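(* Consider the following problem: given an instance of gGASP whose underlying graph $(N,L)$ is acyclic, decide whether it admits an individually stable feasible assignment, and find one if it exists. This problem is fixed-parameter tractable with respect to the number $p=|A^*|$ of non-void activities.
   Context: An instance of gGASP consists of: players $N=[n]$; activities $A=A^*\cup\{a_\emptyset\}$ with $A^*$ the non-void activities and $a_\emptyset$ the void activity; for each player $i$ a complete and transitive preference relation $\succeq_i$ (indifferences allowed) over $X=(A^*\times[n])\cup\{(a_\emptyset,1)\}$; and links $L\subseteq\{\{i,j\}:i\ne j\in N\}$. A feasible assignment is a map $\pi:N\to A$ such that each $\pi^a=\{i:\pi(i)=a\}$, $a\in A^*$, is connected in $(N,L)$ (empty allowed). $\pi_i=\pi^{\pi(i)}$ if $\pi(i)\ne a_\emptyset$, else $\pi_i=\{i\}$. $\pi$ is individually rational if $(\pi(i),|\pi_i|)\succeq_i(a_\emptyset,1)$ for all $i$. Player $i$ has an IS-deviation to $a\in A^*\setminus\{\pi(i)\}$ if $\pi^a\cup\{i\}$ is connected, $(a,|\pi^a|+1)\succ_i(\pi(i),|\pi_i|)$, and $(a,|\pi^a|+1)\succeq_j(a,|\pi^a|)$ for all $j\in\pi^a$. $\pi$ is individually stable if it is individually rational and no player has an IS-deviation. *)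

(* Defs.v *)
From mathcomp Require Import all_boot.
Set Implicit Arguments. Unset Strict Implicit. Unset Printing Implicit Defensive.

(* Players N = 'I_n, non-void activities A^* = 'I_p, the void activity is
   None in (option 'I_p).  Alternatives X are represented in
   option ('I_p * nat): None = (a_void, 1), Some (a, k) = (a, k).
   Only the elements listed in [alts n p] (k in 1..n) are genuine
   members of X; preferences are only constrained/used on them.       *)

Definition alt (p : nat) := option ('I_p * nat).

Definition alts (n p : nat) : seq (alt p) :=
  None :: [seq Some (a, k) | a <- enum 'I_p, k <- iota 1 n].

Definition weak_order_on (n p : nat) (R : rel (alt p)) : Prop :=
  (forall x y, x \in alts n p -> y \in alts n p -> R x y || R y x) /\
  (forall x y z, x \in alts n p -> y \in alts n p -> z \in alts n p ->
     R x y -> R y z -> R x z).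

Definition strict (p : nat) (R : rel (alt p)) (x y : alt p) : bool :=
  R x y && ~~ R y x.

Definition links_ok (n : nat) (L : {set {set 'I_n}}) : Prop :=
  forall e, e \in L -> #|e| = 2.

Definition adj (n : nat) (L : {set {set 'I_n}}) : rel 'I_n :=
  fun i j => (i != j) && ([set i; j] \in L).

Definition acyclic (n : nat) (L : {set {set 'I_n}}) : Prop :=
  ~ exists s : seq 'I_n, [/\ 3 <= size s, uniq s & cycle (adj L) s].

(* S induces a connected subgraph (the empty set is connected) *)
Definition connectedS (n : nat) (L : {set {set 'I_n}}) (S : {set 'I_n}) : Prop :=
  {in S &, forall x y,
     connect [rel u v | adj L u v && (u \in S) && (v \in S)] x y}.

Section Assign.
Variables (n p : nat).
Implicit Types (pi : 'I_n -> option 'I_p).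

Definition coalition pi (a : 'I_p) : {set 'I_n} := [set i | pi i == Some a].

Definition pos pi (i : 'I_n) : alt p :=
  match pi i with
  | Some a => Some (a, #|coalition pi a|)
  | None => None
  end.

Definition feasible (L : {set {set 'I_n}}) pi : Prop :=
  forall a : 'I_p, connectedS L (coalition pi a).

Definition indiv_rational (pref : 'I_n -> rel (alt p)) pi : Prop :=
  forall i, pref i (pos pi i) None.

Definition IS_deviation (L : {set {set 'I_n}}) (pref : 'I_n -> rel (alt p))
    pi (i : 'I_n) (a : 'I_p) : Prop :=
  [/\ pi i != Some a,
      connectedS L (i |: coalition pi a),
      strict (pref i) (Some (a, #|coalition pi a|.+1)) (pos pi i) &
      forall j, j \in coalition pi a ->
        pref j (Some (a, #|coalition pi a|.+1)) (Some (a, #|coalition pi a|))].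

Definition indiv_stable (L : {set {set 'I_n}}) (pref : 'I_n -> rel (alt p)) pi
  : Prop :=
  [/\ feasible L pi, indiv_rational pref pi &
      forall i a, ~ IS_deviation L pref pi i a].

End Assign.

(* Part 2: a machine model (unit-cost RAM with +, truncated -,          *)
(* indirect addressing), polynomially equivalent to Turing machines.   *)

Inductive instr : Type :=
| IConst of nat & nat
| IAdd of nat & nat & nat
| ISub of nat & nat & nat
| ILoad of nat & nat
| IStore of nat & nat
| IJz of nat & nat
| IJmp of nat
| IHalt.

Definition program := seq instr.

Record state := State { pc : nat; mem : nat -> nat }.

Definition upd (m : nat -> nat) (r v : nat) : nat -> nat :=
  fun x => if x == r then v else m x.

Definition step (P : program) (s : state) : state :=
  let m := mem s in
  match nth IHalt P (pc s) with
  | IConst r k => State (pc s).+1 (upd m r k)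
  | IAdd d a b => State (pc s).+1 (upd m d (m a + m b))
  | ISub d a b => State (pc s).+1 (upd m d (m a - m b))
  | ILoad d a => State (pc s).+1 (upd m d (m (m a)))
  | IStore a b => State (pc s).+1 (upd m (m a) (m b))
  | IJz r l => State (if m r == 0 then l else (pc s).+1) m
  | IJmp l => State l m
  | IHalt => s
  end.

Definition halted (P : program) (s : state) : bool :=
  if nth IHalt P (pc s) is IHalt then true else false.

Definition init (x : seq nat) : state :=
  State 0 (fun r => if r is r'.+1 then nth 0 x r' else size x).

Definition output (s : state) : seq nat :=
  [seq mem s i.+1 | i <- iota 0 (mem s 0)].

(* P, started on x, halts within t steps with output y
   (IHalt is a fixed point of [step]) *)
Definition runs_within (P : program) (x : seq nat) (t : nat) (y : seq nat) : Prop :=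
  let s := iter t (step P) (init x) in halted P s /\ output s = y.

Definition computable_fun (f : nat -> nat) : Prop :=
  exists Pf : program, forall k, exists t, runs_within Pf [:: k] t [:: f k].

Definition encode_instance (n p : nat) (L : {set {set 'I_n}})
    (pref : 'I_n -> rel (alt p)) : seq nat :=
  [:: n; p] ++
  [seq nat_of_bool (adj L i j) | i <- enum 'I_n, j <- enum 'I_n] ++
  flatten [seq [seq nat_of_bool (pref i x y) | x <- alts n p, y <- alts n p]
          | i <- enum 'I_n].

Definition code_activity (p : nat) (o : option 'I_p) : nat :=
  if o is Some a then (nat_of_ord a).+1 else 0.

(* answer "yes, here is pi": 1 :: codes of pi(0), ..., pi(n-1);
   answer "no": [:: 0] *)
Definition encode_solution (n p : nat) (pi : 'I_n -> option 'I_p) : seq nat :=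
  1 :: [seq code_activity (pi i) | i <- enum 'I_n].

Definition correct_answer (n p : nat) (L : {set {set 'I_n}})
    (pref : 'I_n -> rel (alt p)) (y : seq nat) : Prop :=
  (exists pi, indiv_stable L pref pi /\ y = encode_solution pi) \/
  ((~ exists pi, indiv_stable L pref pi) /\ y = [:: 0]).

(* Main.v *)
Require Import Defs.
From mathcomp Require Import all_boot zify.
Set Implicit Arguments. Unset Strict Implicit. Unset Printing Implicit Defensive.

(** Repeatedly removing a vertex with at most one remaining neighbour orders the
    forest so that each vertex has at most one later neighbour, its parent; a
    virtual root [n] collects the vertices without one.  Label each player with
    an activity [a], the final size [k] of its coalition, and a bit saying that
    all members accept one more; for a fixed set [B] of used activities,
    stability then becomes a condition on single players and on edges, except
    that each coalition must have one top vertex (connectedness), [k] members,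
    and an objector if the bit is off.  These are tracked from the leaves to the
    root by a table indexed by a vertex, its label, the current size of its
    coalition, whether an objector was met, and the set of activities completed
    below it: at most f(p) n^3 states.  Guessing [B] and merging tables along the
    edges decides solvability, and fixing the players' activities one after the
    other turns the decision procedure into a search.

    The algorithm is written in a language of bounded loops over variables and
    unbounded arrays, whose total semantics makes it verifiable equationally and
    whose running time is polynomial in the loop bounds; a compiler carries it to
    the RAM. *)

(** * A bounded-loop language and its compiler *)

(** The obstacle is that an IS-deviation depends on the final size of a coalition and on the consent
    of all its members, neither of which is known while only a subtree has been seen. Guessing both
    in the label makes every deviation visible locally. A player can join a nonempty coalition only
    next to one of its members, so this deviation is seen on an edge; a move to an empty activity is
    seen at the player alone once [B] is guessed. The two values of the bit need different proofs:
    when it is on, each member checks its own consent; when it is off, it would excuse deviations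
    without reason unless some member really refuses, hence the search for an objector. The set of
    completed activities keeps an activity from reappearing in a distant part of the forest, which
    would disconnect its coalition; together with the guess of [B] it is the only exponential
    ingredient. *)

Inductive expr :=
| EV of nat
| EC of nat
| EAdd of expr & expr
| ESub of expr & expr
| ERd of nat & expr
| EIf of expr & expr & expr
| ESum of nat & nat & expr
| ELet of nat & expr & nat & expr & expr.

Inductive cmd :=
| CSet of nat & expr
| CStore of nat & expr & expr
| CSeq of cmd & cmd
| CIf of expr & cmd & cmd
| CFor of nat & nat & cmd.

Record store := Store { va : nat -> nat; ar : nat -> nat -> nat }.

(** The bounds of sums and loops are variables rather than expressions: a limit on a few variables
    then limits the running time, whatever the arrays contain. In [ELet] both definitions are
    evaluated outside the scope of either name. *)
Fixpoint eval (ev : nat -> nat) (A : nat -> nat -> nat) (e : expr) : nat :=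
  match e with
  | EV x => ev x
  | EC k => k
  | EAdd e1 e2 => eval ev A e1 + eval ev A e2
  | ESub e1 e2 => eval ev A e1 - eval ev A e2
  | ERd a e => A a (eval ev A e)
  | EIf c e1 e2 => if eval ev A c == 0 then eval ev A e2 else eval ev A e1
  | ESum x y e => sumn [seq eval (upd ev x i) A e | i <- iota 0 (ev y)]
  | ELet x e1 y e2 b => eval (upd (upd ev x (eval ev A e1)) y (eval ev A e2)) A b
  end.

Definition set_var (s : store) x v := Store (upd (va s) x v) (ar s).
Definition set_cell (s : store) a i v :=
  Store (va s) (fun b => if b == a then upd (ar s a) i v else ar s b).

Fixpoint exec (c : cmd) (s : store) : store :=
  match c with
  | CSet x e => set_var s x (eval (va s) (ar s) e)
  | CStore a e1 e2 =>
      set_cell s a (eval (va s) (ar s) e1) (eval (va s) (ar s) e2)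
  | CSeq c1 c2 => exec c2 (exec c1 s)
  | CIf e c1 c2 =>
      if eval (va s) (ar s) e == 0 then exec c2 s else exec c1 s
  | CFor x y c =>
      foldl (fun s i => exec c (set_var s x i)) s (iota 0 (va s y))
  end.

(** The exact number of steps of the compiled code, so that the simulation is an equality of states;
    the numerals count the instructions executed around the code of the subterms. *)
Fixpoint cost_expr (ev : nat -> nat) (A : nat -> nat -> nat) (e : expr) : nat :=
  match e with
  | EV x => 2
  | EC k => 1
  | EAdd e1 e2 => cost_expr ev A e1 + (cost_expr ev A e2 + 1)
  | ESub e1 e2 => cost_expr ev A e1 + (cost_expr ev A e2 + 1)
  | ERd a e => cost_expr ev A e + 8
  | EIf c e1 e2 => cost_expr ev A c +
      (1 + if eval ev A c == 0 then cost_expr ev A e2 else cost_expr ev A e1 + 1)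
  | ESum x y e =>
      4 + (sumn [seq (cost_expr (upd ev x i) A e + 6) | i <- iota 0 (ev y)] + 1)
  | ELet x e1 y e2 b => cost_expr ev A e1 + (cost_expr ev A e2 +
      (cost_expr (upd (upd ev x (eval ev A e1)) y (eval ev A e2)) A b + 2))
  end.

Fixpoint cost (c : cmd) (s : store) : nat :=
  match c with
  | CSet x e => cost_expr (va s) (ar s) e + 2
  | CStore a e1 e2 =>
      cost_expr (va s) (ar s) e1 + (7 + (cost_expr (va s) (ar s) e2 + 1))
  | CSeq c1 c2 => cost c1 s + cost c2 (exec c1 s)
  | CIf e c1 c2 => cost_expr (va s) (ar s) e +
      (1 + if eval (va s) (ar s) e == 0 then cost c2 s else cost c1 s + 1)
  | CFor x y c =>
      3 + ((foldl (fun st i =>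
              (exec c (set_var st.1 x i), st.2 + (cost c (set_var st.1 x i) + 7)))
            (s, 0) (iota 0 (va s y))).2 + 1)
  end.

(** Jump targets are absolute, so a block has to know the length of its parts before it is
    emitted. *)
Fixpoint code_size_expr (e : expr) : nat :=
  match e with
  | EV x => 2
  | EC k => 1
  | EAdd e1 e2 | ESub e1 e2 => code_size_expr e1 + (code_size_expr e2 + 1)
  | ERd a e => code_size_expr e + 8
  | EIf c e1 e2 =>
      code_size_expr c + (1 + (code_size_expr e1 + (1 + code_size_expr e2)))
  | ESum x y e => 4 + (1 + (code_size_expr e + 5))
  | ELet x e1 y e2 b =>
      code_size_expr e1 + (code_size_expr e2 + (code_size_expr b + 2))
  end.

Fixpoint code_size (c : cmd) : nat :=
  match c with
  | CSet x e => code_size_expr e + 2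
  | CStore a e1 e2 => code_size_expr e1 + (7 + (code_size_expr e2 + 1))
  | CSeq c1 c2 => code_size c1 + code_size c2
  | CIf e c1 c2 => code_size_expr e + (1 + (code_size c1 + (1 + code_size c2)))
  | CFor x y c => 3 + (3 + (code_size c + 4))
  end.

(* Register 0 holds the base address; cell [i] of array [a < 16] lives at
   [base + 16 * i + a], so the arrays are unbounded and never overlap. *)
Definition address_code a d :=
  [:: IAdd d d d; IAdd d d d; IAdd d d d; IAdd d d d; IAdd d d 0;
      IConst d.+1 a; IAdd d d d.+1].

(* [rho] maps variables to registers; the value ends up in register [d], and
   only registers from [d] on are overwritten.  [o] is the position of the code. *)
Fixpoint comp_expr (rho : nat -> nat) (d o : nat) (e : expr) : seq instr :=
  match e with
  | EV x => [:: IConst d 0; IAdd d d (rho x)]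
  | EC k => [:: IConst d k]
  | EAdd e1 e2 => comp_expr rho d o e1 ++
      (comp_expr rho d.+1 (o + code_size_expr e1) e2 ++ [:: IAdd d d d.+1])
  | ESub e1 e2 => comp_expr rho d o e1 ++
      (comp_expr rho d.+1 (o + code_size_expr e1) e2 ++ [:: ISub d d d.+1])
  | ERd a e => comp_expr rho d o e ++ (address_code a d ++ [:: ILoad d d])
  | EIf c e1 e2 =>
      let o1 := o + code_size_expr c + 1 in
      let o2 := o1 + code_size_expr e1 + 1 in
      comp_expr rho d o c ++ ([:: IJz d o2] ++ (comp_expr rho d o1 e1 ++
      ([:: IJmp (o2 + code_size_expr e2)] ++ comp_expr rho d o2 e2)))
  | ESum x y e =>
      [:: IConst d 0; IConst d.+1 0; IAdd d.+1 d.+1 (rho y); IConst d.+2 0] ++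
      ([:: IJz d.+1 (o + 4 + 1 + code_size_expr e + 5)] ++
      (comp_expr (upd rho x d.+2) d.+3 (o + 4 + 1) e ++
       [:: IAdd d d d.+3; IConst d.+3 1; ISub d.+1 d.+1 d.+3;
           IAdd d.+2 d.+2 d.+3; IJmp (o + 4)]))
  | ELet x e1 y e2 b =>
      let o2 := o + code_size_expr e1 in
      comp_expr rho d o e1 ++ (comp_expr rho d.+1 o2 e2 ++
      (comp_expr (upd (upd rho x d) y d.+1) d.+2 (o2 + code_size_expr e2) b ++
       [:: IConst d 0; IAdd d d d.+2]))
  end.

Fixpoint comp (d o : nat) (c : cmd) : seq instr :=
  match c with
  | CSet x e => comp_expr succn d o e ++ [:: IConst x.+1 0; IAdd x.+1 x.+1 d]
  | CStore a e1 e2 => comp_expr succn d o e1 ++ (address_code a d ++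
      (comp_expr succn d.+1 (o + code_size_expr e1 + 7) e2 ++ [:: IStore d d.+1]))
  | CSeq c1 c2 => comp d o c1 ++ comp d (o + code_size c1) c2
  | CIf e c1 c2 =>
      let o1 := o + code_size_expr e + 1 in
      let o2 := o1 + code_size c1 + 1 in
      comp_expr succn d o e ++ ([:: IJz d o2] ++ (comp d o1 c1 ++
      ([:: IJmp (o2 + code_size c2)] ++ comp d o2 c2)))
  | CFor x y c =>
      [:: IConst d 0; IAdd d d y.+1; IConst d.+1 0] ++
      ([:: IJz d (o + 3 + 3 + code_size c + 4); IConst x.+1 0;
           IAdd x.+1 x.+1 d.+1] ++
      (comp d.+2 (o + 3 + 3) c ++
       [:: IConst d.+2 1; ISub d d d.+2; IAdd d.+1 d.+1 d.+2; IJmp (o + 3)]))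
  end.

(* [wf_expr nv low d e]: the variables of [e] are below [nv], its arrays below
   16, and its code at depth [d] only touches registers below [low]. *)
Fixpoint wf_expr (nv low d : nat) (e : expr) : bool :=
  match e with
  | EV x => (x < nv) && (d < low)
  | EC k => d < low
  | EAdd e1 e2 | ESub e1 e2 => wf_expr nv low d e1 && wf_expr nv low d.+1 e2
  | ERd a e => [&& a < 16, d.+1 < low & wf_expr nv low d e]
  | EIf c e1 e2 =>
      [&& wf_expr nv low d c, wf_expr nv low d e1 & wf_expr nv low d e2]
  | ESum x y e => [&& x < nv, y < nv, d.+3 < low & wf_expr nv low d.+3 e]
  | ELet x e1 y e2 b => [&& x < nv, y < nv, wf_expr nv low d e1,
      wf_expr nv low d.+1 e2 & wf_expr nv low d.+2 b]
  end.

Fixpoint wf (nv low d : nat) (c : cmd) : bool :=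
  match c with
  | CSet x e => (x < nv) && wf_expr nv low d e
  | CStore a e1 e2 => [&& a < 16, d.+1 < low, wf_expr nv low d e1
                       & wf_expr nv low d.+1 e2]
  | CSeq c1 c2 => wf nv low d c1 && wf nv low d c2
  | CIf e c1 c2 => [&& wf_expr nv low d e, wf nv low d c1 & wf nv low d c2]
  | CFor x y c => [&& x < nv, y < nv, d.+2 < low & wf nv low d.+2 c]
  end.

(** * Correctness of the compiler *)

Lemma size_comp_expr rho d o e : size (comp_expr rho d o e) = code_size_expr e.
Proof.
elim: e rho d o => //=.
- by move=> e1 H1 e2 H2 rho d o; rewrite !size_cat H1 H2.
- by move=> e1 H1 e2 H2 rho d o; rewrite !size_cat H1 H2.
- by move=> a e H rho d o; rewrite size_cat H.
- by move=> c H e1 H1 e2 H2 rho d o; rewrite size_cat H /= size_cat H1 /= H2.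
- by move=> x y e H rho d o; rewrite size_cat H.
- by move=> x e1 H1 y e2 H2 b H rho d o; rewrite !size_cat H1 H2 H.
Qed.

Lemma size_comp d o c : size (comp d o c) = code_size c.
Proof.
elim: c d o => //=.
- by move=> x e d o; rewrite size_cat size_comp_expr.
- by move=> a e1 e2 d o; rewrite size_cat /= size_cat !size_comp_expr.
- by move=> c1 H1 c2 H2 d o; rewrite size_cat H1 H2.
- by move=> e c1 H1 c2 H2 d o; rewrite size_cat size_comp_expr /= size_cat H1 /= H2.
- by move=> x y c H d o; rewrite size_cat H.
Qed.

Definition code_at (P : program) o (l : seq instr) :=
  forall i, i < size l -> nth IHalt P (o + i) = nth IHalt l i.

Lemma code_at_cat P o l1 l2 :
  code_at P o (l1 ++ l2) -> code_at P o l1 /\ code_at P (o + size l1) l2.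
Proof.
move=> H; split=> i Hi.
  by rewrite H ?size_cat ?ltn_addr // nth_cat Hi.
rewrite -addnA H ?size_cat ?ltn_add2l // nth_cat ltnNge leq_addr /=.
by rewrite addKn.
Qed.

Definition run (P : program) o m t o' m' :=
  iter t (step P) (State o m) = State o' m'.

Lemma run_cat P o m t1 o1 m1 t2 o2 m2 :
  run P o m t1 o1 m1 -> run P o1 m1 t2 o2 m2 -> run P o m (t1 + t2) o2 m2.
Proof. by rewrite /run => H1 H2; rewrite addnC iterD H1. Qed.

Definition straight (i : instr) :=
  match i with IJz _ _ | IJmp _ | IHalt => false | _ => true end.

Definition effect (m : nat -> nat) (i : instr) : nat -> nat :=
  match i with
  | IConst r k => upd m r k
  | IAdd d a b => upd m d (m a + m b)
  | ISub d a b => upd m d (m a - m b)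
  | ILoad d a => upd m d (m (m a))
  | IStore a b => upd m (m a) (m b)
  | _ => m
  end.

Lemma run_straight P o m l : code_at P o l -> all straight l ->
  run P o m (size l) (o + size l) (foldl effect m l).
Proof.
elim: l o m => [|i l IH] o m /=; first by rewrite addn0.
move=> H /andP[Hi Hl]; rewrite -add1n.
apply: (@run_cat _ _ _ _ o.+1 (effect m i)).
  have /= Hn := H 0 isT; rewrite addn0 in Hn.
  by rewrite /run /= /step /= Hn; case: (i) Hi.
rewrite add1n addnS -addSn; apply: IH => // j Hj.
by rewrite addSnnS H.
Qed.

Lemma run_jz P o m r l : code_at P o [:: IJz r l] ->
  run P o m 1 (if m r == 0 then l else o + 1) m.
Proof.
by move=> /(_ 0 isT) /=; rewrite addn0 /run /= /step /= => ->; rewrite addn1.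
Qed.

Lemma run_jmp P o m l : code_at P o [:: IJmp l] -> run P o m 1 l m.
Proof. by move=> /(_ 0 isT) /=; rewrite addn0 /run /= /step /= => ->. Qed.

Lemma updE m r v x : upd m r v x = if x == r then v else m x.
Proof. by []. Qed.

Lemma upd_same m r v : upd m r v r = v.
Proof. by rewrite /upd eqxx. Qed.

Lemma upd_other m r v x : x != r -> upd m r v x = m x.
Proof. by rewrite /upd => /negbTE ->. Qed.

Definition arrays_at (m : nat -> nat) base (A : nat -> nat -> nat) :=
  forall a i, a < 16 -> m (base + i * 16 + a) = A a i.

Definition vars_at (m rho ev : nat -> nat) nv d :=
  forall x, x < nv -> 0 < rho x < d /\ m (rho x) = ev x.

(** Only the window from [d] to below [low] may change: under it lie the variables and pending
    results, above it the arrays. *)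
Definition frame (m m' : nat -> nat) (d low : nat) :=
  forall r, (r < d) || (low <= r) -> m' r = m r.

Lemma frame_trans m1 m2 m3 d d' low : d <= d' ->
  frame m1 m2 d low -> frame m2 m3 d' low -> frame m1 m3 d low.
Proof.
move=> dd H1 H2 r Hr; rewrite H2 ?H1 //.
by case/orP: Hr => [/leq_trans-> //|->]; rewrite orbT.
Qed.

Lemma arrays_frame m m' d low base A : low <= base ->
  frame m m' d low -> arrays_at m base A -> arrays_at m' base A.
Proof.
move=> lb F H a i ai; rewrite F ?H //.
by rewrite (leq_trans lb) ?orbT // -addnA leq_addr.
Qed.

Lemma vars_frame m m' d low rho ev nv d0 d1 : d0 <= d -> d0 <= d1 ->
  frame m m' d low -> vars_at m rho ev nv d0 -> vars_at m' rho ev nv d1.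
Proof.
move=> dd dd1 F H x Hx; have [/andP[h1 h2] h3] := H x Hx.
by rewrite h1 F ?h3 ?(leq_trans h2 dd) ?(leq_trans h2 dd1).
Qed.

Lemma vars_upd m rho ev nv d x r v : 0 < r < d -> m r = v ->
  vars_at m rho ev nv d -> vars_at m (upd rho x r) (upd ev x v) nv d.
Proof. by move=> rd mr H y Hy; rewrite /upd; case: eqP => // _; apply: H. Qed.

Lemma effect_frame m d low l m0 :
  frame m0 m d low ->
  all (fun i => match i with
    | IConst r _ | IAdd r _ _ | ISub r _ _ | ILoad r _ => d <= r < low
    | IStore _ _ => false | _ => true end) l ->
  frame m0 (foldl effect m l) d low.
Proof.
elim: l m => //= i l IH m F /andP[Hi Hl]; apply: IH => // r Hr.
case: i Hi => //=; try by move=> *; apply: F.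
all: by move=> *; rewrite upd_other ?F //; lia.
Qed.

Ltac upd_simpl := rewrite /= ?updE; repeat first
  [ rewrite eqxx
  | match goal with |- context [@eq_op _ ?a ?b] =>
      (have -> : (a == b) = false by lia) end ]; rewrite /= ?updE.

(** The first four instructions are doublings that multiply by 16, the machine having no
    multiplication. *)
Lemma address_codeE m a d base : 0 < d -> m 0 = base ->
  foldl effect m (address_code a d) d = base + m d * 16 + a.
Proof. by move=> d0 m0; upd_simpl; rewrite m0; lia. Qed.

Ltac fr := first [ by apply: effect_frame; [by move=> ? ?|rewrite /=; lia] ].

Lemma wf_expr_low nv low e d : wf_expr nv low d e -> d < low.
Proof.
elim: e d => //=.
- by move=> x d /andP[].
- by move=> e1 IH1 e2 _ d /andP[/IH1].
- by move=> e1 IH1 e2 _ d /andP[/IH1].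
- by move=> a e _ d /and3P[_ /ltnW].
- by move=> c IH e1 _ e2 _ d /and3P[/IH].
- by move=> x y e _ d /and4P[_ _ dl _]; lia.
- by move=> x e1 IH y e2 _ b _ d /and5P[_ _ /IH].
Qed.

(** The map [rho], the depth and the environment vary in the induction, because [ESum] and [ELet]
    bind their variables to work registers at the current depth and continue deeper. *)
Lemma comp_exprP P nv low base A : low <= base -> forall e rho d o ev m,
  wf_expr nv low d e -> 0 < d -> m 0 = base -> arrays_at m base A ->
  vars_at m rho ev nv d -> code_at P o (comp_expr rho d o e) ->
  exists m', [/\ run P o m (cost_expr ev A e) (o + code_size_expr e) m',
    m' d = eval ev A e & frame m m' d low].
Proof.
move=> lb.
have base_frame m m' d : 0 < d -> frame m m' d low -> m 0 = base -> m' 0 = base.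
  by move=> d0 F <-; apply: F; rewrite d0.
have binop (f : nat -> nat -> nat) i : forall e1 e2,
  (forall m d, effect m (i d) = upd m d (f (m d) (m d.+1))) ->
  (forall d, straight (i d)) ->
  (forall rho d o ev m,
    wf_expr nv low d e1 -> 0 < d -> m 0 = base -> arrays_at m base A ->
    vars_at m rho ev nv d -> code_at P o (comp_expr rho d o e1) ->
    exists m', [/\ run P o m (cost_expr ev A e1) (o + code_size_expr e1) m',
      m' d = eval ev A e1 & frame m m' d low]) ->
  (forall rho d o ev m,
    wf_expr nv low d e2 -> 0 < d -> m 0 = base -> arrays_at m base A ->
    vars_at m rho ev nv d -> code_at P o (comp_expr rho d o e2) ->
    exists m', [/\ run P o m (cost_expr ev A e2) (o + code_size_expr e2) m',
      m' d = eval ev A e2 & frame m m' d low]) ->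
  forall rho d o ev m,
    wf_expr nv low d e1 && wf_expr nv low d.+1 e2 ->
    0 < d -> m 0 = base -> arrays_at m base A ->
    vars_at m rho ev nv d -> code_at P o (comp_expr rho d o e1 ++
      (comp_expr rho d.+1 (o + code_size_expr e1) e2 ++ [:: i d])) ->
    d < low ->
    exists m', [/\ run P o m (cost_expr ev A e1 + (cost_expr ev A e2 + 1))
       (o + (code_size_expr e1 + (code_size_expr e2 + 1))) m',
      m' d = f (eval ev A e1) (eval ev A e2) & frame m m' d low].
  move=> e1 e2 Ei Si IH1 IH2 rho d o ev m /andP[w1 w2] d0 m0 mA mv.
  move=> /code_at_cat[]; rewrite size_comp_expr => C1 /code_at_cat[].
  rewrite size_comp_expr => C2 C3 dl.
  have [m1 [R1 E1 F1]] := IH1 _ _ _ _ _ w1 d0 m0 mA mv C1.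
  have [m2 [R2 E2 F2]] := IH2 _ _ _ _ _ w2 (ltn0Sn _) (base_frame _ _ _ d0 F1 m0)
    (arrays_frame lb F1 mA) (vars_frame (leqnn d) (leqnSn d) F1 mv) C2.
  exists (effect m2 (i d)); split.
  - apply: (run_cat R1); rewrite addnA; apply: (run_cat R2).
    by rewrite addnA; apply: (@run_straight _ _ _ [:: i d]); rewrite //= Si.
  - by rewrite Ei upd_same E2 F2 ?E1 // ltnSn.
  - move=> r Hr; rewrite Ei upd_other; last by lia.
    by rewrite F2 ?F1 //; lia.
elim=> /=.
- move=> x rho d o ev m /andP[Hx Hd] d0 m0 mA mv C.
  exists (foldl effect m [:: IConst d 0; IAdd d d (rho x)]); split.
  + exact: (run_straight m C isT).
  + have [/andP[h1 h2] h3] := mv _ Hx; upd_simpl; lia.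
  + by fr.
- move=> k rho d o ev m Hd d0 m0 mA mv C.
  exists (foldl effect m [:: IConst d k]); split.
  + exact: (run_straight m C isT).
  + by upd_simpl.
  + by fr.
- move=> e1 IH1 e2 IH2 rho d o ev m W d0 m0 mA mv C.
  have dl : d < low by case/andP: W => /wf_expr_low.
  exact: (@binop addn (fun d => IAdd d d d.+1) e1 e2 (fun _ _ => erefl)
    (fun _ => isT) IH1 IH2 rho d o ev m W).
- move=> e1 IH1 e2 IH2 rho d o ev m W d0 m0 mA mv C.
  have dl : d < low by case/andP: W => /wf_expr_low.
  exact: (@binop subn (fun d => ISub d d d.+1) e1 e2 (fun _ _ => erefl)
    (fun _ => isT) IH1 IH2 rho d o ev m W).
- move=> a e IH rho d o ev m /and3P[a16 dl W] d0 m0 mA mv.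
  move=> /code_at_cat[C1]; rewrite size_comp_expr => C2.
  have [m1 [R1 E1 F1]] := IH _ _ _ _ _ W d0 m0 mA mv C1.
  exists (foldl effect m1 (address_code a d ++ [:: ILoad d d])); split.
  + by apply: (run_cat R1); rewrite addnA; exact: (run_straight m1 C2 isT).
  + rewrite foldl_cat; set m2 := foldl effect m1 _.
    have F2 : frame m1 m2 d low by fr.
    rewrite /= upd_same /m2 (address_codeE _ d0 (base_frame _ _ _ d0 F1 m0)) E1 -/m2.
    by apply: (arrays_frame lb F2 (arrays_frame lb F1 mA)).
  + by apply: effect_frame => //=; lia.
- move=> c IHc e1 IH1 e2 IH2 rho d o ev m /and3P[wc w1 w2] d0 m0 mA mv.
  move=> /code_at_cat[Cc]; rewrite size_comp_expr => /(@code_at_cat P _ [:: _])[Cj].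
  rewrite [size [:: _]]/= => /code_at_cat[C1]; rewrite size_comp_expr.
  move=> /(@code_at_cat P _ [:: _])[Cm]; rewrite [size [:: _]]/= => C2.
  have [m1 [R1 E1 F1]] := IHc _ _ _ _ _ wc d0 m0 mA mv Cc.
  have Rj := run_jz m1 Cj; rewrite E1 in Rj.
  have m1A := arrays_frame lb F1 mA; have m1v := vars_frame (leqnn d) (leqnn d) F1 mv.
  have m10 := base_frame _ _ _ d0 F1 m0.
  case: (eval ev A c == 0) Rj => Rj.
    have [m2 [R2 E2 F2]] := IH2 _ _ _ _ _ w2 d0 m10 m1A m1v C2.
    exists m2; split=> //; last exact: frame_trans F1 F2.
    apply: (run_cat R1); apply: (run_cat Rj).
    by move: R2; congr (run _ _ _ _ _ _); lia.
  have [m2 [R2 E2 F2]] := IH1 _ _ _ _ _ w1 d0 m10 m1A m1v C1.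
  exists m2; split=> //; last exact: frame_trans F1 F2.
  apply: (run_cat R1); apply: (run_cat Rj); apply: (run_cat R2).
  by move: (run_jmp m2 Cm); congr (run _ _ _ _ _ _); lia.
- move=> x y e IH rho d o ev m /and4P[xn yn dl W] d0 m0 mA mv.
  move=> /(@code_at_cat P o [:: _; _; _; _])[C0].
  move=> /(@code_at_cat P _ [:: _])[Cj]; rewrite [size [:: _]]/=.
  rewrite [size [:: _; _; _; _]]/= in Cj *.
  move=> /code_at_cat[Ce]; rewrite size_comp_expr.
  rewrite -[[:: _; _; _; _; _]]/([:: _; _; _; _] ++ [:: _]) => /code_at_cat[Cs].
  rewrite [size [:: _; _; _; _]]/= => Cm.
  (* Register [d] accumulates the sum, [d.+1] counts the remaining iterations down, and [d.+2] holds
     the index, to which [x] is bound. *)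
  have loop k : forall i m, m 0 = base -> arrays_at m base A ->
     vars_at m rho ev nv d -> m d.+1 = k -> m d.+2 = i ->
     exists m', [/\ run P (o + 4) m
       (sumn [seq (cost_expr (upd ev x i) A e + 6) | i <- iota i k] + 1)
       (o + (4 + (1 + (code_size_expr e + 5)))) m',
       m' d = m d + sumn [seq eval (upd ev x i) A e | i <- iota i k]
       & frame m m' d low].
    elim: k => [|k IHk] i m1 m10 m1A m1v mk mi.
      exists m1; split=> //=; last by rewrite addn0.
      have := run_jz m1 Cj; rewrite mk eqxx add0n.
      by congr (run _ _ _ _ _ _); lia.
    have Rj := run_jz m1 Cj; rewrite mk /= in Rj.
    have m1v' : vars_at m1 (upd rho x d.+2) (upd ev x i) nv d.+3.
      apply: vars_upd => //; first by lia.
      by apply: (@vars_frame m1 m1 d low) m1v => //; lia.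
    have [m2 [R2 E2 F2]] := IH _ _ _ _ _ W (ltn0Sn _) m10 m1A m1v' Ce.
    set m3 := foldl effect m2 [:: IAdd d d d.+3; IConst d.+3 1;
      ISub d.+1 d.+1 d.+3; IAdd d.+2 d.+2 d.+3].
    have F3 : frame m1 m3 d low.
      apply: effect_frame => /=; last lia.
      by move=> r Hr; apply: F2; lia.
    have m20 : m2 0 = base by rewrite F2.
    have h1 : m2 d.+1 = k.+1 by rewrite F2 //; lia.
    have h2 : m2 d.+2 = i by rewrite F2 //; lia.
    have h3 : m2 d = m1 d by rewrite F2 //; lia.
    have [|||||m4 [R4 E4 F4]] := IHk i.+1 m3.
    + exact: base_frame F3 m10.
    + exact: arrays_frame F3 m1A.
    + exact: (vars_frame (leqnn d) (leqnn d) F3 m1v).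
    + by rewrite /m3; upd_simpl; rewrite h1; lia.
    + by rewrite /m3; upd_simpl; rewrite h2; lia.
    exists m4; split; last exact: frame_trans F3 F4.
    + rewrite /=; set S := sumn _.
      have -> : cost_expr (upd ev x i) A e + 6 + S + 1 =
        1 + (cost_expr (upd ev x i) A e + (4 + (1 + (S + 1)))) by lia.
      apply: (run_cat Rj); apply: (run_cat R2).
      apply: (run_cat (run_straight m2 Cs isT)).
      exact: run_cat (run_jmp _ Cm) R4.
    + rewrite E4 /m3 /=; upd_simpl; rewrite h3 E2; lia.
  set m1 := foldl effect m [:: IConst d 0; IConst d.+1 0; IAdd d.+1 d.+1 (rho y);
    IConst d.+2 0].
  have F1 : frame m m1 d low by fr.
  have [/andP[y1 y2] y3] := mv _ yn.
  have [|||||m2 [R2 E2 F2]] := loop (ev y) 0 m1.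
  + exact: base_frame F1 m0.
  + exact: arrays_frame F1 mA.
  + exact: (vars_frame (leqnn d) (leqnn d) F1 mv).
  + by rewrite /m1; upd_simpl; rewrite y3.
  + by rewrite /m1; upd_simpl.
  exists m2; split; last exact: frame_trans F1 F2.
    by apply: run_cat R2; apply: (run_straight m C0 isT).
  by rewrite E2 /m1; upd_simpl.
- move=> x e1 IH1 y e2 IH2 b IH rho d o ev m /and5P[xn yn w1 w2 w] d0 m0 mA mv.
  move=> /code_at_cat[C1]; rewrite size_comp_expr => /code_at_cat[C2].
  rewrite size_comp_expr => /code_at_cat[Cb]; rewrite size_comp_expr => Cs.
  have [m1 [R1 E1 F1]] := IH1 _ _ _ _ _ w1 d0 m0 mA mv C1.
  have m10 := base_frame _ _ _ d0 F1 m0; have m1A := arrays_frame lb F1 mA.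
  have m1v := vars_frame (leqnn d) (leqnn d) F1 mv.
  have [m2 [R2 E2 F2]] := IH2 _ _ _ _ _ w2 (ltn0Sn _) m10 m1A
    (vars_frame (leqnn d) (leqnSn d) F1 mv) C2.
  have F12 : frame m m2 d low by apply: frame_trans F1 F2; lia.
  have m2d : m2 d = eval ev A e1 by rewrite F2 // ltnSn.
  have m2v : vars_at m2 (upd (upd rho x d) y d.+1)
      (upd (upd ev x (eval ev A e1)) y (eval ev A e2)) nv d.+2.
    apply: vars_upd; [lia|done|]; apply: vars_upd; [lia|done|].
    by apply: (vars_frame _ _ F12 mv); lia.
  have [m3 [R3 E3 F3]] := IH _ _ _ _ _ w (ltn0Sn _) (base_frame _ _ _ d0 F12 m0)
    (arrays_frame lb F12 mA) m2v Cb.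
  have dl := wf_expr_low w.
  exists (foldl effect m3 [:: IConst d 0; IAdd d d d.+2]); split.
  + apply: (run_cat R1); apply: (run_cat R2); apply: (run_cat R3).
    by rewrite !addnA; apply: (run_straight m3 Cs isT).
  + by upd_simpl.
  + apply: effect_frame; last by rewrite /=; lia.
    by apply: frame_trans F12 F3; lia.
Qed.

Lemma arrays_set_cell m base s a i v : a < 16 ->
  arrays_at m base (ar s) ->
  arrays_at (upd m (base + i * 16 + a) v) base (ar (set_cell s a i v)).
Proof.
move=> a16 H b j b16 /=; rewrite /upd.
have -> : (base + j * 16 + b == base + i * 16 + a) = (b == a) && (j == i) by lia.
by case: eqP => [-> /=|_ /=]; [case: ifP => // _|]; rewrite H.
Qed.

Lemma vars_set_var m rho s nv d x v : x < nv ->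
  rho =1 succn -> nv < d -> vars_at m rho (va s) nv d ->
  vars_at (upd m x.+1 v) rho (va (set_var s x v)) nv d.
Proof.
move=> xn rE nd H y yn; have [_ h] := H y yn.
rewrite rE in h *; split; first by lia.
by rewrite /= /upd eqSS; case: eqP.
Qed.

(** A command may change the variables, held in registers 1 to [nv], but has to keep the base
    address and the counters of the enclosing loops. *)
Definition frame_cmd (m m' : nat -> nat) nv d :=
  forall r, r = 0 \/ (nv < r < d) -> m' r = m r.

Lemma compP P nv low base : low <= base -> forall c d o s m,
  wf nv low d c -> nv < d -> m 0 = base -> arrays_at m base (ar s) ->
  vars_at m succn (va s) nv d -> code_at P o (comp d o c) ->
  exists m', [/\ run P o m (cost c s) (o + code_size c) m',
    arrays_at m' base (ar (exec c s)), vars_at m' succn (va (exec c s)) nv d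
    & frame_cmd m m' nv d].
Proof.
move=> lb.
have fc m m' d : nv < d -> frame m m' d low -> frame_cmd m m' nv d.
  by move=> nd F r Hr; apply: F; lia.
have setP m x d s : x < nv -> nv < d -> d < low -> arrays_at m base (ar s) ->
    vars_at m succn (va s) nv d ->
    let m' := foldl effect m [:: IConst x.+1 0; IAdd x.+1 x.+1 d] in
    [/\ arrays_at m' base (ar s), vars_at m' succn (va (set_var s x (m d))) nv d
      & frame_cmd m m' nv d].
  move=> xn nd dl mA mv m'.
  have E r : m' r = upd m x.+1 (m d) r.
    by rewrite /m' /= !updE eqxx; case: (r =P x.+1) => // _; upd_simpl.
  split.
  - by move=> a i a16; rewrite E upd_other ?mA //; lia.
  - move=> y yn; rewrite E.
    exact: (@vars_set_var m succn s nv d x (m d) xn (frefl _) nd mv y yn).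
  - by move=> r Hr; rewrite E upd_other //; lia.
elim=> /=.
- move=> x e d o s m /andP[xn w] nd m0 mA mv /code_at_cat[C1].
  rewrite size_comp_expr => C2.
  have d0 : 0 < d by lia.
  have [m1 [R1 E1 F1]] := comp_exprP lb w d0 m0 mA mv C1.
  have [] := setP m1 x d s xn nd (wf_expr_low w) (arrays_frame lb F1 mA)
    (vars_frame (leqnn d) (leqnn d) F1 mv).
  rewrite E1; set m2 := foldl _ _ _ => m2A m2v F2.
  exists m2; split=> //.
  + by apply: (run_cat R1); rewrite addnA; apply: (run_straight m1 C2 isT).
  + by move=> r Hr; rewrite F2 // (fc _ _ _ nd F1).
- move=> a e1 e2 d o s m /and4P[a16 dl w1 w2] nd m0 mA mv.
  move=> /code_at_cat[C1]; rewrite size_comp_expr.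
  move=> /(@code_at_cat P _ (address_code a d))[C2].
  rewrite [size (address_code _ _)]/= => /code_at_cat[C3].
  rewrite size_comp_expr => C4.
  have d0 : 0 < d by lia.
  have [m1 [R1 E1 F1]] := comp_exprP lb w1 d0 m0 mA mv C1.
  have m10 : m1 0 = base by rewrite F1 ?d0.
  set m2 := foldl effect m1 (address_code a d).
  have F2 : frame m m2 d low by apply: effect_frame => //=; lia.
  have E2 := address_codeE a d0 m10; rewrite -/m2 in E2.
  have m20 : m2 0 = base by rewrite F2 ?d0.
  have [m3 [R3 E3 F3]] := comp_exprP lb w2 (ltn0Sn _) m20 (arrays_frame lb F2 mA)
    (vars_frame (leqnn d) (leqnSn d) F2 mv) C3.
  have F13 : frame m m3 d low by apply: frame_trans F2 F3; lia.
  have E4 : m3 d = base + eval (va s) (ar s) e1 * 16 + a.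
    by rewrite F3 ?ltnSn // E2 E1.
  exists (upd m3 (m3 d) (m3 d.+1)); split=> /=.
  + apply: (run_cat R1); apply: (run_cat (run_straight m1 C2 isT)).
    apply: (run_cat R3); rewrite -!addnA !addnA.
    exact: (run_straight m3 C4 isT).
  + by rewrite E4 E3; apply: arrays_set_cell => //; apply: arrays_frame F13 mA.
  + move=> y yn.
    have [h1 h2] := vars_frame (leqnn d) (leqnn d) F13 mv yn; split=> //.
    by rewrite upd_other ?h2 // E4; lia.
  + move=> r Hr; rewrite upd_other; first exact: (fc _ _ _ nd F13).
    by rewrite E4; lia.
- move=> c1 IH1 c2 IH2 d o s m /andP[w1 w2] nd m0 mA mv /code_at_cat[C1].
  rewrite size_comp => C2.
  have [m1 [R1 A1 V1 F1]] := IH1 _ _ _ _ w1 nd m0 mA mv C1.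
  have m10 : m1 0 = base by rewrite F1 //; left.
  have [m2 [R2 A2 V2 F2]] := IH2 _ _ _ _ w2 nd m10 A1 V1 C2.
  exists m2; split=> //; first by rewrite addnA; apply: run_cat R1 R2.
  by move=> r Hr; rewrite F2 ?F1.
- move=> e c1 IH1 c2 IH2 d o s m /and3P[we w1 w2] nd m0 mA mv.
  move=> /code_at_cat[Cc]; rewrite size_comp_expr => /(@code_at_cat P _ [:: _])[Cj].
  rewrite [size [:: _]]/= => /code_at_cat[C1]; rewrite size_comp.
  move=> /(@code_at_cat P _ [:: _])[Cm]; rewrite [size [:: _]]/= => C2.
  have d0 : 0 < d by lia.
  have [m1 [R1 E1 F1]] := comp_exprP lb we d0 m0 mA mv Cc.
  have Rj := run_jz m1 Cj; rewrite E1 in Rj.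
  have m1A := arrays_frame lb F1 mA.
  have m1v := vars_frame (leqnn d) (leqnn d) F1 mv.
  have m10 : m1 0 = base by rewrite F1 ?d0.
  case: (eval _ _ e == 0) Rj => Rj.
    have [m2 [R2 A2 V2 F2]] := IH2 _ _ _ _ w2 nd m10 m1A m1v C2.
    exists m2; split=> //.
      apply: (run_cat R1); apply: (run_cat Rj).
      by move: R2; congr (run _ _ _ _ _ _); lia.
    by move=> r Hr; rewrite F2 // (fc _ _ _ nd F1).
  have [m2 [R2 A2 V2 F2]] := IH1 _ _ _ _ w1 nd m10 m1A m1v C1.
  exists m2; split=> //.
    apply: (run_cat R1); apply: (run_cat Rj); apply: (run_cat R2).
    by move: (run_jmp m2 Cm); congr (run _ _ _ _ _ _); lia.
  by move=> r Hr; rewrite F2 // (fc _ _ _ nd F1).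
- move=> x y c IH d o s m /and4P[xn yn dl W] nd m0 mA mv.
  move=> /(@code_at_cat P o [:: _; _; _])[C0].
  move=> /(@code_at_cat P _ [:: _; _; _])[Cj]; rewrite [size [:: _; _; _]]/=.
  rewrite [size [:: _; _; _]]/= in Cj *.
  move: Cj => /(@code_at_cat P _ [:: _] [:: _; _])[Cj]; rewrite [size [:: _]]/= => Cx.
  move=> /code_at_cat[Ce]; rewrite size_comp.
  rewrite -[[:: _; _; _; _]]/([:: _; _; _] ++ [:: _]) => /code_at_cat[Cs].
  rewrite [size [:: _; _; _]]/= => Cm.
  (* Register [d] counts down and [d.+1] up. The fold carries the store together with the cost,
     which starts from an arbitrary [q]; hence the difference in the number of steps. *)
  have loop k : forall i s m q, m 0 = base -> arrays_at m base (ar s) ->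
     vars_at m succn (va s) nv d -> m d = k -> m d.+1 = i ->
     let sq := foldl (fun st i => (exec c (set_var st.1 x i),
         st.2 + (cost c (set_var st.1 x i) + 7))) (s, q) (iota i k) in
     exists m', [/\ run P (o + 3) m (sq.2 - q + 1)
       (o + (3 + (3 + (code_size c + 4)))) m', q <= sq.2,
       arrays_at m' base (ar sq.1), vars_at m' succn (va sq.1) nv d
       & frame_cmd m m' nv d].
    elim: k => [|k IHk] i s1 m1 q m10 m1A m1v mk mi /=.
      exists m1; split=> //=.
      have := run_jz m1 Cj; rewrite mk eqxx subnn add0n.
      by congr (run _ _ _ _ _ _); lia.
    have Rj := run_jz m1 Cj; rewrite mk /= in Rj.
    have m1v' : vars_at m1 succn (va s1) nv d.+1.
      by apply: (@vars_frame m1 m1 d low) m1v.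
    have [||] := setP m1 x d.+1 s1 xn _ _ m1A m1v'; [lia|lia|].
    set m2 := foldl _ _ _; rewrite mi => m2A m2v F2.
    have m2v' : vars_at m2 succn (va (set_var s1 x i)) nv d.+2.
      by apply: (@vars_frame m2 m2 d.+1 low) m2v.
    have m20 : m2 0 = base by rewrite F2 //; left.
    have nd2 : nv < d.+2 by lia.
    have [m3 [R3 A3 V3 F3]] := IH _ _ (set_var s1 x i) _ W nd2 m20 m2A m2v' Ce.
    set m4 := foldl effect m3 [:: IConst d.+2 1; ISub d d d.+2; IAdd d.+1 d.+1 d.+2].
    have F4 : frame m3 m4 d low by apply: effect_frame => //=; lia.
    have F14 : frame_cmd m1 m4 nv d.
      move=> r Hr; rewrite F4; last by lia.
      by rewrite F3; [rewrite F2 //|]; lia.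
    have h1 : m3 d = k.+1 by rewrite F3; [rewrite F2; [exact: mk|]|]; lia.
    have h2 : m3 d.+1 = i.
      rewrite F3; last by lia.
      by rewrite /m2 /= !updE; upd_simpl; rewrite mi.
    have V4 : vars_at m4 succn (va (exec c (set_var s1 x i))) nv d.
      move=> z zn; have [_ h] := V3 z zn; split; first by lia.
      by rewrite F4 //; lia.
    have [|||m5 [R5 le5 A5 V5 F5]] :=
      IHk i.+1 _ m4 (q + (cost c (set_var s1 x i) + 7)) _ (arrays_frame lb F4 A3) V4.
    + by rewrite F14 //; left.
    + by rewrite /m4; upd_simpl; rewrite h1; lia.
    + by rewrite /m4; upd_simpl; rewrite h2; lia.
    exists m5; split=> //; last by move=> r Hr; rewrite F5 ?F14.
    + move: R5 le5; set S := (foldl _ _ _).2 => R5 le5.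
      have -> : S - q + 1 = 1 + (2 + (cost c (set_var s1 x i) +
        (3 + (1 + (S - (q + (cost c (set_var s1 x i) + 7)) + 1))))) by lia.
      apply: (run_cat Rj); apply: (run_cat (run_straight m1 Cx isT)).
      have -> : o + 3 + 1 + 2 = o + 3 + 3 by lia.
      apply: (run_cat R3); apply: (run_cat (run_straight m3 Cs isT)).
      exact: run_cat (run_jmp _ Cm) R5.
    + by apply: leq_trans le5; lia.
  set m1 := foldl effect m [:: IConst d 0; IAdd d d y.+1; IConst d.+1 0].
  have F1 : frame m m1 d low by apply: effect_frame => //=; lia.
  have [yd y3] := mv _ yn.
  have [|||||m2 [R2 _ A2 V2 F2]] := loop (va s y) 0 s m1 0.
  + by rewrite F1 //; lia.
  + exact: arrays_frame F1 mA.
  + exact: (vars_frame (leqnn d) (leqnn d) F1 mv).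
  + by rewrite /m1; upd_simpl.
  + by rewrite /m1; upd_simpl.
  have sq1 l s0 q : (foldl (fun st i => (exec c (set_var st.1 x i),
      st.2 + (cost c (set_var st.1 x i) + 7))) (s0, q) l).1 =
      foldl (fun s i => exec c (set_var s x i)) s0 l.
    by elim: l s0 q => //= i l IHl s0 q; rewrite IHl.
  rewrite subn0 sq1 in R2 A2 V2.
  exists m2; split=> //; last by move=> r Hr; rewrite F2 // (fc _ _ _ nd F1).
  by apply: run_cat R2; apply: (run_straight m C0 isT).
Qed.

(** * Input and output conventions of the RAM *)

Definition loop_code o (b : seq instr) :=
  [:: IJz 2 (o + 1 + size b + 1)] ++ (b ++ [:: IJmp o]).

(** The invariant is indexed by the number of remaining iterations, which register 2 holds. *)
Lemma run_loop P o b (I : nat -> (nat -> nat) -> Prop) : all straight b ->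
  code_at P o (loop_code o b) ->
  (forall k m, I k m -> m 2 = k) ->
  (forall k m, I k.+1 m -> I k (foldl effect m b)) ->
  forall k m, I k m -> exists m',
    run P o m (k * (size b + 2) + 1) (o + 1 + size b + 1) m' /\ I 0 m'.
Proof.
move=> sb /(@code_at_cat P _ [:: _])[Cj]; rewrite [size [:: _]]/=.
move=> /code_at_cat[Cb Cm] I2 Istep; elim=> [|k IHk] m Im.
  exists m; split=> //; have := run_jz m Cj; rewrite (I2 _ _ Im) eqxx.
  by congr (run _ _ _ _ _ _); lia.
have [m' [R' I']] := IHk _ (Istep _ _ Im).
exists m'; split=> //.
have Rj := run_jz m Cj; rewrite (I2 _ _ Im) /= in Rj.
have -> : k.+1 * (size b + 2) + 1 = 1 + (size b + (1 + (k * (size b + 2) + 1))) by lia.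
apply: (run_cat Rj); apply: (run_cat (run_straight m Cb sb)).
exact: run_cat (run_jmp _ Cm) R'.
Qed.

Section FullProgram.
Variables (nv low : nat).
Hypothesis low7 : 7 < low.
Hypothesis nvlow : nv.+1 < low.

(* At the start the input occupies the low registers, so no register is free
   except 0 (the input length, which is recoverable) and 3 (which holds 0).
   Register 0 serves as a pointer past the input, register 3 as its stride. *)
Definition save_code :=
  [:: IConst 3 low; IAdd 0 0 3; IConst 3 16] ++
  flatten [seq [:: IAdd 0 0 3; if j == 3 then IConst 3 16 else IStore 0 j]
          | j <- iota 1 low.-1].

(** [save_code] leaves register 0 at [base + 16 * low.-1]. From it the base is recovered, then the
    input length [base - low], which goes to cell 0 of array 0; register 2 ends as the number of
    input words not yet saved. *)
Definition copy_in_init :=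
  [:: IConst 1 (16 * low.-1); ISub 0 0 1; IConst 1 low; ISub 2 0 1; IStore 0 2;
      IConst 4 (16 * low); IAdd 4 4 0; IConst 5 1; IAdd 2 2 5; ISub 2 2 1].

Definition copy_in_body :=
  [:: ILoad 6 1; IStore 4 6; IAdd 1 1 5; IAdd 4 4 3; ISub 2 2 5].

Definition clear_code := [seq IConst x.+1 0 | x <- iota 0 nv].

Definition prologue :=
  let l := save_code ++ copy_in_init in
  l ++ (loop_code (size l) copy_in_body ++ clear_code).

Definition copy_out_init :=
  [:: ILoad 2 0; IConst 1 low; IConst 5 1; IAdd 2 2 5; ISub 2 2 1; IConst 3 16;
      IConst 4 (16 * low); IAdd 4 4 0].

Definition copy_out_body :=
  [:: ILoad 6 4; IStore 1 6; IAdd 1 1 5; IAdd 4 4 3; ISub 2 2 5].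

(** Each low register serves as its own address register, and register 0, which provides the base
    for the others, is loaded last. *)
Definition restore_code :=
  flatten [seq [:: IConst r (16 * r); IAdd r r 0; ILoad r r] | r <- iota 1 low.-1]
  ++ [:: ILoad 0 0].

Definition epilogue o :=
  copy_out_init ++ (loop_code (o + size copy_out_init) copy_out_body ++ restore_code).

Definition full_program c :=
  let lc := comp nv.+1 (size prologue) c in
  prologue ++ (lc ++ (epilogue (size prologue + size lc) ++ [:: IHalt])).

Definition input_array (x : seq nat) (a i : nat) :=
  if a == 0 then Defs.mem (init x) i else 0.

Lemma init_out x i : size x < i -> Defs.mem (init x) i = 0.
Proof. by case: i => //= i Hi; rewrite nth_default. Qed.

Lemma clear_codeE m (l : seq nat) r :
  foldl effect m [seq IConst x.+1 0 | x <- l] r =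
  if r \in [seq x.+1 | x <- l] then 0 else m r.
Proof.
elim: l m => //= x l IH m; rewrite IH inE updE.
by case: ifP; rewrite ?orbT // orbF.
Qed.

(** The base lies above the whole input, so the copy never overwrites a word still to be read.
    Memory beyond the input is initially 0, which already clears every other array cell. *)
Lemma prologueP P x : nth 0 x 2 = 0 -> code_at P 0 prologue ->
  exists t m, [/\ t <= size prologue + 7 * size x,
    run P 0 (Defs.mem (init x)) t (size prologue) m,
    m 0 = size x + low, arrays_at m (size x + low) (input_array x)
    & vars_at m succn (fun _ => 0) nv nv.+1].
Proof.
move=> x3; set base := size x + low; set m0 := Defs.mem (init x).
have m0_3 : m0 3 = 0 by [].
have m0_0 : m0 0 = size x by [].
have m0_out i : size x < i -> m0 i = 0 by apply: init_out.
move=> /code_at_cat[C0]; rewrite add0n => /code_at_cat[C1 C2].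
(* The registers 1 to [J] have been treated; register 0 points at cell [J] of array 0. *)
pose IB J m := [/\ m 0 = base + 16 * J, m 3 = 16,
  forall r, 0 < r < base -> r != 3 -> m r = m0 r &
  forall i a, a < 16 -> m (base + i * 16 + a) =
     if (a == 0) && (0 < i <= J) then m0 i else 0].
have IB0 : IB 0 (foldl effect m0 [:: IConst 3 low; IAdd 0 0 3; IConst 3 16]).
  split.
  - by upd_simpl; rewrite m0_0 /base; lia.
  - by upd_simpl.
  - by move=> r r1 r2; upd_simpl.
  - move=> i a a16; upd_simpl; rewrite m0_out /base; last by lia.
    by case: ifP => //; lia.
have IBJ : forall J, J < low ->
    IB J (foldl effect m0 ([:: IConst 3 low; IAdd 0 0 3; IConst 3 16] ++
     flatten [seq [:: IAdd 0 0 3; if j == 3 then IConst 3 16 else IStore 0 j]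
          | j <- iota 1 J])).
  elim=> [|J IH] HJ; first by rewrite cats0.
  rewrite -addn1 iotaD map_cat flatten_cat catA foldl_cat add1n.
  have {IH} := IH (ltnW HJ); set m := foldl effect m0 _ => -[I0 I3 Ir Ia].
  have ad i a : a < 16 ->
    (base + i * 16 + a == base + 16 * J.+1) = (a == 0) && (i == J.+1) by lia.
  rewrite addn1 [flatten _]/= [foldl _ _ _]/=; case: eqP => J3 /=.
    split.
    + by upd_simpl; rewrite I0 I3; lia.
    + by upd_simpl.
    + by move=> r r1 r2; upd_simpl; apply: Ir.
    + move=> i a a16; upd_simpl; rewrite Ia //.
      case: (eqVneq a 0) => //= _.
      (* Register 3 is never saved: its original content was 0, like the fresh cell meant for it. *)
      case: (i =P 3) => [->|i3]; first by rewrite m0_3 !if_same.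
      by congr (if _ then _ else _); lia.
  have -> : upd m 0 (m 0 + m 3) 0 = base + 16 * J.+1.
    by rewrite upd_same I0 I3; lia.
  split.
  + by upd_simpl; rewrite I0 I3; lia.
  + by upd_simpl.
  + by move=> r r1 r2; upd_simpl; apply: Ir.
  + move=> i a a16; rewrite updE ad //.
    have [a0|aa]/= := eqVneq a 0; last by upd_simpl; rewrite Ia // (negbTE aa).
    case: (i =P J.+1) => [->|Hi] /=; first by upd_simpl; rewrite Ir ?leqnn //; lia.
    upd_simpl; rewrite Ia // a0 /=; congr (if _ then _ else _); lia.
have {IBJ} := IBJ low.-1; rewrite prednK ?leqnn; last by lia.
move=> /(_ isT); rewrite -/save_code => -[B0 B3 Br Ba].
set m1 := foldl effect m0 save_code in B0 B3 Br Ba.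
set m2 := foldl effect m1 copy_in_init.
(* Here [j] is the next word to copy. For an input shorter than [low] the truncated count is 0
   although [j] is already past the end, so the equation for [j + k] is claimed only for positive
   [k]. *)
pose IL k m := [/\ m 2 = k, m 0 = base, m 3 = 16, m 5 = 1 &
  exists j, [/\ low <= j, size x < j + k & 0 < k -> j + k = (size x).+1] /\
  [/\ m 1 = j, m 4 = base + 16 * j, forall r, low <= r < base -> m r = m0 r &
  forall i a, a < 16 -> m (base + i * 16 + a) =
    if (a == 0) && (i < j) then m0 i else 0]].
have IL0 : IL (size x + 1 - low) m2.
  pose ma := foldl effect m1 [:: IConst 1 (16 * low.-1); ISub 0 0 1; IConst 1 low;
    ISub 2 0 1].
  have a0 : ma 0 = base by rewrite /ma; upd_simpl; rewrite B0; lia.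
  have a1 : ma 1 = low by rewrite /ma; upd_simpl.
  have a2 : ma 2 = size x by rewrite /ma; upd_simpl; rewrite B0 /base; lia.
  have a3 r : 2 < r -> ma r = m1 r by move=> Hr; rewrite /ma; upd_simpl.
  have -> : m2 = foldl effect (upd ma base (size x)) [:: IConst 4 (16 * low);
     IAdd 4 4 0; IConst 5 1; IAdd 2 2 5; ISub 2 2 1] by rewrite -a2 -{1}a0.
  have lb : low <= base by rewrite leq_addl.
  clearbody ma; clear m2; rewrite /IL /=; split.
  - by upd_simpl; rewrite a2 a1.
  - by upd_simpl.
  - by upd_simpl; rewrite a3.
  - by upd_simpl.
  exists low; split; first by split; lia.
  split.
  - by upd_simpl.
  - by upd_simpl; rewrite a0; lia.
  - by move=> r Hr; upd_simpl; rewrite a3 ?Br //; lia.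
  - move=> i a a16; upd_simpl; rewrite a3 ?Ba //; last by lia.
    have -> : (base + i * 16 + a == base) = (a == 0) && (i == 0) by lia.
    have [a00|aa]/= := eqVneq a 0; last by [].
    case: i => [|i] /=; first by rewrite m0_0; case: ifP => //; lia.
    by congr (if _ then _ else _); lia.
have [] := @run_loop P (size (save_code ++ copy_in_init)) copy_in_body IL isT _ _ _ _
  _ IL0.
- exact: C1.
- by move=> k m [].
- move=> k m [k2 b0 k3 k5 [j [[j1 j2 j3] [k1 k4 kr ka]]]].
  have {j3} jk := j3 isT.
  pose ma := upd m 6 (m j).
  have mj : m j = m0 j by apply: kr; rewrite /base; lia.
  have a3 r : r != 6 -> ma r = m r by move=> Hr; rewrite /ma; upd_simpl.
  have -> : foldl effect m copy_in_body =
    foldl effect (upd ma (base + 16 * j) (m0 j)) [:: IAdd 1 1 5; IAdd 4 4 3; ISub 2 2 5].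
    by rewrite /ma -k4 -mj -k1.
  clearbody ma.
  have lb : low <= base by rewrite leq_addl.
  rewrite /IL /=; split.
  + by upd_simpl; rewrite !a3 // k2 k5; lia.
  + by upd_simpl; rewrite a3.
  + by upd_simpl; rewrite a3.
  + by upd_simpl; rewrite a3.
  exists j.+1; split; first by split; lia.
  split.
  + by upd_simpl; rewrite !a3 // k1 k5; lia.
  + by upd_simpl; rewrite !a3 // k4 k3; lia.
  + by move=> r Hr; upd_simpl; rewrite a3 ?kr //; lia.
  + move=> i a a16; upd_simpl; rewrite a3 ?ka //; last by lia.
    have -> : (base + i * 16 + a == base + 16 * j) = (a == 0) && (i == j) by lia.
    have [a00|aa]/= := eqVneq a 0; last by [].
    by case: (i =P j) => [->|ij]; [rewrite ltnSn|congr (if _ then _ else _); lia].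
move=> m3 [R3 [_ b0 _ _ [j [[j1 j2 _] [_ _ _ ka]]]]].
have E := clear_codeE m3 (iota 0 nv); rewrite -/clear_code in E.
have C2s : all straight clear_code by rewrite /clear_code all_map; apply/allP.
have C0s : all straight (save_code ++ copy_in_init).
  rewrite /save_code !all_cat andbT /=.
  by elim: (iota _ _) => //= k l ->; case: eqP.
have R0 := run_straight m0 C0 C0s.
rewrite foldl_cat -/m1 -/m2 add0n in R0.
have R4 := run_straight m3 C2 C2s.
move: R0 R3 R4; rewrite /prologue; set L := size (save_code ++ copy_in_init).
rewrite !(size_cat (save_code ++ _)) -/L (size_cat (loop_code _ _)).
have -> : size (loop_code L copy_in_body) = 7 by [].
rewrite [size copy_in_body]/= => R0 R3 R4.
have EE : L + 7 = L + 1 + 5 + 1 by lia.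
rewrite EE in R4.
have RR := run_cat R0 (run_cat R3 R4).
eexists; exists (foldl effect m3 clear_code); split; last 3 first.
- by rewrite E; case: mapP => // -[].
- move=> a i a16; rewrite E ifF; last first.
    by apply/mapP => -[y]; rewrite mem_iota /base; lia.
  rewrite ka // /input_array -/m0; case: eqP => //= _; case: ltnP => // ji.
  by rewrite m0_out //; lia.
- move=> y yn; split; first by lia.
  by rewrite E map_f // mem_iota; lia.
- 2: have -> : L + (7 + size clear_code) = L + 1 + 5 + 1 + size clear_code by lia.
  2: exact: RR.
by lia.
Qed.

(** The bound on the output length keeps the output registers below the arrays from which they are
    copied. *)
Lemma epilogueP P o m base A : low <= base -> code_at P o (epilogue o) ->
  m 0 = base -> arrays_at m base A -> A 0 0 < base ->
  exists t m', [/\ t <= size (epilogue 0) + 7 * A 0 0,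
    run P o m t (o + size (epilogue 0)) m', m' 0 = A 0 0
    & forall i, 0 < i <= A 0 0 -> m' i = A 0 i].
Proof.
move=> lb; set len := A 0 0 => /code_at_cat[C0] /code_at_cat[C1 C2] mb mA lenb.
have m_A i : m (base + i * 16) = A 0 i by rewrite -(mA 0 i) // addn0.
pose IL k m := [/\ m 2 = k, m 0 = base, m 3 = 16, m 5 = 1 &
  exists j, [/\ low <= j, len < j + k & 0 < k -> j + k = len.+1] /\
  [/\ m 1 = j, m 4 = base + 16 * j, forall i, low <= i < j -> m i = A 0 i &
  forall i, m (base + i * 16) = A 0 i]].
have IL0 : IL (len + 1 - low) (foldl effect m copy_out_init).
  have mbase : m base = len by rewrite -[base]addn0 -[0]/(0 * 16) m_A.
  rewrite /IL /=; split.
  - by upd_simpl; rewrite mb mbase; lia.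
  - by upd_simpl.
  - by upd_simpl.
  - by upd_simpl.
  exists low; split; first by split; lia.
  split.
  - by upd_simpl.
  - by upd_simpl; rewrite mb; lia.
  - by move=> i; lia.
  - by move=> i; upd_simpl.
have [||m1 [R1 [_ b0 _ _ [j [[j1 j2 _] [_ _ Ai AA]]]]]] :=
  @run_loop P _ copy_out_body IL isT C1 _ _ _ _ IL0.
- by move=> k m' [].
- move=> k m' [k2 k0 k3 k5 [j [[j1 j2 j3] [k1 k4 kr ka]]]].
  have {j3} jk := j3 isT.
  pose ma := upd m' 6 (A 0 j).
  have mj : m' (m' 4) = A 0 j by rewrite k4 mulnC ka.
  have a3 r : r != 6 -> ma r = m' r by move=> Hr; rewrite /ma; upd_simpl.
  have -> : foldl effect m' copy_out_body =
    foldl effect (upd ma j (A 0 j)) [:: IAdd 1 1 5; IAdd 4 4 3; ISub 2 2 5].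
    by rewrite /ma -mj -[in RHS]k1.
  clearbody ma; rewrite /IL /=; split.
  + by upd_simpl; rewrite !a3 // k2 k5; lia.
  + by upd_simpl; rewrite a3.
  + by upd_simpl; rewrite a3.
  + by upd_simpl; rewrite a3.
  exists j.+1; split; first by split; lia.
  split.
  + by upd_simpl; rewrite !a3 // k1 k5; lia.
  + by upd_simpl; rewrite !a3 // k4 k3; lia.
  + move=> i Hi; upd_simpl; case: (i =P j) => [->//|ij].
    by rewrite a3 ?kr //; lia.
  + by move=> i; upd_simpl; rewrite a3 ?ka //; lia.
have rest J : J < low -> forall m2, m2 = foldl effect m1 (flatten
    [seq [:: IConst r (16 * r); IAdd r r 0; ILoad r r] | r <- iota 1 J]) ->
   [/\ m2 0 = base, forall i, 0 < i <= J -> m2 i = A 0 i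
    & forall i, low <= i -> m2 i = m1 i].
  elim: J => [|J IH] HJ m3; first by move=> ->; split=> //; lia.
  rewrite -[J.+1]addn1 iotaD map_cat flatten_cat foldl_cat.
  have {IH} := IH (ltnW HJ) _ erefl; set m2 := foldl effect m1 _ => -[h0 h1 h2].
  rewrite add1n addn1 /= => ->; split.
  - by upd_simpl.
  - move=> i Hi; upd_simpl; case: (i =P J.+1) => [->|iJ]; last by upd_simpl; apply: h1;
    lia.
    by rewrite h0 addnC mulnC; upd_simpl; rewrite h2 ?AA //; lia.
  - by move=> i Hi; upd_simpl; apply: h2.
have [|r0 r1 r2] := rest low.-1 _ _ erefl; first by lia.
set m2 := foldl _ _ _ in r0 r1 r2.
have Rs : all straight restore_code.
  by rewrite /restore_code all_cat andbT; elim: (iota _ _).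
have R2 := run_straight m1 C2 Rs.
have R0 := run_straight m C0 isT.
have sE : size (epilogue 0) = 8 + (7 + size restore_code).
  by rewrite /epilogue (size_cat copy_out_init) (size_cat (loop_code _ _)).
have EE : o + size copy_out_init + size (loop_code (o + size copy_out_init) copy_out_body)
   = o + size copy_out_init + 1 + size copy_out_body + 1 by rewrite /=; lia.
rewrite EE in R2.
have RR := run_cat R0 (run_cat R1 R2).
have EO : o + size (epilogue 0) =
  o + size copy_out_init + 1 + size copy_out_body + 1 + size restore_code.
  by rewrite sE /=; lia.
rewrite EO sE; eexists; eexists; split; [|exact: RR| |].
- by rewrite [size copy_out_init]/= [size copy_out_body]/=; lia.
- by rewrite /restore_code foldl_cat /= -/m2 upd_same r0 -[base]addn0 -[0]/(0 * 16)
  r2 ?AA //; lia.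
- move=> i Hi; rewrite /restore_code foldl_cat /= -/m2 upd_other; last by lia.
  by case: (ltnP i low) => il; [apply: r1|rewrite r2 // Ai]; lia.
Qed.

Definition start (x : seq nat) := Store (fun _ => 0) (input_array x).

(** Copying takes 7 steps per word in each direction, whence the 14. Any longer time serves as well,
    a halted state being a fixed point. *)
Lemma full_programP c x : wf nv low nv.+1 c -> nth 0 x 2 = 0 ->
  let A := ar (exec c (start x)) in
  A 0 0 <= size x ->
  forall t, size prologue + size (epilogue 0) + 14 * size x + cost c (start x) <= t ->
  runs_within (full_program c) x t [seq A 0 i.+1 | i <- iota 0 (A 0 0)].
Proof.
move=> w x3 A Ax t; set P := full_program c.
have /code_at_cat[C1] : code_at P 0 P by [].
rewrite add0n => /code_at_cat[C2]; rewrite size_comp => /code_at_cat[C3 C4].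
have [t1 [m1 [le1 R1 b1 A1 V1]]] := prologueP x3 C1.
have lb : low <= size x + low by rewrite leq_addl.
have [m2 [R2 A2 V2 F2]] := compP lb w (ltnSn nv) (s := start x) b1 A1 V1 C2.
have b2 : m2 0 = size x + low by rewrite F2 //; left.
have [|t3 [m3 [le3 R3 l3 E3]]] := epilogueP lb C3 b2 A2; first by rewrite -/A; lia.
have RR := run_cat R1 (run_cat R2 R3); move=> let_.
have H : nth IHalt P (size prologue + code_size c + size (epilogue 0)) = IHalt.
  have := C4 0 isT; rewrite addn0 => h; apply: etrans h.
  by congr (nth _ _ (_ + _));
    rewrite /epilogue !(size_cat copy_out_init) !(size_cat (loop_code _ _)).
move: RR H; rewrite /run; move: (_ + size (epilogue 0)) => o RR H.
have fin k : iter k (step P) (State o m3) = State o m3.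
  by elim: k => // k IH; rewrite iterS IH /step /= H.
rewrite /runs_within.
have -> : t = (t - (t1 + (cost c (start x) + t3))) + (t1 + (cost c (start x) + t3)).
  by rewrite subnK // (leq_trans _ let_) //; rewrite -/A in le3; lia.
rewrite iterD RR fin /halted /= H; split=> //.
rewrite /output /= l3; apply/eq_in_map => i; rewrite mem_iota => Hi.
by rewrite E3 //; lia.
Qed.

End FullProgram.

(** * Invariants, frames and running time *)

Lemma exec_for (I : nat -> store -> Prop) x y c s :
  I 0 s ->
  (forall i s', i < va s y -> I i s' -> I i.+1 (exec c (set_var s' x i))) ->
  I (va s y) (exec (CFor x y c) s).
Proof.
move=> I0 Istep /=; set k := va s y in Istep *.
have : forall j s', j <= k -> I j s' ->
    I k (foldl (fun s i => exec c (set_var s x i)) s' (iota j (k - j))).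
  move=> j s'; have [d] := ubnP (k - j); elim: d j s' => // d IH j s' Hd jk Ij.
  have [kj|jlt] := leqP k j.
    by have -> : k - j = 0 by [lia]; have <- : j = k by lia.
  have -> : k - j = (k - j.+1).+1 by lia.
  by apply: IH; [lia|lia|apply: Istep].
by move=> /(_ 0 s isT I0); rewrite subn0.
Qed.

Fixpoint assigned (c : cmd) : seq nat :=
  match c with
  | CSet x _ => [:: x]
  | CStore _ _ _ => [::]
  | CSeq c1 c2 | CIf _ c1 c2 => assigned c1 ++ assigned c2
  | CFor x _ c => x :: assigned c
  end.

Fixpoint stored (c : cmd) : seq nat :=
  match c with
  | CSet _ _ => [::]
  | CStore a _ _ => [:: a]
  | CSeq c1 c2 | CIf _ c1 c2 => stored c1 ++ stored c2
  | CFor _ _ c => stored c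
  end.

Lemma exec_va c s x : x \notin assigned c -> va (exec c s) x = va s x.
Proof.
elim: c s => //=.
- by move=> y e s; rewrite inE => h; rewrite upd_other.
- by move=> c1 H1 c2 H2 s; rewrite mem_cat negb_or => /andP[h1 h2]; rewrite H2 ?H1.
- move=> e c1 H1 c2 H2 s; rewrite mem_cat negb_or => /andP[h1 h2].
  by case: ifP => _; rewrite ?H1 ?H2.
- move=> y z c H s; rewrite inE negb_or => /andP[xy h].
  by apply: (@exec_for (fun _ s' => va s' x = va s x)) => // i s' _ <-;
     rewrite H //= upd_other.
Qed.

Lemma exec_ar c s a : a \notin stored c -> ar (exec c s) a = ar s a.
Proof.
elim: c s => //=.
- by move=> y e1 e2 s; rewrite inE => /negbTE ->.
- by move=> c1 H1 c2 H2 s; rewrite mem_cat negb_or => /andP[h1 h2]; rewrite H2 ?H1.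
- move=> e c1 H1 c2 H2 s; rewrite mem_cat negb_or => /andP[h1 h2].
  by case: ifP => _; rewrite ?H1 ?H2.
- move=> y z c H s h.
  by apply: (@exec_for (fun _ s' => ar s' a = ar s a)) => // i s' _ <-; rewrite H.
Qed.

(* Loop bounds are variables below 16, which the loops themselves never
   modify; this makes the running time polynomial in those variables. *)
Fixpoint bounded_expr (e : expr) : bool :=
  match e with
  | EV _ | EC _ => true
  | EAdd e1 e2 | ESub e1 e2 => bounded_expr e1 && bounded_expr e2
  | ERd _ e => bounded_expr e
  | EIf c e1 e2 => [&& bounded_expr c, bounded_expr e1 & bounded_expr e2]
  | ESum x y e => [&& 16 <= x, y < 16 & bounded_expr e]
  | ELet x e1 y e2 b => [&& 16 <= x, 16 <= y, bounded_expr e1, bounded_expr e2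
                          & bounded_expr b]
  end.

Fixpoint bounded (c : cmd) : bool :=
  match c with
  | CSet x e => (16 <= x) && bounded_expr e
  | CStore _ e1 e2 => bounded_expr e1 && bounded_expr e2
  | CSeq c1 c2 => bounded c1 && bounded c2
  | CIf e c1 c2 => [&& bounded_expr e, bounded c1 & bounded c2]
  | CFor x y c => [&& 16 <= x, y < 16 & bounded c]
  end.

Definition small (M : nat) (ev : nat -> nat) := forall y, y < 16 -> ev y <= M.

Lemma small_upd M ev x v : 16 <= x -> small M ev -> small M (upd ev x v).
Proof. by move=> x16 H y y16; rewrite upd_other ?H //; lia. Qed.

(** Bounds are kept in the shape [C * M ^ d]; adding both constants and degrees is wasteful but
    avoids any comparison of degrees. *)
Lemma poly_bound_add C1 d1 C2 d2 M a b k : 0 < M ->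
  a <= C1 * M ^ d1 -> b <= C2 * M ^ d2 ->
  a + b + k <= (C1 + C2 + k) * M ^ (d1 + d2).
Proof.
move=> M0 Ha Hb; rewrite !mulnDl; apply: leq_add; [apply: leq_add|].
- by rewrite (leq_trans Ha) // leq_mul2l leq_pexp2l ?leq_addr ?orbT.
- by rewrite (leq_trans Hb) // leq_mul2l leq_pexp2l ?leq_addl ?orbT.
- by rewrite -[k in k <= _]muln1 leq_mul2l expn_gt0 M0 orbT.
Qed.

Lemma sumn_iota_le (f : nat -> nat) n b :
  (forall i, f i <= b) -> sumn [seq f i | i <- iota 0 n] <= n * b.
Proof.
move=> H; elim: n 0 => [|n IH] k //=; rewrite mulSn; exact: leq_add.
Qed.

Lemma poly_bound_mul C d M n a k : 0 < M -> n <= M -> a <= n * (C * M ^ d + k) ->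
  a + 5 <= (C + k + 5) * M ^ d.+1.
Proof.
move=> M0 nM Ha; rewrite mulnDl leq_add //; last first.
  by rewrite -[X in X <= _]muln1 leq_mul2l expn_gt0 M0 orbT.
apply: (leq_trans Ha); rewrite expnS mulnCA; apply: leq_mul => //.
rewrite mulnDl leq_add2l -[X in X <= _]muln1 leq_mul2l expn_gt0 M0 orbT //.
Qed.

(** The constants depend on the expression alone: neither array contents nor variables from 16 on
    can lengthen a sum. *)
Lemma cost_expr_bound e : exists C d, forall ev A M, 0 < M -> small M ev ->
  bounded_expr e -> cost_expr ev A e <= C * M ^ d.
Proof.
elim: e => /=.
- by move=> x; exists 2, 0 => *; rewrite muln1.
- by move=> x; exists 1, 0 => *; rewrite muln1.
- move=> e1 [C1 [d1 H1]] e2 [C2 [d2 H2]]; exists (C1 + C2 + 1), (d1 + d2).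
  move=> ev A M M0 sM /andP[b1 b2]; rewrite addnA.
  by apply: poly_bound_add; [|apply: H1|apply: H2].
- move=> e1 [C1 [d1 H1]] e2 [C2 [d2 H2]]; exists (C1 + C2 + 1), (d1 + d2).
  move=> ev A M M0 sM /andP[b1 b2]; rewrite addnA.
  by apply: poly_bound_add; [|apply: H1|apply: H2].
- move=> a e [C [d H]]; exists (C + 0 + 8), (d + 0) => ev A M M0 sM b.
  rewrite -[cost_expr ev A e]addn0.
  by apply: (@poly_bound_add _ _ 0 0) => //; apply: H.
- move=> c [C [d H]] e1 [C1 [d1 H1]] e2 [C2 [d2 H2]].
  exists (C + (C1 + C2 + 0) + 2), (d + (d1 + d2)).
  move=> ev A M M0 sM /and3P[b b1 b2].
  have Hc := H ev A M M0 sM b.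
  have H12 := poly_bound_add 0 M0 (H1 ev A M M0 sM b1) (H2 ev A M M0 sM b2).
  have := poly_bound_add 2 M0 Hc H12.
  by apply: leq_trans; case: ifP => _; lia.
- move=> x y e [C [d H]]; exists (C + 6 + 5), d.+1.
  move=> ev A M M0 sM /and3P[x16 y16 b].
  rewrite addnCA [4 + 1]/=.
  apply: (poly_bound_mul (n := ev y)) => //; first exact: sM.
  apply: sumn_iota_le => i; rewrite leq_add2r.
  by apply: H => //; apply: small_upd.
- move=> x e1 [C1 [d1 H1]] y e2 [C2 [d2 H2]] b [C [d H]].
  exists (C + (C1 + C2 + 0) + 2), (d + (d1 + d2)).
  move=> ev A M M0 sM /and5P[x16 y16 b1 b2 bb].
  have H12 := poly_bound_add 0 M0 (H1 ev A M M0 sM b1) (H2 ev A M M0 sM b2).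
  set ev' := upd _ _ _.
  have Hb := H ev' A M M0 (small_upd _ y16 (small_upd _ x16 sM)) bb.
  have := poly_bound_add 2 M0 Hb H12.
  by apply: leq_trans; lia.
Qed.

Lemma bounded_va c s y : bounded c -> y < 16 -> va (exec c s) y = va s y.
Proof.
move=> b y16; apply: exec_va; apply/negP => h.
suff : 16 <= y by lia.
elim: c b h => //=.
- by move=> x e /andP[h _]; rewrite inE => /eqP ->.
- by move=> c1 H1 c2 H2 /andP[/H1 h1 /H2 h2]; rewrite mem_cat => /orP[].
- by move=> e c1 H1 c2 H2 /and3P[_ /H1 h1 /H2 h2]; rewrite mem_cat => /orP[].
- by move=> x z c H /and3P[h1 _ h2]; rewrite inE => /orP[/eqP ->|/(H h2)].
Qed.

(** A [bounded] command never assigns a variable below 16, so a single [M] limits all loops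
    throughout the run. *)
Lemma cost_bound c : exists C d, forall s M, 0 < M -> small M (va s) ->
  bounded c -> cost c s <= C * M ^ d.
Proof.
elim: c => /=.
- move=> x e; have [C [d H]] := cost_expr_bound e.
  exists (C + 0 + 2), (d + 0) => s M M0 sM /andP[_ b].
  rewrite -[cost_expr _ _ e]addn0.
  by apply: (@poly_bound_add _ _ 0 0) => //; apply: H.
- move=> a e1 e2; have [C1 [d1 H1]] := cost_expr_bound e1.
  have [C2 [d2 H2]] := cost_expr_bound e2.
  exists (C1 + C2 + 8), (d1 + d2) => s M M0 sM /andP[b1 b2].
  have := poly_bound_add 8 M0 (H1 _ (ar s) M M0 sM b1) (H2 _ (ar s) M M0 sM b2).
  by apply: leq_trans; lia.
- move=> c1 [C1 [d1 H1]] c2 [C2 [d2 H2]].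
  exists (C1 + C2 + 0), (d1 + d2) => s M M0 sM /andP[b1 b2].
  rewrite -[X in X <= _]addn0; apply: poly_bound_add => //; first exact: H1.
  by apply: H2 => // y y16; rewrite bounded_va // sM.
- move=> e c1 [C1 [d1 H1]] c2 [C2 [d2 H2]].
  have [C [d H]] := cost_expr_bound e.
  exists (C + (C1 + C2 + 0) + 2), (d + (d1 + d2)).
  move=> s M M0 sM /and3P[b b1 b2].
  have Hc := H _ (ar s) M M0 sM b.
  have H12 := poly_bound_add 0 M0 (H1 s M M0 sM b1) (H2 s M M0 sM b2).
  have := poly_bound_add 2 M0 Hc H12.
  by apply: leq_trans; case: ifP => _; lia.
- move=> x y c [C [d H]]; exists (C + 7 + 5), d.+1.
  move=> s M M0 sM /and3P[x16 y16 b]; set S := (foldl _ _ _).2.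
  have := @poly_bound_mul C d M (va s y) S 7 M0 (sM _ y16).
  suff h : S <= va s y * (C * M ^ d + 7) by move=> /(_ h); apply: leq_trans; lia.
  rewrite /S; have : forall k j s' q, small M (va s') ->
    (foldl (fun st i => (exec c (set_var st.1 x i),
       st.2 + (cost c (set_var st.1 x i) + 7))) (s', q) (iota j k)).2
     <= q + k * (C * M ^ d + 7).
    elim=> [|k IH] j s' q sM' /=; first by rewrite addn0.
    apply: leq_trans (IH _ _ _ _) _.
      by move=> z z16; rewrite bounded_va //=; apply: small_upd.
    have := H (set_var s' x j) M M0 (small_upd _ x16 sM') b.
    by move: (cost _ _) (C * _) => u v uv; rewrite mulSn; lia.
  by move=> h; apply: h.
Qed.

(** * Dynamic programming on a rooted forest *)

Lemma count_add (T : eqType) (a b c : pred T) (s : seq T) :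
  {in s, forall x, (a x : nat) = b x + c x} -> count a s = count b s + count c s.
Proof.
elim: s => //= x s IH H; rewrite H ?mem_head // IH; first by lia.
by move=> y ys; apply: H; rewrite inE ys orbT.
Qed.

Section ForestDP.

Variables (n : nat) (par : nat -> nat).
Hypothesis par_gt : forall x, x < n -> x < par x <= n.

(* The ancestor of [x] that survives once vertices [0, ..., k-1] have been
   merged into their parents. *)
Fixpoint root k x :=
  if k is k'.+1 then let r := root k' x in if r == k' then par k' else r else x.

Lemma root_id k x : k <= x -> root k x = x.
Proof.
elim: k => //= k IH kx; rewrite IH; last exact: ltnW.
by case: eqP => // xk; lia.
Qed.

Lemma root_par k x : x < k <= n -> root k x = root k (par x).
Proof.
elim: k => // k IH /andP[]; rewrite ltnS leq_eqVlt => /orP[/eqP -> kn|xk kn] /=.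
  have pk := par_gt kn.
  rewrite root_id // eqxx root_id; last by lia.
  by case: eqP => // ?; lia.
by rewrite IH //; lia.
Qed.

Lemma root_le k x : x <= n -> k <= n -> k <= root k x <= n.
Proof.
move=> xn; elim: k => // k IH kn /=.
have := IH (ltnW kn); have := par_gt kn; case: eqP => //; lia.
Qed.

Lemma root_eq j k x y : j <= k -> root j x = root j y -> root k x = root k y.
Proof.
move=> jk E; rewrite -(subnKC jk); elim: (k - j) => [|d IH]; first by rewrite addn0.
by rewrite addnS /= IH.
Qed.

Lemma root_last x : x <= n -> root n x = n.
Proof. by move=> xn; have := root_le xn (leqnn n); lia. Qed.

Variables (L : eqType) (act : L -> nat).
Implicit Types l : nat -> L.

Definition top l x := act (l x) != act (l (par x)).

(* Like [root], but climbing stops at the top of the coalition. *)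
Fixpoint croot l k x :=
  if k is k'.+1 then
    let r := croot l k' x in if (r == k') && ~~ top l k' then par k' else r
  else x.

Lemma croot_id l k x : k <= x -> croot l k x = x.
Proof.
elim: k => //= k IH kx; rewrite IH; last exact: ltnW.
by case: eqP => // xk; lia.
Qed.

Lemma croot_par l k x : x < k <= n -> ~~ top l x -> croot l k x = croot l k (par x).
Proof.
move=> + tx; elim: k => // k IH /andP[]; rewrite ltnS leq_eqVlt.
case/orP=> [/eqP xk kn|xk kn] /=; last by rewrite IH //; lia.
rewrite xk in tx *; have pk := par_gt kn.
rewrite croot_id // eqxx tx croot_id; last by lia.
by case: eqP => // ?; lia.
Qed.

(** A climb that has got as far as [k] has not been stopped by any top among the merged vertices, so
    it agrees with the climb of [root]. *)
Lemma croot_root l k x : k <= n -> k <= croot l k x -> croot l k x = root k x.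
Proof.
elim: k => // k IH kn /=; have [E|ne] := eqVneq (croot l k x) k => /=.
  have := IH (ltnW kn); rewrite E leqnn => /(_ isT) <-; rewrite eqxx.
  by case: ifP => //; lia.
by move=> h; rewrite -IH; [rewrite (negbTE ne)|exact: ltnW|exact: ltnW].
Qed.

Lemma croot_act l k x : x <= n -> k <= n -> act (l (croot l k x)) = act (l x).
Proof.
move=> xn; elim: k => //= k IH kn; case: ifP => [/andP[/eqP E tk]|_].
  by rewrite -IH ?E; [move: tk; rewrite negbK => /eqP ->|exact: ltnW].
by rewrite IH // ltnW.
Qed.

Lemma eq_croot l l' k y : k <= n ->
  (forall x, x < k -> root k x = root k y -> top l x = top l' x) ->
  croot l k y = croot l' k y.
Proof.
elim: k => // k IH kn H.
have E : croot l k y = croot l' k y.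
  apply: IH; first exact: ltnW.
  by move=> x xk xy; apply: H; [exact: ltnW|rewrite /= xy].
rewrite /= E; case: eqP => //= E2; rewrite H //.
rewrite -E in E2.
by apply: (@root_eq k) => //; rewrite root_id // -(@croot_root l) ?E2 // ltnW.
Qed.

Variables (node : nat -> L -> bool) (obj : nat -> L -> bool).
Variables (compat : nat -> L -> nat -> L -> bool) (lsize : L -> nat) (lacc : L -> bool).

(** After [k] merges, [v] stands for the tree of all [y] with [root k y = v]. This and the next two
    definitions summarise that tree: the part of the coalition of [v] seen so far, whether it has an
    objector, and the tops strictly below [v]. Objectors are judged by the label of [v], which all
    members share along edges inside a coalition. *)
Definition cnt l k v := count (fun y => croot l k y == v) (iota 0 n.+1).
Definition wit l k v := has (fun y => (croot l k y == v) && obj y (l v)) (iota 0 n.+1).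
Definition tops l k v b :=
  count (fun x => [&& root k x == v, x != v, top l x & act (l x) == b]) (iota 0 n).

(** All descendants of [x] have smaller indices, so [cnt l x x] is the complete size of the
    coalition with top [x]. An edge inside a coalition demands equal labels, that is, equal
    guesses. *)
Definition edge l x :=
  if top l x then
    ((par x < n) ==> compat (par x) (l (par x)) x (l x)) &&
    ((act (l x) != 0) ==>
       (cnt l x x == lsize (l x)) && (lacc (l x) || wit l x x))
  else l x == l (par x).

Variables (p ST : nat) (dl : nat -> L) (dt : nat -> nat) (dw : nat -> bool).
Variable db : nat -> nat -> nat.

Definition fits k v l s :=
  [/\ dl s = l v, forall x, x <= n -> root k x = v -> node x (l x),
      forall x, x < n -> root k x = v -> x != v -> edge l x,
      dt s = cnt l k v /\ dw s = wit l k v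
    & forall b, 0 < b <= p -> db s b = tops l k v b].

(** When the values of [db] are bits, the equations between sums force the activities completed on
    the two sides, and at [u] itself, to be distinct. *)
Definition merge v u s1 s2 s :=
  (dl s == dl s1) &&
  (if act (dl s2) == act (dl s1) then
     [&& dl s2 == dl s1, dt s == dt s1 + dt s2, dw s == dw s1 || dw s2
       & all (fun b => db s b == db s1 b + db s2 b) (iota 1 p)]
   else
     [&& (v < n) ==> compat v (dl s1) u (dl s2),
         (act (dl s2) != 0) ==>
           (dt s2 == lsize (dl s2)) && (lacc (dl s2) || dw s2),
         dt s == dt s1, dw s == dw s1
       & all (fun b => db s b == db s1 b + db s2 b + (act (dl s2) == b))
             (iota 1 p)]).

Definition base v s :=
  [&& node v (dl s), dt s == 1, dw s == obj v (dl s)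
    & all (fun b => db s b == 0) (iota 1 p)].

Fixpoint dp k v s : bool :=
  if k is k'.+1 then
    if v == par k' then
      has (fun s1 => has (fun s2 =>
        [&& dp k' v s1, dp k' k' s2 & merge v k' s1 s2 s]) (iota 0 ST)) (iota 0 ST)
    else dp k' v s
  else base v s.

Hypothesis db_le1 : forall s b, db s b <= 1.
Hypothesis dec_surj : forall x lam t w (chi : nat -> nat), x <= n -> node x lam ->
  t <= n.+1 -> (forall b, 0 < b <= p -> chi b <= 1) ->
  exists s, [/\ s < ST, dl s = lam, dt s = t, dw s = w
    & forall b, 0 < b <= p -> db s b = chi b].

Lemma all_iota1 (a : pred nat) : reflect (forall b, 0 < b <= p -> a b) (all a (iota 1 p)).
Proof.
by apply: (iffP allP) => H b Hb; apply: H; move: Hb; rewrite mem_iota; lia.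
Qed.

(** This and the following lemmas show that everything recorded about the tree of [v] depends only
    on the labels in that tree, so that labellings of disjoint trees can be glued. *)
Lemma top_eq l l' k v x : k <= n -> k <= v ->
  (forall y, y <= n -> root k y = v -> l y = l' y) ->
  x < k -> root k x = v -> top l x = top l' x.
Proof.
move=> kn kv H xk xv; have xn : x < n by exact: leq_trans kn.
have px := par_gt xn.
by rewrite /top !H -?root_par //; lia.
Qed.

Lemma croot_eqE l l' k v y : k <= n -> k <= v ->
  (forall y, y <= n -> root k y = v -> l y = l' y) ->
  (croot l k y == v) = (croot l' k y == v).
Proof.
move=> kn kv H; have [yv|nyv] := eqVneq (root k y) v.
  by rewrite (@eq_croot l l') // => x xk; rewrite yv; apply: (top_eq kn kv).
have nE l0 : (croot l0 k y == v) = false.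
  apply: contraNF nyv => /eqP E; rewrite -(@croot_root l0) ?E //.
by rewrite !nE.
Qed.

Lemma cnt_eq l l' k v : k <= n -> k <= v ->
  (forall y, y <= n -> root k y = v -> l y = l' y) -> cnt l k v = cnt l' k v.
Proof. by move=> kn kv H; apply: eq_count => y; apply: croot_eqE. Qed.

Lemma wit_eq l l' k v : k <= n -> k <= v <= n ->
  (forall y, y <= n -> root k y = v -> l y = l' y) -> wit l k v = wit l' k v.
Proof.
move=> kn /andP[kv vn] H; apply: eq_has => y.
by rewrite (croot_eqE _ kn kv H) H // root_id.
Qed.

Lemma edge_eq l l' k v x : k <= n -> k <= v ->
  (forall y, y <= n -> root k y = v -> l y = l' y) ->
  x < k -> root k x = v -> edge l x = edge l' x.
Proof.
move=> kn kv H xk xv; have xn : x < n by exact: leq_trans kn.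
have px := par_gt xn.
(* The tree of [x] just before its own merge is part of the tree of [v]. *)
have Hx : forall y, y <= n -> root x y = x -> l y = l' y.
  move=> y yn yx; apply: H => //; rewrite -xv; apply: (@root_eq x); first exact: ltnW.
  by rewrite yx root_id.
rewrite /edge (top_eq kn kv H) // !(cnt_eq (ltnW xn) _ Hx) // (wit_eq (ltnW xn) _ Hx);
  last by lia.
by rewrite !H -?root_par //; lia.
Qed.

Lemma tops_eq l l' k v b : k <= n -> k <= v ->
  (forall y, y <= n -> root k y = v -> l y = l' y) -> tops l k v b = tops l' k v b.
Proof.
move=> kn kv H; apply: eq_in_count => x; rewrite mem_iota add0n => /= xn.
case: eqP => //= xv; case: eqVneq => //= nxv.
have xk : x < k by rewrite ltnNge; apply: contra nxv => kx; rewrite -xv root_id.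
by rewrite (top_eq kn kv H) // H // ltnW.
Qed.

Lemma fits_eq l l' k v s : k <= n -> k <= v <= n ->
  (forall y, y <= n -> root k y = v -> l y = l' y) ->
  fits k v l s -> fits k v l' s.
Proof.
move=> kn /andP[kv vn] H [f1 f2 f3 [f4 f5] f6]; split.
- by rewrite f1 H // root_id.
- by move=> x xn xv; rewrite -H // f2.
- move=> x xn xv nxv; rewrite -(edge_eq kn kv H) ?f3 //.
  by rewrite ltnNge; apply: contra nxv => kx; rewrite -xv root_id.
- by rewrite -(cnt_eq kn kv H) -(wit_eq kn _ H) ?kv.
- by move=> b Hb; rewrite -(tops_eq _ kn kv H) f6.
Qed.

Lemma root_step k x : k < n -> x <= n ->
  (root k.+1 x == par k) = (root k x == par k) || (root k x == k).
Proof.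
by move=> kn xn /=; case: (eqVneq (root k x) k) => [_|_]; rewrite ?eqxx ?orbT ?orbF.
Qed.

Lemma cnt_step l k : k < n ->
  cnt l k.+1 (par k) = cnt l k (par k) + (if top l k then 0 else cnt l k k).
Proof.
move=> kn; have pk := par_gt kn; case: ifP => tk.
  by rewrite addn0; apply: eq_count => y /=; rewrite tk andbF.
apply: count_add => y _ /=; rewrite tk andbT.
by case: (eqVneq (croot l k y) k) => [->|_]; rewrite ?eqxx ?addn0 //;
  case: eqP => // ?; lia.
Qed.

(** Equality of the labels is needed because objectors from the tree of [k] are now judged by the
    label of the parent. *)
Lemma wit_step l k : k < n -> (~~ top l k -> l k = l (par k)) ->
  wit l k.+1 (par k) =
  if top l k then wit l k (par k) else wit l k (par k) || wit l k k.
Proof.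
move=> kn E; have pk := par_gt kn; case: ifP => tk.
  by apply: eq_has => y /=; rewrite tk andbF.
rewrite /wit E ?tk // -has_predU; apply: eq_has => y /=; rewrite tk andbT -andb_orl.
congr (_ && _); case: (eqVneq (croot l k y) k) => [->|_]; rewrite ?eqxx ?orbT //.
by rewrite orbF.
Qed.

(** The last term is for [k] itself, which is not counted in its own tree but lies strictly below
    its parent. *)
Lemma tops_step l k b : k < n ->
  tops l k.+1 (par k) b = tops l k (par k) b + tops l k k b +
    (top l k && (act (l k) == b)).
Proof.
move=> kn; have pk := par_gt kn; pose P x := top l x && (act (l x) == b).
have -> : (top l k && (act (l k) == b)) = count (fun x => (x == k) && P x) (iota 0 n)
  :> nat.
  rewrite -/(P k); case Pk: (P k).
    rewrite (@eq_count _ _ (pred1 k)); last by move=> x /=; case: eqP => // ->.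
    by rewrite count_uniq_mem ?iota_uniq // mem_iota kn.
  rewrite (@eq_count _ _ pred0) ?count_pred0 // => x /=.
  by case: eqP => // ->.
rewrite -addnA /tops -(count_add (a := fun x => (root k x == k) && P x)).
  apply: count_add => x; rewrite mem_iota => /= xn;
    rewrite -/(root k.+1 x) root_step //; last by lia.
  rewrite -/(P x); case: (P x); rewrite ?andbF ?andbT //.
  case: (eqVneq (root k x) (par k)) => [E|nE] /=.
    have -> : (root k x == k) = false by rewrite E; lia.
    by rewrite addn0.
  case: (eqVneq (root k x) k) => //= E.
  case: eqP => // xp; move: nE; rewrite xp root_id ?eqxx //; lia.
move=> x; rewrite mem_iota => /= xn; rewrite -/(P x); case: (P x);
  rewrite ?andbF ?andbT //.
case: (eqVneq x k) => [->|_]; first by rewrite root_id // eqxx.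
by rewrite andbT addn0.
Qed.

Lemma fits_merge l k s1 s2 s : k < n ->
  fits k (par k) l s1 -> fits k k l s2 -> merge (par k) k s1 s2 s ->
  fits k.+1 (par k) l s.
Proof.
move=> kn [a1 a2 a3 [a4 a5] a6] [b1 b2 b3 [b4 b5] b6]; rewrite /merge a1 b1.
have pk := par_gt kn.
case/andP=> /eqP d1 M.
have rootS x : x <= n -> root k.+1 x = par k -> (root k x = par k) \/ (root k x = k).
  by move=> xn /eqP; rewrite root_step // => /orP[] /eqP; [left|right].
have edges : edge l k -> forall x, x < n -> root k.+1 x = par k -> x != par k -> edge l x.
  move=> ek x xn xv nxv; case: (rootS x (ltnW xn) xv) => E; first exact: a3.
  by case: (eqVneq x k) => [->//|nk]; apply: b3.
have nodes : forall x, x <= n -> root k.+1 x = par k -> node x (l x).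
  by move=> x xn xv; case: (rootS x xn xv) => E; [apply: a2|apply: b2].
move: M; case: ifP => [E|nE].
  case/and4P=> /eqP Ek /eqP t1 /eqP w1 /all_iota1 h.
  have tk : top l k = false by rewrite /top E.
  split=> //.
  - by apply: edges; rewrite /edge tk Ek.
  - by rewrite (cnt_step l kn) (wit_step kn (fun _ => Ek)) tk t1 w1 a4 b4 a5 b5.
  - by move=> b Hb; rewrite tops_step // tk /= addn0 (eqP (h b Hb)) a6 // b6.
case/and5P=> cm cc /eqP t1 /eqP w1 /all_iota1 h.
have tk : top l k by rewrite /top nE.
split=> //.
- by apply: edges; rewrite /edge tk cm -b4 -b5.
- by rewrite (cnt_step l kn) (wit_step kn) tk // addn0 t1 w1 a4 a5.
- by move=> b Hb; rewrite tops_step // tk /= (eqP (h b Hb)) a6 // b6.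
Qed.

Lemma cnt_le l k v : cnt l k v <= n.+1.
Proof. by rewrite -[n.+1](size_iota 0) count_size. Qed.

Lemma fits_split l k s : k < n -> fits k.+1 (par k) l s ->
  exists s1 s2, [/\ s1 < ST, s2 < ST, fits k (par k) l s1, fits k k l s2
    & merge (par k) k s1 s2 s].
Proof.
move=> kn [f1 f2 f3 [f4 f5] f6]; have pk := par_gt kn.
have rootS x : x <= n -> root k x = par k \/ root k x = k -> root k.+1 x = par k.
  by move=> xn H; apply/eqP; rewrite root_step //; case: H => ->; rewrite eqxx ?orbT.
have nodev : node (par k) (l (par k)).
  by apply: f2; [lia|apply: rootS; [lia|left; rewrite root_id //; lia]].
have nodek : node k (l k).
  by apply: f2; [lia|apply: rootS; [lia|right; rewrite root_id //; lia]].
have ek : edge l k by apply: f3; [lia|apply: rootS; [lia|right; rewrite root_id]|lia].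
(* The count in the merged tree is a bit, so both parts are bits too and can be represented by
   states. *)
have tle b : 0 < b <= p -> tops l k (par k) b <= 1 /\ tops l k k b <= 1.
  by move=> Hb; have := db_le1 s b; rewrite f6 // tops_step //; lia.
have [|||s1 [s1S d1 t1 w1 h1]] := @dec_surj (par k) (l (par k)) (cnt l k (par k))
  (wit l k (par k)) (tops l k (par k)) _ nodev; [lia|exact: cnt_le|by move=> b /tle[]|].
have [|||s2 [s2S d2 t2 w2 h2]] := @dec_surj k (l k) (cnt l k k)
  (wit l k k) (tops l k k) _ nodek; [lia|exact: cnt_le|by move=> b /tle[]|].
exists s1, s2; split=> //.
- split=> //.
  + by move=> x xn xv; apply: f2 => //; apply: rootS => //; left.
  + by move=> x xn xv nxv; apply: f3 => //; apply: rootS; [lia|left].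
- split=> //.
  + by move=> x xn xv; apply: f2 => //; apply: rootS => //; right.
  + move=> x xn xv nxv; apply: f3 => //; first by apply: rootS; [lia|right].
    apply: contra nxv => /eqP xp; move: xv; rewrite xp root_id; lia.
rewrite /merge f1 d1 d2 t1 t2 w1 w2 f4 f5 eqxx /=.
have tE : (act (l k) == act (l (par k))) = ~~ top l k by rewrite negbK.
have Ek : ~~ top l k -> l k = l (par k).
  by move=> tk; move: ek; rewrite /edge (negbTE tk) => /eqP.
rewrite tE (cnt_step l kn) (wit_step kn Ek); move: ek; rewrite /edge;
  case: (boolP (top l k)) => tk /=.
  case/andP=> -> ->; rewrite addn0 !eqxx /=; apply/all_iota1 => b Hb.
  by rewrite f6 // h1 // h2 // tops_step // tk.
move=> ->; rewrite !eqxx /=; apply/all_iota1 => b Hb.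
by rewrite f6 // h1 // h2 // tops_step // (negbTE tk) addn0.
Qed.

Lemma base_fits v s : v <= n -> base v s <-> exists l, fits 0 v l s.
Proof.
move=> vn.
have cnt0 l : cnt l 0 v = 1 by rewrite /cnt /= -[LHS]/(count_mem v (iota 0 n.+1))
  count_uniq_mem ?iota_uniq // mem_iota add0n ltnS vn.
have wit0 l : wit l 0 v = obj v (l v).
  apply/hasP/idP => [[y _ /andP[/eqP <-]] //|ov].
  by exists v; [rewrite mem_iota add0n ltnS vn|rewrite eqxx].
have tops0 l b : tops l 0 v b = 0.
  rewrite /tops (@eq_count _ _ pred0) ?count_pred0 // => x /=.
  by case: eqP.
split=> [/and4P[h1 /eqP h2 /eqP h3 /all_iota1 h4]|[l [f1 f2 f3 [f4 f5] f6]]].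
  exists (fun _ => dl s); split=> //.
  - by move=> x _ /= ->.
  - by move=> x _ /= ->; rewrite eqxx.
  - by rewrite cnt0 wit0.
  - by move=> b Hb; rewrite tops0; apply/eqP/h4.
rewrite /base f4 f5 cnt0 wit0 f1 f2 //= eqxx; apply/all_iota1 => b Hb.
by rewrite f6 // tops0.
Qed.

Lemma dpP k v s : k <= v <= n -> dp k v s <-> exists l, fits k v l s.
Proof.
elim: k v s => [|k IH] v s /andP[kv vn]; first exact: base_fits.
have kn : k < n by lia.
have pk := par_gt kn; rewrite [dp _ _ _]/=; case: eqP => [->|nvp].
  split.
    case/hasP=> s1 _ /hasP[s2 _ /and3P[/IH[|l1 f1]]]; first by lia.
    move=> /IH[|l2 f2 M]; first by lia.
    (* The trees of [k] and of its parent are disjoint, so the two labellings are glued along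
       [root k]. *)
    pose l x := if root k x == k then l2 x else l1 x.
    exists l; apply: (@fits_merge l k s1 s2) => //.
      apply: fits_eq f1; [lia|lia|].
      by move=> y yn yv; rewrite /l yv; case: eqP => // ?; lia.
    apply: fits_eq f2; [lia|lia|].
    by move=> y yn yv; rewrite /l yv eqxx.
  case=> l /(fits_split kn)[s1 [s2 [h1 h2 f1 f2 M]]].
  apply/hasP; exists s1; first by rewrite mem_iota.
  apply/hasP; exists s2; first by rewrite mem_iota.
  by rewrite M andbT; apply/andP; split; apply/IH; [lia|exists l|lia|exists l].
rewrite IH; last by lia.
(* Merging [k] into a vertex other than [v] changes nothing in the tree of [v]. *)
have rS x : x <= n -> (root k.+1 x = v) <-> (root k x = v).
  move=> xn /=; case: eqP => // E; split=> h; lia.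
have cS l : cnt l k.+1 v = cnt l k v.
  apply: eq_count => y /=; case: ifP => // /andP[/eqP -> _].
  by case: eqP => [?|_]; [lia|case: eqP => // ?; lia].
have wS l : wit l k.+1 v = wit l k v.
  apply: eq_has => y /=; congr (_ && _); case: ifP => // /andP[/eqP -> _].
  by case: eqP => [?|_]; [lia|case: eqP => // ?; lia].
have tS l b : tops l k.+1 v b = tops l k v b.
  apply: eq_in_count => x; rewrite mem_iota add0n => /andP[_ xn]; congr (_ && _).
  by have [h1 h2] := rS x (ltnW xn); apply/eqP/eqP.
split=> -[l [f1 f2 f3 [f4 f5] f6]]; exists l; split=> //.
- by move=> x xn /(rS x xn); apply: f2.
- by move=> x xn /(rS x (ltnW xn)); apply: f3.
- by rewrite cS wS.
- by move=> b Hb; rewrite tS f6.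
- by move=> x xn h; apply: f2 => //; apply/(rS x xn).
- by move=> x xn h; apply: f3 => //; apply/(rS x (ltnW xn)).
- by rewrite -cS -wS.
- by move=> b Hb; rewrite -tS f6.
Qed.

End ForestDP.

(** * Labels and stable assignments *)

Lemma count_le1_eq (T : eqType) (P : pred T) (s : seq T) x y :
  count P s <= 1 -> x \in s -> y \in s -> P x -> P y -> x = y.
Proof.
move=> c1 xs ys Px Py; apply/eqP; apply: contraLR c1 => nxy.
rewrite -ltnNge -size_filter; apply: (@uniq_leq_size _ [:: x; y]).
  by rewrite /= inE nxy.
by move=> z; rewrite !inE mem_filter => /orP[] /eqP ->; apply/andP.
Qed.

Section Labels.

Variables (n p : nat).

(** The components are the activity (0 for void), the guessed final size and the acceptance bit. *)
Definition lab : eqType := (nat * nat * bool)%type.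
Definition lact (m : lab) := m.1.1.
Definition lsz (m : lab) := m.1.2.
Definition lac (m : lab) := m.2.
Definition void : lab := (0, 0, false).

(* The position in [alts n p] of the alternative (a, k), where activity [a] is
   counted from 1 and the void alternative is (0, 0). *)
Definition alt_index a k := a.-1 * n + k.
Definition lalt (m : lab) := alt_index (lact m) (lsz m).

Variables (pr : nat -> nat -> nat -> bool) (ord : nat -> nat).

Definition strictn i x y := pr i x y && ~~ pr i y x.

(** A coalition of all [n] players cannot grow, and size [n.+1] is outside the domain of the
    preferences; the first alternative avoids reading them there. *)
Definition accepts x (m : lab) :=
  (lsz m == n) || pr (ord x) (alt_index (lact m) (lsz m).+1) (lalt m).

Definition lnode (B : nat -> bool) (fixed : nat -> nat) x (m : lab) :=
  if x == n then m == void else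
  [&& lact m <= p, lsz m <= n,
      (lact m == 0) ==> (lsz m == 0) && ~~ lac m,
      (lact m != 0) ==> (0 < lsz m) && B (lact m) &
  [&& pr (ord x) (lalt m) 0,
      all (fun b => B b || ~~ strictn (ord x) (alt_index b 1) (lalt m)) (iota 1 p),
      lac m ==> accepts x m &
      (fixed (ord x) == 0) || (fixed (ord x) == (lact m).+1)]].

Definition lobj x m := ~~ accepts x m.

Definition deviates x (m m' : lab) :=
  [&& lact m' != 0, lac m' &
      strictn (ord x) (alt_index (lact m') (lsz m').+1) (lalt m)].

Definition lcompat v m u m' := ~~ deviates v m m' && ~~ deviates u m' m.

Variables (L : {set {set 'I_n}}) (pref : 'I_n -> rel (alt p)).
Variables (par : nat -> nat) (ps : 'I_n -> nat).
Hypothesis par_gt : forall x, x < n -> x < par x <= n.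
Hypothesis ps_lt : forall i, ps i < n.
Hypothesis ps_inj : injective ps.
Hypothesis ord_ps : forall i, ord (ps i) = i.
Hypothesis adj_ps : forall i j, adj L i j = (par (ps i) == ps j) || (par (ps j) == ps i).

Definition altn (x : alt p) := if x is Some (a, k) then alt_index (nat_of_ord a).+1 k
  else 0.

Hypothesis prE : forall (i : 'I_n) x y, x \in alts n p -> y \in alts n p ->
  pr i (altn x) (altn y) = pref i x y.

Lemma mem_alts (a : 'I_p) k : 0 < k <= n -> Some (a, k) \in alts n p.
Proof.
move=> Hk; rewrite inE /=; apply/allpairsP; exists (a, k).
by rewrite mem_enum mem_iota; split=> //=; lia.
Qed.

Lemma perm_ps : perm_eq [seq ps i | i <- enum 'I_n] (iota 0 n).
Proof.
apply: uniq_perm; [by rewrite map_inj_uniq ?enum_uniq|exact: iota_uniq|].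
have [|||_ //] := @uniq_min_size _ [seq ps i | i <- enum 'I_n] (iota 0 n).
- by rewrite map_inj_uniq ?enum_uniq.
- by move=> x /mapP[i _ ->]; rewrite mem_iota ps_lt.
- by rewrite size_iota size_map size_enum_ord.
Qed.

Lemma ps_surj x : x < n -> exists i, ps i = x.
Proof.
move=> xn; have : x \in iota 0 n by rewrite mem_iota.
by rewrite -(perm_mem perm_ps) => /mapP[i _ ->]; exists i.
Qed.

Lemma card_ps (P : pred nat) (C : {set 'I_n}) : (forall i, (i \in C) = P (ps i)) ->
  #|C| = count P (iota 0 n).
Proof.
move=> CE; rewrite -(permP perm_ps) count_map cardE {1}/enum_mem -enumT size_filter.
by apply: eq_count => i /=; rewrite -CE.
Qed.

(** Labels are constant up to the first top, and that top is reached before the virtual root because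
    the latter is void. *)
Lemma climb (l : nat -> lab) : lact (l n) = 0 ->
  (forall x, x < n -> ~~ top par lact l x -> l x = l (par x)) ->
  forall x, x < n -> lact (l x) != 0 -> exists z,
    [/\ x <= z < n, top par lact l z, l z = l x & croot par lact l z x = z].
Proof.
move=> ln nt x; have [m] := ubnP (n - x); elim: m x => // m IH x Hm xn ax.
have px := par_gt xn.
have [tx|ntx] := boolP (top par lact l x).
  by exists x; rewrite leqnn croot_id.
have lx := nt x xn ntx.
have pn : par x < n.
  rewrite ltn_neqAle; case/andP: px => _ ->; rewrite andbT.
  by apply: contra ax => /eqP E; rewrite lx E ln.
have [||z [z1 z2 z3 z4]] := IH (par x) _ pn; [lia|by rewrite -lx|].
exists z; split=> //; [lia|by rewrite z3|].
by rewrite (croot_par par_gt) // ; lia.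
Qed.

Definition sol B fixed (l : nat -> lab) :=
  [/\ forall x, x <= n -> lnode B fixed x (l x),
      forall x, x < n -> edge n par lact lobj lcompat lsz lac l x
    & forall b, 0 < b <= p -> tops n par lact l n n b = B b].

Definition consistent (fixed : nat -> nat) (pi : 'I_n -> option 'I_p) :=
  forall i : 'I_n, fixed i = 0 \/ fixed i = (code_activity (pi i)).+1.

Definition decode_activity (a : nat) : option 'I_p := if a is a'.+1 then insub a'
  else None.

Lemma decode_activityK a : a <= p -> code_activity (decode_activity a) = a.
Proof. by case: a => //= a ap; rewrite insubT. Qed.

Lemma adj_sym i j : adj L i j = adj L j i.
Proof. by rewrite /adj eq_sym setUC. Qed.

(** * From admissible labellings to stable assignments *)

Section Soundness.
Variables (B : nat -> bool) (fixed : nat -> nat) (l : nat -> lab).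
Hypothesis sl : sol B fixed l.

Let pi i := decode_activity (lact (l (ps i))).

Let nodeE x : x < n -> [/\ lact (l x) <= p, lsz (l x) <= n,
      (lact (l x) == 0) ==> (lsz (l x) == 0) && ~~ lac (l x),
      (lact (l x) != 0) ==> (0 < lsz (l x)) && B (lact (l x)) &
  [/\ pr (ord x) (lalt (l x)) 0,
      all (fun b => B b || ~~ strictn (ord x) (alt_index b 1) (lalt (l x))) (iota 1 p),
      lac (l x) ==> accepts x (l x) &
      (fixed (ord x) == 0) || (fixed (ord x) == (lact (l x)).+1)]].
Proof.
move=> xn; have [H _ _] := sl; have := H x (ltnW xn); rewrite /lnode.
by rewrite (ltn_eqF xn) => /and5P[-> -> -> -> /and4P[-> -> -> ->]].
Qed.

Let ln : l n = void.
Proof. by have [H _ _] := sl; have := H n (leqnn n); rewrite /lnode eqxx => /eqP. Qed.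

Let code_pi i : code_activity (pi i) = lact (l (ps i)).
Proof. by apply: decode_activityK; have [] := nodeE (ps_lt i). Qed.

Let in_coal i (a : 'I_p) : (i \in coalition pi a) = (lact (l (ps i)) == a.+1).
Proof.
by rewrite inE -code_pi; case: (pi i).
Qed.

Let edgeN x : x < n -> ~~ top par lact l x -> l x = l (par x).
Proof.
by move=> xn tx; have [_ H _] := sl; have := H x xn; rewrite /edge (negbTE tx) => /eqP.
Qed.

Let lact_n : lact (l n) = 0. Proof. by rewrite ln. Qed.

Let top_uniq x y : x < n -> y < n -> top par lact l x -> top par lact l y ->
  lact (l x) = lact (l y) -> lact (l x) != 0 -> x = y.
Proof.
move=> xn yn tx ty E ax; have [_ _ T] := sl.
have [ap _ _ _ _] := nodeE xn.
have := T (lact (l x)); rewrite lt0n ax ap => /(_ isT) c.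
apply: (@count_le1_eq _ (fun x0 => [&& root par n x0 == n, x0 != n,
  top par lact l x0 & lact (l x0) == lact (l x)]) (iota 0 n)).
- by rewrite -/(tops n par lact l n n (lact (l x))) c; case: (B _).
- by rewrite mem_iota.
- by rewrite mem_iota.
- by rewrite (root_last par_gt (ltnW xn)) (ltn_eqF xn) tx !eqxx.
- by rewrite (root_last par_gt (ltnW yn)) (ltn_eqF yn) ty E !eqxx.
Qed.

(** Every member climbs to a top of its activity, and there is only one; conversely, climbing
    preserves the activity. *)
Let coal_top (a : 'I_p) i : i \in coalition pi a -> exists z,
  [/\ top par lact l z, lact (l z) = a.+1,
      forall j, (j \in coalition pi a) = (croot par lact l z (ps j) == z)
    & z < n /\ forall j, j \in coalition pi a -> l (ps j) = l z].
Proof.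
rewrite in_coal => /eqP ai.
have [|z [z1 z2 z3 z4]] := climb lact_n edgeN (ps_lt i); first by rewrite ai.
have {z1} zn : z < n by lia.
have az : lact (l z) = a.+1 by rewrite z3.
have Hj j : lact (l (ps j)) = a.+1 -> croot par lact l z (ps j) = z /\ l (ps j) = l z.
  move=> aj; have [|z' [z1' z2' z3' z4']] := climb lact_n edgeN (ps_lt j).
    by rewrite aj.
  suff -> : z = z' by [].
  by apply: top_uniq; rewrite ?az ?z3' //; lia.
exists z; split=> //; last split=> //.
- move=> j; rewrite in_coal; apply/eqP/eqP => [/Hj[]//|E].
  by rewrite -(@croot_act n par _ lact l z (ps j) (ltnW (ps_lt j)) (ltnW zn)) E.
- by move=> j; rewrite in_coal => /eqP /Hj[].
Qed.

Let card_coal (a : 'I_p) i : i \in coalition pi a ->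
  #|coalition pi a| = lsz (l (ps i)).
Proof.
move=> ia; have [z [tz az Cz [zn lz]]] := coal_top ia.
have [_ /(_ z zn) + _] := sl; rewrite /edge tz az /= => /andP[_ /andP[/eqP + _]].
rewrite lz // => <-; rewrite (card_ps (P := fun y => croot par lact l z y == z)) //.
(* The range of [cnt] includes the virtual root, which does not climb and contributes nothing. *)
rewrite /cnt -addn1 iotaD count_cat /= (croot_id par lact l (ltnW zn)).
by rewrite (gtn_eqF zn) !addn0.
Qed.

Let pos_pi i : altn (pos pi i) = lalt (l (ps i)) /\ pos pi i \in alts n p.
Proof.
have [ap sn a0 a1 _] := nodeE (ps_lt i).
rewrite /pos; case E : (pi i) => [a|]; have := code_pi i; rewrite E /= => Ea.
  have ia : i \in coalition pi a by rewrite inE E.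
  rewrite (card_coal ia) /lalt -Ea; split=> //; apply: mem_alts.
  by move: a1; rewrite -Ea /= => /andP[-> _]; rewrite sn.
rewrite mem_head; split=> //.
by move: a0; rewrite /lalt -Ea /= => /andP[/eqP -> _].
Qed.

(** The chain of parents of a member stays in the coalition until it reaches the unique top, so any
    two members are joined through it. *)
Let sound_feasible : feasible L pi.
Proof.
move=> a x y xa ya; set e := [rel u v | adj L u v && (u \in _) && (v \in _)].
have e_sym : symmetric e.
  by move=> u v; rewrite /e /= adj_sym andbAC.
have [z [tz az Cz [zn lz]]] := coal_top xa; have [iz izE] := ps_surj zn.
have toz j : j \in coalition pi a -> connect e j iz.
  have [m] := ubnP (z - ps j); elim: m j => // m IH j Hm ja.
  have jz : ps j <= z.
    rewrite leqNgt; apply/negP => zj.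
    by move: ja; rewrite Cz croot_id ?(gtn_eqF zj) // ltnW.
  have [jE|nj] := eqVneq (ps j) z; first by rewrite (ps_inj (etrans jE (esym izE))).
  have tj : ~~ top par lact l (ps j).
    apply: contra nj => tj; apply/eqP; apply: top_uniq => //.
      by rewrite lz // az.
    by rewrite lz // az.
  have lj := edgeN (ps_lt j) tj; have pj := par_gt (ps_lt j).
  have pn : par (ps j) < n.
    rewrite ltn_neqAle; case/andP: pj => _ ->; rewrite andbT.
    by apply/negP => /eqP E; move: (lz _ ja); rewrite lj E ln => E2; move: az;
      rewrite -E2.
  have [k kE] := ps_surj pn.
  have ka : k \in coalition pi a by rewrite in_coal kE -lj -in_coal.
  apply: connect_trans (connect1 _) (IH k _ ka); last by lia.
  by rewrite /= ja ka adj_ps kE eqxx.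
apply: connect_trans (toz x xa) _; rewrite (sym_connect_sym e_sym); exact: toz.
Qed.

Lemma sol_stable : exists pi, indiv_stable L pref pi /\ consistent fixed pi.
Proof.
exists pi; split; last first.
  move=> i; have [_ _ _ _ [_ _ _]] := nodeE (ps_lt i).
  by rewrite ord_ps code_pi => /orP[] /eqP ->; [left|right].
split; first exact: sound_feasible.
  move=> i; have [E Ea] := pos_pi i; have [_ _ _ _ [ir _ _ _]] := nodeE (ps_lt i).
  by rewrite -(prE i Ea (mem_head _ _)) E -ord_ps.
move=> i a [nia conn st acc].
have [E Ea] := pos_pi i; have [_ _ _ _ [_ un _ _]] := nodeE (ps_lt i).
have iC : i \notin coalition pi a by rewrite inE.
have Cn : #|coalition pi a| < n.
  rewrite -[n in _ < n]card_ord -cardsT; apply: proper_card; rewrite properE subsetT.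
  by apply/subsetPn; exists i.
have st' : strictn (ord (ps i)) (alt_index a.+1 #|coalition pi a|.+1) (lalt (l (ps i))).
  move: st; rewrite /strict /strictn ord_ps -E.
  by rewrite -!prE // mem_alts.
have [C0|[c cC]] := set_0Vmem (coalition pi a).
  have ai : a.+1 \in iota 1 p by rewrite mem_iota; have := ltn_ord a; lia.
  (* A strict gain from founding [a] forces [a] into [B]; but then [a] has a top, so its coalition
     is not empty. *)
  move/allP: un => /(_ a.+1 ai).
  rewrite C0 cards0 in st'; rewrite st' orbF => Ba.
  have [_ _ /(_ a.+1)] := sl; rewrite ltn_ord => /(_ isT).
  rewrite Ba /tops => c1; have : has (fun x => [&& root par n x == n, x != n,
    top par lact l x & lact (l x) == a.+1]) (iota 0 n) by rewrite has_count c1.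
  case/hasP=> x; rewrite mem_iota add0n => /andP[_ xn] /and4P[_ _ _ ax].
  have [j jE] := ps_surj xn; have : j \in coalition pi a by rewrite in_coal jE.
  by rewrite C0 inE.
(* Connectedness of the enlarged coalition gives [i] a neighbour [j] in the old one. *)
have /connectP[[|j q] /=] := conn i c (setU11 _ _) (setU1r _ cC).
  by move=> _ E2; rewrite -E2 cC in iC.
case/andP=> /andP[/andP[aij _]]; rewrite in_setU1 => jC _ _.
have {}jC : j \in coalition pi a.
  by case/orP: jC => // /eqP ji; move: aij; rewrite /adj ji eqxx.
have nact : lact (l (ps i)) != lact (l (ps j)).
  by apply: contra iC; rewrite !in_coal => /eqP ->; rewrite -in_coal.
have nd : ~~ deviates (ps i) (l (ps i)) (l (ps j)).
  move: aij; rewrite adj_ps => /orP[] /eqP pE.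
    have [_ /(_ _ (ps_lt i)) + _] := sl; rewrite /edge /top pE nact ps_lt /=.
    by case/andP=> /andP[].
  have [_ /(_ _ (ps_lt j)) + _] := sl; rewrite /edge /top pE eq_sym nact ps_lt /=.
  by case/andP=> /andP[].
move: nd; rewrite /deviates -(card_coal jC).
have -> : lact (l (ps j)) = a.+1 by apply/eqP; rewrite -in_coal.
rewrite st' andbT /= => nac.
(* The edge between [i] and [j] forces the bit off, so the condition at the top exhibits a member
   refusing one more, against the consent [acc]. *)
have [z [tz az Cz [zn lz]]] := coal_top jC.
have [_ /(_ z zn) + _] := sl; rewrite /edge tz az /=.
rewrite -(lz j jC) (negbTE nac) /= => /and3P[_ _ /hasP[y yn /andP[cy ob]]].
have {}yn : y < n.
  move: yn cy; rewrite mem_iota add0n ltnS /= leq_eqVlt => /orP[/eqP ->|//].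
  by rewrite croot_id ?(gtn_eqF zn) // ltnW.
have [j' jE'] := ps_surj yn; have j'C : j' \in coalition pi a by rewrite Cz jE'.
move: ob; rewrite /lobj /accepts -(lz _ j'C) /lalt.
have -> : lact (l (ps j')) = a.+1 by apply/eqP; rewrite -in_coal.
rewrite -(card_coal j'C) -jE' ord_ps (ltn_eqF Cn) /=.
have := acc j' j'C; rewrite -prE; last 2 first.
- by apply: mem_alts.
- by apply: mem_alts; rewrite (ltnW Cn) andbT card_gt0; apply/set0Pn; exists j.
by rewrite /altn => ->.
Qed.

End Soundness.

(** * From stable assignments to admissible labellings *)

Section Completeness.
Variables (fixed : nat -> nat) (pi : 'I_n -> option 'I_p).
Hypothesis stab : indiv_stable L pref pi.
Hypothesis cons : consistent fixed pi.

Let B b := [exists i, code_activity (pi i) == b].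

Let labi i : lab :=
  if pi i is Some a then
    let k := #|coalition pi a| in
    ((nat_of_ord a).+1, k, [forall (j | j \in coalition pi a),
       (k == n) || pref j (Some (a, k.+1)) (Some (a, k))])
  else void.

Let l x : lab :=
  if x < n then (if insub (ord x) is Some i then labi i else void) else void.

Let l_ps i : l (ps i) = labi i.
Proof. by rewrite /l ps_lt ord_ps valK. Qed.

Let l_n : l n = void. Proof. by rewrite /l ltnn. Qed.

Let act_labi i : lact (labi i) = code_activity (pi i).
Proof. by rewrite /labi; case: (pi i). Qed.

Let code_inj i j : code_activity (pi i) = code_activity (pi j) -> pi i = pi j.
Proof. by case: (pi i) (pi j) => [a|] [b|] //= [/val_inj ->]. Qed.

Let in_coal i (a : 'I_p) : (i \in coalition pi a) = (code_activity (pi i) == a.+1).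
Proof. by rewrite inE; case: (pi i). Qed.

Let card_lt (a : 'I_p) i : i \notin coalition pi a -> #|coalition pi a| < n.
Proof.
move=> iC; rewrite -[n in _ < n]card_ord -cardsT; apply: proper_card.
by rewrite properE subsetT; apply/subsetPn; exists i.
Qed.

Let pos_labi i : altn (pos pi i) = lalt (labi i) /\ pos pi i \in alts n p.
Proof.
rewrite /pos /labi; case E : (pi i) => [a|] /=; last by rewrite mem_head.
split=> //; apply: mem_alts; rewrite card_gt0 -[n in _ <= n]card_ord max_card andbT.
by apply/set0Pn; exists i; rewrite inE E.
Qed.

Let strictE (i : 'I_n) (a : 'I_p) k : 0 < k <= n ->
  strictn i (alt_index a.+1 k) (lalt (labi i)) = strict (pref i) (Some (a, k)) (pos pi i).
Proof.
move=> Hk; have [<- pa] := pos_labi i.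
by rewrite /strictn /strict -!prE ?mem_alts.
Qed.

Let nodes x : x <= n -> lnode B fixed x (l x).
Proof.
rewrite leq_eqVlt => /orP[/eqP ->|xn]; first by rewrite /lnode eqxx l_n.
have [i <-] := ps_surj xn; rewrite l_ps /lnode (ltn_eqF (ps_lt i)) ord_ps.
have [F IR ND] := stab.
have ir : pr i (lalt (labi i)) 0.
  by have [<- pa] := pos_labi i; rewrite -[0]/(altn None) prE ?mem_head.
rewrite ir /= act_labi.
have -> : all (fun b => B b || ~~ strictn i (alt_index b 1) (lalt (labi i))) (iota 1 p).
  apply/allP => -[|b]; rewrite mem_iota // add1n => /andP[_]; rewrite ltnS => bp.
  have n1 : 0 < 1 <= n by have := ltn_ord i; lia.
  have [//|nB] := boolP (B b.+1); apply/negP => st.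
  have C0 : coalition pi (Ordinal bp) = set0.
    apply/setP => j; rewrite in_coal !inE; apply/negP => h; case/negP: nB.
    by apply/existsP; exists j.
  apply: (ND i (Ordinal bp)); rewrite /IS_deviation C0 cards0; split.
  - have : i \notin coalition pi (Ordinal bp) by rewrite C0 inE.
    by rewrite inE.
  - by move=> u v; rewrite setU0 !inE => /eqP -> /eqP ->; apply: connect0.
  - by rewrite -strictE.
  - by move=> j; rewrite inE.
have Bi : B (code_activity (pi i)) by apply/existsP; exists i.
have -> : (fixed i == 0) || (fixed i == (code_activity (pi i)).+1).
  by case: (cons i) => ->; rewrite eqxx ?orbT.
rewrite Bi !andbT /labi; case E : (pi i) => [a|] /=; last by [].
have ia : i \in coalition pi a by rewrite inE E.
have C0 : 0 < #|coalition pi a| by rewrite card_gt0; apply/set0Pn; exists i.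
have Cn : #|coalition pi a| <= n by rewrite -[n in _ <= n]card_ord max_card.
rewrite ltn_ord C0 /lsz /= Cn /=; apply/implyP => /forallP /(_ i).
rewrite ia /= /accepts /lsz /lact /lalt /= ord_ps.
have [//|nC] := eqVneq #|coalition pi a| n.
by rewrite -prE ?mem_alts ?C0 ?Cn //= ltn_neqAle nC Cn.
Qed.

(** If the bit of [j] is on, its whole coalition consents, and adjacency to [j] keeps the enlarged
    coalition connected; a strict gain would thus be an IS-deviation. *)
Let no_deviation i j : adj L i j -> code_activity (pi i) != code_activity (pi j) ->
  ~~ deviates (ps i) (labi i) (labi j).
Proof.
move=> aij nij; apply/negP; rewrite /deviates act_labi ord_ps.
case E : (pi j) => [a|] //= /andP[]; rewrite {1}/labi E /lac /= => /forallP acc.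
have -> : lsz (labi j) = #|coalition pi a| by rewrite /labi E.
have iC : i \notin coalition pi a by move: nij; rewrite in_coal E.
have Cn := card_lt iC.
have jC : j \in coalition pi a by rewrite inE E.
rewrite strictE // => st; have [F IR ND] := stab.
apply: (ND i a); split=> //.
- by move: iC; rewrite inE.
- pose e := [rel u v | adj L u v && (u \in i |: coalition pi a)
                       && (v \in i |: coalition pi a)].
  have e_sym : symmetric e by move=> u v; rewrite /e /= adj_sym andbAC.
  have toj u : u \in i |: coalition pi a -> connect e u j.
    rewrite in_setU1 => /orP[/eqP ->|uC].
      by apply: connect1; rewrite /= aij setU11 setU1r.
    have := F a u j uC jC; apply: connect_sub => x y /andP[/andP[axy xC] yC].
    by apply: connect1; rewrite /= axy !setU1r.
  move=> u v uC vC; apply: (connect_trans (e := e) (toj u uC)).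
  by rewrite (sym_connect_sym e_sym); apply: toj.
- by move=> k kC; have := acc k; rewrite kC (ltn_eqF Cn).
Qed.

(** Follow a path inside the coalition from [i] to [j]. A step to the parent stays on the climb
    towards [i], and cannot leave from [i] itself, whose parent has another activity; a step to a
    child reaches a vertex that climbs back through its parent. *)
Let climb_to_top i : pi i != None -> top par lact l (ps i) ->
  forall j, pi j = pi i -> croot par lact l (ps i) (ps j) = ps i.
Proof.
case E : (pi i) => [a|] // _ ti j Ej; have [F _ _] := stab.
have iC : i \in coalition pi a by rewrite inE E.
have jC : j \in coalition pi a by rewrite inE Ej.
have /connectP[q pq ->] := F a i j iC jC.
have ii : croot par lact l (ps i) (ps i) = ps i by rewrite croot_id.
suff gen u : croot par lact l (ps i) (ps u) = ps i ->
    path [rel u v | adj L u v && (u \in coalition pi a) && (v \in coalition pi a)] u q ->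
    croot par lact l (ps i) (ps (last u q)) = ps i by apply: gen.
elim: q u {pq} => //= k q IH u cu /andP[/andP[/andP[auk uC] kC] pq].
have uk : lact (l (ps u)) = lact (l (ps k)).
  by rewrite !l_ps !act_labi; move: uC kC; rewrite !in_coal => /eqP -> /eqP ->.
have ui : ps u <= ps i.
  rewrite leqNgt; apply/negP => h.
  by move: cu; rewrite croot_id ?(ltnW h) // => h2; rewrite h2 ltnn in h.
have pn : ps i <= n by rewrite ltnW.
apply: IH => //; move: auk; rewrite adj_ps => /orP[] /eqP pE.
  have [ui'|nui] := eqVneq (ps u) (ps i).
    by move: ti; rewrite -ui' /top pE uk eqxx.
  by rewrite -pE -(croot_par par_gt) ?cu ?pn ?andbT // /top ?pE ?uk ?eqxx //; lia.
have := par_gt (ps_lt k); rewrite pE => /andP[ku _].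
by rewrite (croot_par par_gt) ?pE // /top ?pE ?uk ?eqxx //; lia.
Qed.

Let edges x : x < n -> edge n par lact lobj lcompat lsz lac l x.
Proof.
move=> xn; have [i iE] := ps_surj xn; rewrite -iE; have pi_gt := par_gt (ps_lt i).
rewrite /edge; case: ifP => [tx|/negbFE/eqP]; last first.
  have [pn|pn] := eqVneq (par (ps i)) n.
    rewrite pn l_n l_ps act_labi /labi; by case: (pi i).
  have [j jE] := @ps_surj (par (ps i)) (ltac:(lia)).
  rewrite -jE !l_ps !act_labi => /code_inj E; rewrite /labi E eqxx //.
apply/andP; split.
  apply/implyP => pn; have [j jE] := ps_surj pn.
  move: tx; rewrite /top -jE !l_ps !act_labi => tx.
  have aij : adj L i j by rewrite adj_ps jE eqxx.
  by rewrite /lcompat !no_deviation // 1?eq_sym // adj_sym.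
apply/implyP; rewrite l_ps act_labi; case E : (pi i) => [a|] // _.
have ci : pi i != None by rewrite E.
(* What climbs to the top [ps i] is exactly its coalition; this yields both the size and, if the bit
   is off, the objector. *)
have C y : y < n.+1 -> (croot par lact l (ps i) y == ps i) =
    (y < n) && (lact (l y) == a.+1).
  rewrite ltnS leq_eqVlt => /orP[/eqP ->|yn].
    by rewrite croot_id ?(ltnW (ps_lt i)) // ltnn (gtn_eqF (ps_lt i)).
  rewrite yn; have [j <-] := ps_surj yn; apply/eqP/eqP => [E2|].
    rewrite -(@croot_act n par _ lact l (ps i)) ?(ltnW (ps_lt _)) // E2.
    by rewrite l_ps act_labi E.
  rewrite l_ps act_labi => E2; apply: climb_to_top => //.
  by apply: code_inj; rewrite E2 E.
have -> : cnt n par lact l (ps i) (ps i) = lsz (labi i).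
  rewrite /labi E /lsz /= (@card_ps (fun y => lact (l y) == a.+1)); last first.
    by move=> j; rewrite l_ps act_labi in_coal.
  rewrite /cnt -addn1 iotaD count_cat /= add0n C // ltnn addn0 addn0.
  by apply: eq_in_count => y; rewrite mem_iota add0n => /andP[_ yn];
    rewrite C ?yn // ltnW.
rewrite eqxx /=; case: (boolP (lac (labi i))) => //=; rewrite {1}/labi E /lac /=.
rewrite negb_forall => /existsP[j]; rewrite negb_imply => /andP[jC nacc].
apply/hasP; exists (ps j); first by rewrite mem_iota add0n ltnS (ltnW (ps_lt j)).
rewrite C ?ps_lt ?(leqW (ps_lt j)) //= l_ps act_labi -in_coal jC /= l_ps.
have -> : labi i = (a.+1, #|coalition pi a|, lac (labi i)) by rewrite /labi E.
move: nacc; rewrite /lobj /accepts /lalt /lsz /lact /= ord_ps.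
rewrite !negb_or => /andP[nC npr]; rewrite nC /=; apply: contra npr.
rewrite -prE; [exact|apply: mem_alts|apply: mem_alts].
  by rewrite /= ltn_neqAle nC -[n in _ <= n]card_ord max_card.
apply/andP; split; last by rewrite -[n in _ <= n]card_ord max_card.
by rewrite card_gt0; apply/set0Pn; exists j.
Qed.

Let tops_B b : 0 < b <= p -> tops n par lact l n n b = B b.
Proof.
move=> /andP[b0 bp]; rewrite /tops.
have E x : x < n -> [&& root par n x == n, x != n, top par lact l x & lact (l x) == b]
   = top par lact l x && (lact (l x) == b).
  by move=> xn; rewrite (root_last par_gt (ltnW xn)) eqxx (ltn_eqF xn).
have [/existsP[i /eqP ib]|nB] := boolP (B b); last first.
  apply/eqP; rewrite -leqn0 leqNgt -has_count; apply/negP => /hasP[x].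
  rewrite mem_iota add0n => /andP[_ xn]; rewrite E // => /andP[_].
  have [i <-] := ps_surj xn; rewrite l_ps act_labi => ib; case/negP: nB.
  by apply/existsP; exists i.
have nt x : x < n -> ~~ top par lact l x -> l x = l (par x).
  by move=> xn tx; have := edges xn; rewrite /edge (negbTE tx) => /eqP.
have ai : lact (l (ps i)) = b by rewrite l_ps act_labi.
have [||z [z1 z2 z3 z4]] := climb _ nt (ps_lt i).
- by rewrite l_n.
- by rewrite ai; lia.
have zn : z < n by lia.
rewrite (@eq_in_count _ _ (pred1 z)).
  by rewrite count_uniq_mem ?iota_uniq // mem_iota zn.
move=> x; rewrite mem_iota add0n => /andP[_ xn]; rewrite E //=.
apply/andP/eqP => [[tx /eqP ax]|->]; last by rewrite z2 z3 ai.
have [j jE] := ps_surj xn; have [k kE] := ps_surj zn.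
rewrite -jE -kE in tx ax z2 z3 *.
have pjk : pi j = pi k.
  by apply: code_inj; rewrite -!act_labi -!l_ps ax z3 ai.
have nN u : pi u = pi j -> pi u != None.
  by move=> ->; move: ax; rewrite l_ps act_labi; case: (pi j) => // h; rewrite -h in b0.
(* Two tops with the same activity climb to each other, and climbing never decreases the index, so
   they coincide. *)
have h1 := climb_to_top (nN j erefl) tx (esym pjk).
have h2 := climb_to_top (nN k (esym pjk)) z2 pjk.
have le u v : croot par lact l u v = u -> v <= u.
  move=> h; rewrite leqNgt; apply/negP => uv.
  by move: h; rewrite croot_id ?(ltnW uv) // => h; rewrite h ltnn in uv.
by apply/eqP; rewrite eqn_leq (le _ _ h1) (le _ _ h2).
Qed.

Lemma stable_sol : exists B l, sol B fixed l.
Proof. by exists B, l; split; [exact: nodes|exact: edges|exact: tops_B]. Qed.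

End Completeness.

End Labels.

(** * Elimination orders *)

(* A longest path in a set where every vertex has two neighbours closes up. *)
Lemma acyclic_leaf n (L : {set {set 'I_n}}) (A : {set 'I_n}) : acyclic L ->
  A != set0 -> exists2 u, u \in A & #|[set w in A | adj L u w]| <= 1.
Proof.
move=> ac /set0Pn[u0 u0A]; apply/exists_inP; apply: contraT;
  rewrite negb_exists_in => /forall_inP H.
have next u v : u \in A -> exists w, [/\ w \in A, adj L u w & w != v].
  move=> uA; have := H u uA; rewrite -ltnNge (cardsD1 v) => h.
  have : 0 < #|[set w in A | adj L u w] :\ v| by case: (v \in _) h; lia.
  by rewrite card_gt0 => /set0Pn[w]; rewrite !inE => /and3P[h1 h2 h3]; exists w.
have adjC u v : adj L u v = adj L v u by rewrite /adj eq_sym setUC.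
have long m : exists (u v : 'I_n) (r : seq 'I_n), [/\ size r = m, uniq [:: u, v & r],
    path (adj L) u (v :: r) & u \in A].
  elim: m => [|m [u [v [r [sr ur pr uA]]]]].
    have [v [vA uv vu]] := next u0 u0 u0A; exists v, u0, [::].
    by rewrite /= inE vu adjC uv.
  have [w [wA uw wv]] := next u v uA.
  have wu : w != u by apply: contraL uw => /eqP ->; rewrite /adj eqxx.
  have [wr|nwr] := boolP (w \in r); last first.
    exists w, u, (v :: r); split=> //; first by rewrite /= sr.
      by rewrite cons_uniq ur andbT !inE !negb_or wu wv nwr.
    by rewrite /= adjC uw.
  (* The new neighbour [w] of [u] lies on the path beyond [v], so the path from [u] to [w] closes to
     a cycle of length at least 3. *)
  case: ac; case/splitPr: wr ur pr {sr} => r1 r2 ur pr.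
  exists [:: u, v & rcons r1 w]; split.
  - by rewrite /= size_rcons.
  - move: ur; rewrite -cat_rcons -[[:: u, v & _]]/([:: u; v] ++ _).
    by rewrite catA cat_uniq => /andP[].
  - rewrite /= rcons_path last_rcons; move: pr; rewrite /= -cat_rcons cat_path.
    by case/and3P=> -> -> _; rewrite adjC uw.
(* Otherwise paths grow without limit, up to [n + 2] distinct vertices. *)
have [u [v [r [sr ur _ _]]]] := long n.
have := max_card (mem [:: u, v & r]); rewrite (card_uniqP ur) card_ord /= sr.
by rewrite ltnNge leqnSn.
Qed.

Section Elimination.

Variables (n : nat) (L : {set {set 'I_n}}) (g : nat -> nat -> bool).
Hypothesis ac : acyclic L.
Hypothesis gE : forall i j : 'I_n, g i j = adj L i j.

Definition eliminable (ord : nat -> nat) k u :=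
  all (fun j => ord j != u) (iota 0 k) &&
  (count (fun w => all (fun j => ord j != w) (iota 0 k) && g u w) (iota 0 n) <= 1).

Lemma eliminable_exists ord k : k < n -> exists2 u, u < n & eliminable ord k u.
Proof.
move=> kn; pose A := [set i : 'I_n | all (fun j => ord j != i) (iota 0 k)].
have A0 : A != set0.
  apply/negP => /eqP A0.
  have sub : {subset iota 0 n <= [seq ord j | j <- iota 0 k]}.
    move=> x; rewrite mem_iota add0n => /andP[_ xn].
    have : Ordinal xn \notin A by rewrite A0 inE.
    rewrite inE -has_predC => /hasP[j jk /= /negPn/eqP <-]; exact: map_f.
  have := uniq_leq_size (iota_uniq 0 n) sub.
  by rewrite size_map !size_iota leqNgt kn.
have [u uA h] := acyclic_leaf ac A0; exists u => //.
move: uA; rewrite inE => uA; rewrite /eliminable uA /=.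
apply: leq_trans h; rewrite -[iota 0 n]val_enum_ord count_map -size_filter.
rewrite -(card_uniqP (filter_uniq _ (enum_uniq _))); apply: eq_leq; apply: eq_card => w.
by rewrite mem_filter mem_enum !inE /= gE andbT.
Qed.

(** In an elimination order at most one later neighbour exists, so the sum of all later neighbours
    is that neighbour; a sum is what the expression language can compute. *)
Definition par_of (ord : nat -> nat) k :=
  let later j := (k < j) && g (ord k) (ord j) in
  if has later (iota 0 n) then sumn [seq if later j then j else 0 | j <- iota 0 n]
  else n.

Variable ord : nat -> nat.
Hypothesis ord_lt : forall k, k < n -> ord k < n.
Hypothesis ord_elim : forall k, k < n -> eliminable ord k (ord k).

Lemma ord_inj j k : j < n -> k < n -> ord j = ord k -> j = k.
Proof.
have H a b : a < b -> b < n -> ord a != ord b.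
  move=> ab bn; have /andP[/allP h _] := ord_elim bn.
  by apply: h; rewrite mem_iota; lia.
move=> jn kn E; case: (ltngtP j k) => // h.
- by have := H _ _ h kn; rewrite E eqxx.
- by have := H _ _ h jn; rewrite E eqxx.
Qed.

Lemma later_uniq k j j' : k < j < n -> k < j' < n ->
  g (ord k) (ord j) -> g (ord k) (ord j') -> j = j'.
Proof.
move=> /andP[kj jn] /andP[kj' jn'] gj gj'.
have kn : k < n by lia.
have /andP[_ c] := ord_elim kn.
have P i : k < i -> i < n -> all (fun a => ord a != ord i) (iota 0 k).
  move=> ki iN; apply/allP => a; rewrite mem_iota add0n => /andP[_ ak].
  by apply/eqP => /ord_inj E; have := E _ _; lia.
apply: ord_inj => //; apply: count_le1_eq c _ _ _ _; rewrite ?mem_iota ?ord_lt //.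
- by rewrite P.
- by rewrite P.
Qed.

Lemma par_ofP k : k < n ->
  (exists j, [/\ k < j < n, g (ord k) (ord j) & par_of ord k = j]) \/
  (par_of ord k = n /\ forall j, k < j < n -> ~~ g (ord k) (ord j)).
Proof.
move=> kn; rewrite /par_of; case: hasP => [[j]|nh].
  rewrite mem_iota add0n => /andP[_ jn] /andP[kj gj]; left; exists j.
  rewrite kj jn; split=> //.
  have E i : i < n -> (k < i) && g (ord k) (ord i) = (i == j).
    move=> iN; apply/andP/eqP => [[ki gi]|->//].
    by apply: (@later_uniq k); rewrite ?ki ?kj.
  have : {in iota 0 n, forall i, (if (k < i) && g (ord k) (ord i) then i else 0) =
     if i == j then j else 0}.
    by move=> i; rewrite mem_iota => iN; rewrite E //; case: eqP.
  move=> /eq_in_map ->; rewrite -[n in iota 0 n](subnKC jn) -addn1 -addnA iotaD.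
  rewrite map_cat sumn_cat iotaD map_cat sumn_cat /= eqxx.
  have z a b : (j < a) || (a + b <= j) ->
      sumn [seq (if i == j then j else 0) | i <- iota a b] = 0.
    move=> h; apply/eqP/eqP; elim: b a h => //= b IH a h.
    by rewrite IH; [case: eqP|]; lia.
  by rewrite !z; lia.
right; split=> // j /andP[kj jn]; apply/negP => gj; apply: nh.
by exists j; rewrite ?mem_iota ?kj.
Qed.

Lemma par_of_gt k : k < n -> k < par_of ord k <= n.
Proof. by move=> kn; case: (par_ofP kn) => [[j [h _ ->]]|[-> _]]; lia. Qed.

Definition pos_of (i : 'I_n) := index (val i) [seq ord k | k <- iota 0 n].

Lemma ord_surj (i : 'I_n) : val i \in [seq ord k | k <- iota 0 n].
Proof.
have [|||_ ->] := @uniq_min_size _ [seq ord k | k <- iota 0 n] (iota 0 n).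
- rewrite map_inj_in_uniq ?iota_uniq // => j k.
  by rewrite !mem_iota !add0n => /andP[_ jn] /andP[_ kn]; apply: ord_inj.
- by move=> _ /mapP[k + ->]; rewrite !mem_iota !add0n => /= kn; apply: ord_lt.
- by rewrite size_map.
- by rewrite mem_iota ltn_ord.
Qed.

Lemma pos_of_lt i : pos_of i < n.
Proof. by rewrite -[n in _ < n](size_iota 0) -(size_map ord) index_mem ord_surj. Qed.

Lemma ord_pos_of i : ord (pos_of i) = i.
Proof.
have := nth_index 0 (ord_surj i); rewrite (nth_map 0) ?size_iota ?pos_of_lt //.
by rewrite nth_iota ?pos_of_lt.
Qed.

Lemma pos_of_inj : injective pos_of.
Proof. by move=> i j E; apply: val_inj; rewrite /= -!ord_pos_of E. Qed.

(** Each link runs from its earlier endpoint to the only later neighbour of that endpoint, which is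
    its parent. *)
Lemma adj_pos_of i j :
  adj L i j = (par_of ord (pos_of i) == pos_of j) || (par_of ord (pos_of j) == pos_of i).
Proof.
have H u v : par_of ord (pos_of u) = pos_of v -> adj L u v.
  move=> E; case: (par_ofP (pos_of_lt u)) => [[k [_ gk E2]]|[E2 _]].
    by move: gk; rewrite -E2 E !ord_pos_of gE.
  by have := pos_of_lt v; rewrite -E E2 ltnn.
have H2 u v : adj L u v -> pos_of u < pos_of v -> par_of ord (pos_of u) = pos_of v.
  move=> a uv; case: (par_ofP (pos_of_lt u)) => [[k [kn gk ->]]|[_ h]].
    apply: later_uniq gk _ => //; first by rewrite uv pos_of_lt.
    by rewrite !ord_pos_of gE.
  by have := h (pos_of v); rewrite uv pos_of_lt !ord_pos_of gE a => /(_ isT).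
apply/idP/orP => [a|[] /eqP /H //]; last by rewrite /adj eq_sym setUC.
case: (ltngtP (pos_of i) (pos_of j)) => h.
- by left; apply/eqP; apply: H2.
- by right; apply/eqP; apply: H2 => //; move: a; rewrite /adj eq_sym setUC.
- by move: a; rewrite (pos_of_inj h) /adj eqxx.
Qed.

End Elimination.

(** * Encoding of the states *)

Definition bit S b := (S %/ 2 ^ b.-1) %% 2.

Lemma bit_surj p (chi : nat -> nat) : (forall b, 0 < b <= p -> chi b <= 1) ->
  exists2 S, S < 2 ^ p & forall b, 0 < b <= p -> bit S b = chi b.
Proof.
elim: p chi => [|p IH] chi H; first by exists 0 => // b; lia.
have [|S SP E] := IH (fun b => chi b.+1); first by move=> b Hb; apply: H; lia.
have c1 : chi 1 < 2 by apply: H.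
exists (S * 2 + chi 1); first by rewrite expnS; lia.
case=> // -[|b] Hb; rewrite /bit /=.
  by rewrite divn1 modnMDl modn_small.
by rewrite expnS divnMA divnMDl // (divn_small c1) addn0 -E.
Qed.

Section Decode.

Variables (n p : nat).

(** A state is a number in mixed radix; read from the right, the factors are the radices of
    activity, size, acceptance bit, current count and objector bit, and the remaining quotient is
    the set of completed activities. The count has [n.+2] values since [cnt] ranges over [n.+1]
    vertices. *)
Definition num_states := 2 ^ p * 2 * n.+2 * 2 * n.+1 * p.+1.
Definition dec_act s := s %% p.+1.
Definition dec_q1 s := s %/ p.+1.
Definition dec_size s := dec_q1 s %% n.+1.
Definition dec_q2 s := dec_q1 s %/ n.+1.
Definition dec_acc s := dec_q2 s %% 2.
Definition dec_q3 s := dec_q2 s %/ 2.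
Definition dec_cnt s := dec_q3 s %% n.+2.
Definition dec_q4 s := dec_q3 s %/ n.+2.
Definition dec_wit s := dec_q4 s %% 2.
Definition dec_set s := dec_q4 s %/ 2.

Definition dec_lab s : lab := (dec_act s, dec_size s, dec_acc s != 0).

Lemma dec_surj_states (a k t : nat) (e w : bool) (chi : nat -> nat) :
  a <= p -> k <= n -> t <= n.+1 -> (forall b, 0 < b <= p -> chi b <= 1) ->
  exists s, [/\ s < num_states, dec_lab s = (a, k, e), dec_cnt s = t,
    (dec_wit s != 0) = w & forall b, 0 < b <= p -> bit (dec_set s) b = chi b].
Proof.
move=> ap kn tn /bit_surj[S SP Sb].
have D q d r : r < d -> ((q * d + r) %/ d = q) * ((q * d + r) %% d = r).
  move=> rd; split; last by rewrite modnMDl modn_small.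
  by rewrite divnMDl ?divn_small ?addn0 //; lia.
have lt q Q d r : q < Q -> r < d -> q * d + r < Q * d.
  move=> qQ rd; apply: leq_trans (_ : q.+1 * d <= _); first by rewrite mulSn; lia.
  by rewrite leq_mul2r qQ orbT.
pose s4 := S * 2 + w; pose s3 := s4 * n.+2 + t; pose s2 := s3 * 2 + e.
pose s1 := s2 * n.+1 + k; pose s0 := s1 * p.+1 + a.
have w2 : w < 2 by case: (w). have e2 : e < 2 by case: (e).
have E1 : dec_q1 s0 = s1 by rewrite /dec_q1 /s0 D.
have E2 : dec_q2 s0 = s2 by rewrite /dec_q2 E1 /s1 D.
have E3 : dec_q3 s0 = s3 by rewrite /dec_q3 E2 /s2 D.
have E4 : dec_q4 s0 = s4 by rewrite /dec_q4 E3 /s3 D.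
exists s0; split.
- have l4 : s4 < 2 ^ p * 2 by apply: lt.
  have l3 : s3 < 2 ^ p * 2 * n.+2 by apply: lt.
  have l2 : s2 < 2 ^ p * 2 * n.+2 * 2 by apply: lt.
  have l1 : s1 < 2 ^ p * 2 * n.+2 * 2 * n.+1 by apply: lt.
  exact: lt.
- rewrite /dec_lab /dec_act /s0 D // -/s0 /dec_size E1 /s1 D // /dec_acc E2 /s2 D //.
  by case: (e).
- by rewrite /dec_cnt E3 /s3 D.
- by rewrite /dec_wit E4 /s4 D //; case: (w).
- by move=> b Hb; rewrite /dec_set E4 /s4 D // Sb.
Qed.

Variables (pr : nat -> nat -> nat -> bool) (ord par fixed : nat -> nat).

Definition set_of S b := bit S b != 0.

Definition table B :=
  dp n par lact (lnode n p pr ord (set_of B) fixed) (lobj n pr ord)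
    (lcompat n pr ord) lsz lac p num_states dec_lab dec_cnt
    (fun s => dec_wit s != 0) (fun s => bit (dec_set s)).

Definition final B s :=
  table B n n s && all (fun b => bit (dec_set s) b == bit B b) (iota 1 p).

Definition decide :=
  has (fun B => has (final B) (iota 0 num_states)) (iota 0 (2 ^ p)).

Lemma bit_le1 S b : bit S b <= 1.
Proof. by rewrite -ltnS ltn_pmod. Qed.

Variables (L : {set {set 'I_n}}) (pref : 'I_n -> rel (alt p)) (ps : 'I_n -> nat).
Hypothesis par_gt : forall x, x < n -> x < par x <= n.
Hypothesis ps_lt : forall i, ps i < n.
Hypothesis ps_inj : injective ps.
Hypothesis ord_ps : forall i, ord (ps i) = i.
Hypothesis adj_ps : forall i j, adj L i j = (par (ps i) == ps j) || (par (ps j) == ps i).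
Hypothesis prE : forall (i : 'I_n) x y, x \in alts n p -> y \in alts n p ->
  pr i (altn n x) (altn n y) = pref i x y.

(** After [n] merges the virtual root carries the whole forest, so its table describes complete
    labellings. *)
Lemma decideP :
  decide <-> exists pi, indiv_stable L pref pi /\ consistent fixed pi.
Proof.
have surj B x (lam : lab) t (w : bool) (chi : nat -> nat) : x <= n ->
    lnode n p pr ord B fixed x lam -> t <= n.+1 ->
    (forall b, 0 < b <= p -> chi b <= 1) ->
    exists s, [/\ s < num_states, dec_lab s = lam, dec_cnt s = t,
      (dec_wit s != 0) = w & forall b, 0 < b <= p -> bit (dec_set s) b = chi b].
  case: lam => [[a k] e] xn h tn hc; apply: dec_surj_states => //.
  - by move: h; rewrite /lnode; case: eqP => _; [case/eqP=> -> _ _|case/and5P].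
  - by move: h; rewrite /lnode; case: eqP => _; [case/eqP=> _ -> _|case/and5P].
have nn : n <= n <= n by rewrite leqnn.
have TP B := dpP par_gt lact (lobj n pr ord) (lcompat n pr ord) lsz lac
  (fun s b => bit_le1 (dec_set s) b) (surj (set_of B)).
have bE S b : bit S b = set_of S b by rewrite /set_of; have := bit_le1 S b;
  case: (bit S b) => [|[]].
split.
  case/hasP=> B _ /hasP[s _ /andP[/(TP B n n s nn)[l [f1 f2 f3 _ f6]] /all_iota1 h]].
  apply: (sol_stable par_gt ps_lt ps_inj ord_ps adj_ps prE (B := set_of B) (l := l)).
  split.
  - by move=> x xn; apply: f2 => //; apply: root_last.
  - move=> x xn; apply: f3 => //; first by apply: root_last => //; apply: ltnW.
    by rewrite (ltn_eqF xn).
  - by move=> b Hb; rewrite -f6 // (eqP (h b Hb)) bE.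
case=> pi [st co].
have [B [l [h1 h2 h3]]] := stable_sol par_gt ps_lt ps_inj ord_ps adj_ps prE st co.
have [|S SP SE] := @bit_surj p B; first by move=> b _; case: (B b).
have BS b : 0 < b <= p -> set_of S b = B b.
  by move=> Hb; rewrite /set_of SE //; case: (B b).
(* The predicate [B] and its bit mask agree on 1 to [p] only, so the conditions that mention it are
   transferred on that range. *)
have h1' x : x <= n -> lnode n p pr ord (set_of S) fixed x (l x).
  move=> xn; have := h1 x xn; rewrite /lnode; case: eqP => // _.
  case/and5P=> ap -> -> hB /and4P[-> /allP al -> ->]; rewrite ap.
  have -> : (lact (l x) != 0) ==> (0 < lsz (l x)) && set_of S (lact (l x)).
    apply/implyP => a0; have /andP[-> Ba] := implyP hB a0.
    by rewrite BS // lt0n a0 ap.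
  rewrite !andbT /=; apply/allP => b bi; rewrite BS ?al //.
  by move: bi; rewrite mem_iota; lia.
have tS b : 0 < b <= p -> tops n par lact l n n b <= 1.
  by move=> Hb; rewrite h3 //; case: (B b).
have [s [sS d1 d2 d3 d4]] := surj (set_of S) n (l n) (cnt n par lact l n n)
  (wit n par lact (lobj n pr ord) l n n) (tops n par lact l n n) (leqnn n)
  (h1' n (leqnn n)) (cnt_le _ _ _ _ _ _) tS.
apply/hasP; exists S; first by rewrite mem_iota.
apply/hasP; exists s; first by rewrite mem_iota.
apply/andP; split; last by apply/all_iota1 => b Hb; rewrite d4 // h3 // SE.
apply/(TP S n n s nn); exists l; split=> //.
- by move=> x xn _; apply: h1'.
- by move=> x xn _ _; apply: h2.
Qed.

End Decode.

(** * Derived expressions *)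

(* Arguments are evaluated by [ELet] outside the scope of the reserved variables
   60-71, so none is captured. *)
Definition EMul y e := ELet 60 e 61 (EC 0) (ESum 62 y (EV 60)).
(** Nonzero means true. With truncated subtraction, subtracting from 1 turns zero into 1 and
    everything else into 0. *)
Definition ELe a b := ESub (EC 1) (ESub a b).
Definition EEq a b := ESub (EC 1) (EAdd (ESub a b) (ESub b a)).
Definition ENot a := ESub (EC 1) a.
Definition EAnd a b := EIf a b (EC 0).
Definition EOr a b := EAdd a b.
Definition EImp a b := EAdd (ENot a) b.
Definition EIff a b := EIf a b (ENot b).
Definition EAll x y e := ENot (ESum x y (ENot e)).

(* For [y] at least the quotient: the number of [q < y] with [(q + 1) * b <= a]. *)
Definition EDiv y a b := ELet 63 a 64 b (ESum 65 y
  (ELe (ESum 66 y (EIf (ELe (EV 66) (EV 65)) (EV 64) (EC 0))) (EV 63))).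
Definition EMod y a b := ELet 67 a 68 b (ELet 69 (EDiv y (EV 67) (EV 68)) 70 (EC 0)
  (ESub (EV 67) (ESum 71 y (EIf (ELe (EAdd (EV 71) (EC 1)) (EV 69)) (EV 68) (EC 0))))).

Definition tr ev A e := eval ev A e != 0.

Lemma sumn_neq0 (f : nat -> nat) s : (sumn [seq f i | i <- s] != 0) = has (fun i => f
  i != 0) s.
Proof. by elim: s => //= i s <-; rewrite addn_eq0 negb_and. Qed.

Lemma tr_sum ev A x y e : tr ev A (ESum x y e) =
  has (fun i => tr (upd ev x i) A e) (iota 0 (ev y)).
Proof. by rewrite /tr /= sumn_neq0. Qed.

Lemma tr_not ev A e : tr ev A (ENot e) = ~~ tr ev A e.
Proof. by rewrite /tr /=; lia. Qed.

Lemma tr_all ev A x y e : tr ev A (EAll x y e) =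
  all (fun i => tr (upd ev x i) A e) (iota 0 (ev y)).
Proof.
rewrite tr_not tr_sum -all_predC; apply: eq_all => i /=.
by rewrite tr_not negbK.
Qed.

Lemma tr_and ev A a b : tr ev A (EAnd a b) = tr ev A a && tr ev A b.
Proof. by rewrite /tr /=; case: (eval ev A a == 0). Qed.

Lemma tr_or ev A a b : tr ev A (EOr a b) = tr ev A a || tr ev A b.
Proof. by rewrite /tr /=; lia. Qed.

Lemma tr_imp ev A a b : tr ev A (EImp a b) = tr ev A a ==> tr ev A b.
Proof. by rewrite implybE -tr_not /tr /=; lia. Qed.

Lemma tr_iff ev A a b : tr ev A (EIff a b) = (tr ev A a == tr ev A b).
Proof. by rewrite /tr /=; case: (eval ev A a == 0); lia. Qed.

Lemma tr_le ev A a b : tr ev A (ELe a b) = (eval ev A a <= eval ev A b).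
Proof. by rewrite /tr /=; lia. Qed.

Lemma tr_eq ev A a b : tr ev A (EEq a b) = (eval ev A a == eval ev A b).
Proof. by rewrite /tr /=; lia. Qed.

Lemma tr_if ev A c a b : tr ev A (EIf c a b) = if tr ev A c then tr ev A a else tr ev A b.
Proof. by rewrite /tr /=; case: (eval ev A c == 0). Qed.

Lemma tr_let ev A x a y b e : tr ev A (ELet x a y b e) =
  tr (upd (upd ev x (eval ev A a)) y (eval ev A b)) A e.
Proof. by []. Qed.

Lemma sumn_const k c : sumn [seq c | _ <- iota 0 k] = c * k.
Proof. by elim: k 0 => [|k IH] j /=; [rewrite muln0|rewrite IH mulnS]. Qed.

Lemma eval_mul ev A y e : y < 16 -> eval ev A (EMul y e) = eval ev A e * ev y.
Proof.
move=> y16 /=.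
have -> : upd (upd ev 60 (eval ev A e)) 61 0 y = ev y by rewrite !upd_other //; lia.
by rewrite -sumn_const; congr sumn; apply: eq_map => i; rewrite /upd /=.
Qed.

(** Expressions can only sum over a full range; a guard cuts it to an initial segment, giving
    multiples of [c] and, for [c = 1], counts. *)
Lemma sumn_prefix k c d : d <= k ->
  sumn [seq if i < d then c else 0 | i <- iota 0 k] = c * d.
Proof.
elim: k d => [|k IH] d dk; first by have -> : d = 0 by [lia]; rewrite muln0.
rewrite -addn1 iotaD map_cat sumn_cat /= addn0; move: dk;
  rewrite leq_eqVlt => /orP[/eqP ->|dk].
  have /eq_in_map -> : {in iota 0 k, (fun i => if i < k.+1 then c else 0) =1 (fun=> c)}.
    by move=> i; rewrite mem_iota add0n => /andP[_ /ltnW]; rewrite ltnS => ->.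
  by rewrite ltnSn sumn_const mulnS addnC.
by rewrite IH // ltnNge -ltnS dk addn0.
Qed.

Lemma eval_div ev A y a b : y < 16 -> 0 < eval ev A b -> eval ev A a <= ev y ->
  eval ev A (EDiv y a b) = eval ev A a %/ eval ev A b.
Proof.
move=> y16 b0 ay; rewrite /EDiv /=.
set u := eval ev A a; set w := eval ev A b.
have -> : upd (upd ev 63 u) 64 w y = ev y by rewrite !upd_other //; lia.
rewrite -[RHS]mul1n -(@sumn_prefix (ev y)); last first.
  by apply: leq_trans ay; apply: leq_div.
congr sumn; apply/eq_in_map => q; rewrite mem_iota add0n => /andP[_ qy].
have -> : upd (upd (upd ev 63 u) 64 w) 65 q y = ev y by rewrite !upd_other //; lia.
rewrite (eq_map (_ : _ =1 (fun i => if i < q.+1 then w else 0))); last first.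
  by move=> i; rewrite /upd /=; case: (ltnP i q.+1) => h; case: eqP => //; lia.
rewrite sumn_prefix // /upd /= leq_divRL // mulnC; case: leqP => h; lia.
Qed.

Lemma eval_mod ev A y a b : y < 16 -> 0 < eval ev A b -> eval ev A a <= ev y ->
  eval ev A (EMod y a b) = eval ev A a %% eval ev A b.
Proof.
move=> y16 b0 ay; rewrite /EMod.
set u := eval ev A a; set w := eval ev A b; set ev1 := upd (upd ev 67 u) 68 w.
have e1 : ev1 y = ev y by rewrite /ev1 !upd_other //; lia.
have dE : eval ev1 A (EDiv y (EV 67) (EV 68)) = u %/ w by rewrite eval_div //= e1.
rewrite -[LHS]/(eval (upd (upd ev1 69 (eval ev1 A (EDiv y (EV 67) (EV 68)))) 70 0) A
  (ESub (EV 67) (ESum 71 y (EIf (ELe (EAdd (EV 71) (EC 1)) (EV 69)) (EV 68) (EC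
    0))))) dE /=.
have -> : upd (upd ev1 69 (u %/ w)) 70 0 y = ev y by rewrite /ev1 !upd_other //; lia.
rewrite (eq_map (_ : _ =1 (fun i => if i < u %/ w then w else 0))); last first.
  by move=> i; rewrite /upd /=; case: (ltnP i (u %/ w)) => h; case: eqP => //; lia.
rewrite sumn_prefix; last by apply: leq_trans ay; apply: leq_div.
by rewrite /ev1 /upd /= mulnC {1}(divn_eq u w) addKn.
Qed.

(** * The local conditions as expressions *)

(* Loop bounds: 0 n, 1 p, 2 n+1, 3 p+1, 4 the number of alternatives, 5 2^p,
   6 the constant 2, 7 n+2, 8 the number of states, 9 the size of a table layer.
   Arrays: 0 input and output, 1 elimination order, 2 parents, 3 fixed
   activities, 4 dynamic-programming table, 5 powers of two, 6-11 decoded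
   states, 12-15 intermediate quotients. *)
Definition lims n p (ev : nat -> nat) :=
  [/\ ev 0 = n, ev 1 = p, ev 2 = n.+1, ev 3 = p.+1 &
  [/\ ev 4 = (p * n).+1, ev 5 = 2 ^ p, ev 6 = 2, ev 7 = n.+2 &
      ev 8 = num_states n p /\ ev 9 = num_states n p * n.+1]].

Lemma lims_upd n p ev x v : 16 <= x -> lims n p ev -> lims n p (upd ev x v).
Proof.
move=> x16 H; rewrite /lims !upd_other //; lia.
Qed.

Definition tables n p (A : nat -> nat -> nat) :=
  (forall b, b < p -> A 5 b = 2 ^ b) /\
  forall s, s < num_states n p ->
    [/\ A 6 s = dec_act p s, A 7 s = dec_size n p s, A 8 s = dec_acc n p s,
        A 9 s = dec_cnt n p s & A 10 s = dec_wit n p s /\ A 11 s = dec_set n p s].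

(** In array 0 the cells 0, 1, 2 hold the input length, [n] and [p]. The adjacency matrix starts at
    3, and after its [n * n] entries comes one square matrix of side [(p * n).+1] per player. *)
Definition pref_of n p (In : nat -> nat) i x y :=
  In (3 + n * n + ((i * (p * n).+1 + x) * (p * n).+1 + y)) != 0.
Definition adj_of n (In : nat -> nat) i j := In (3 + (i * n + j)) != 0.

Definition Epr i x y := ERd 0 (EAdd (EAdd (EC 3) (EMul 0 (EV 0)))
  (EAdd (EMul 4 (EAdd (EMul 4 i) x)) y)).
Definition Eadj i j := ERd 0 (EAdd (EC 3) (EAdd (EMul 0 i) j)).
Definition Ealt a k := EAdd (EMul 0 (ESub a (EC 1))) k.
Definition Estrict i x y := EAnd (Epr i x y) (ENot (Epr i y x)).
Definition Eacc x a k := EOr (EEq k (EV 0))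
  (Epr (ERd 1 x) (Ealt a (EAdd k (EC 1))) (Ealt a k)).
Definition Edev x a k a' k' e' := EAnd a' (EAnd e'
  (Estrict (ERd 1 x) (Ealt a' (EAdd k' (EC 1))) (Ealt a k))).
Definition Ebit S b := EMod 5 (EDiv 5 S (ERd 5 (ESub b (EC 1)))) (EC 2).
Definition Esucc x := EAdd (EV x) (EC 1).

(** Variable 20 is the vertex, 21 the state and 22 the guessed set. In a merge, 31 is the child, 24
    and 25 are the states of parent and child; 40 is an activity counted from 0. *)
Definition Enode :=
  let x := EV 20 in let i := ERd 1 x in let B := EV 22 in
  let a := ERd 6 (EV 21) in let k := ERd 7 (EV 21) in let e := ERd 8 (EV 21) in
  EIf (EEq x (EV 0)) (EAnd (EEq a (EC 0)) (EAnd (EEq k (EC 0)) (ENot e)))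
  (EAnd (ELe a (EV 1)) (EAnd (ELe k (EV 0))
  (EAnd (EImp (EEq a (EC 0)) (EAnd (EEq k (EC 0)) (ENot e)))
  (EAnd (EImp a (EAnd k (Ebit B a)))
  (EAnd (Epr i (Ealt a k) (EC 0))
  (EAnd (EAll 40 1 (EOr (Ebit B (Esucc 40))
           (ENot (Estrict i (Ealt (Esucc 40) (EC 1)) (Ealt a k)))))
  (EAnd (EImp e (Eacc x a k))
        (EOr (EEq (ERd 3 i) (EC 0)) (EEq (ERd 3 i) (EAdd a (EC 1))))))))))).

Definition Ebase :=
  EAnd Enode (EAnd (EEq (ERd 9 (EV 21)) (EC 1))
  (EAnd (EIff (ERd 10 (EV 21))
           (ENot (Eacc (EV 20) (ERd 6 (EV 21)) (ERd 7 (EV 21)))))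
        (EAll 40 1 (EEq (Ebit (ERd 11 (EV 21)) (Esucc 40)) (EC 0))))).

Definition Emerge :=
  let v := EV 20 in let u := EV 31 in
  let s := EV 21 in let s1 := EV 24 in let s2 := EV 25 in
  let a1 := ERd 6 s1 in let k1 := ERd 7 s1 in let e1 := ERd 8 s1 in
  let a2 := ERd 6 s2 in let k2 := ERd 7 s2 in let e2 := ERd 8 s2 in
  let bits s := Ebit (ERd 11 s) (Esucc 40) in
  EAnd (EAnd (EEq (ERd 6 s) a1) (EAnd (EEq (ERd 7 s) k1) (EIff (ERd 8 s) e1)))
  (EIf (EEq a2 a1)
    (EAnd (EAnd (EEq a2 a1) (EAnd (EEq k2 k1) (EIff e2 e1)))
    (EAnd (EEq (ERd 9 s) (EAdd (ERd 9 s1) (ERd 9 s2)))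
    (EAnd (EIff (ERd 10 s) (EOr (ERd 10 s1) (ERd 10 s2)))
          (EAll 40 1 (EEq (bits s) (EAdd (bits s1) (bits s2)))))))
    (EAnd (EImp (ELe (EAdd v (EC 1)) (EV 0))
             (EAnd (ENot (Edev v a1 k1 a2 k2 e2)) (ENot (Edev u a2 k2 a1 k1 e1))))
    (EAnd (EImp a2 (EAnd (EEq (ERd 9 s2) k2) (EOr e2 (ERd 10 s2))))
    (EAnd (EEq (ERd 9 s) (ERd 9 s1)) (EAnd (EIff (ERd 10 s) (ERd 10 s1))
          (EAll 40 1 (EEq (bits s) (EAdd (EAdd (bits s1) (bits s2))
                                         (EEq a2 (Esucc 40)))))))))).

Definition Ecell k v s := ERd 4 (EAdd (EMul 9 k) (EAdd (EMul 8 v) s)).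

Definition Estep :=
  EIf (EEq (EV 20) (ERd 2 (EV 31)))
    (ESum 24 8 (ESum 25 8 (EAnd (Ecell (EV 31) (EV 20) (EV 24))
       (EAnd (Ecell (EV 31) (EV 31) (EV 25)) Emerge))))
    (Ecell (EV 31) (EV 20) (EV 21)).

Definition Efinal :=
  ESum 24 8 (EAnd (Ecell (EV 0) (EV 0) (EV 24))
    (EAll 40 1 (EEq (Ebit (ERd 11 (EV 24)) (Esucc 40)) (Ebit (EV 22) (Esucc 40))))).

Lemma dec_set_lt n p s : s < num_states n p -> dec_set n p s < 2 ^ p.
Proof.
rewrite /num_states => H.
by rewrite /dec_set /dec_q4 /dec_q3 /dec_q2 /dec_q1 !ltn_divLR // -!mulnA !mulnA.
Qed.

Lemma all_succ (P : pred nat) p : all (fun b => P b.+1) (iota 0 p) = all P (iota 1 p).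
Proof. by rewrite -[1]addn0 iotaDl all_map; apply: eq_all. Qed.

Lemma eval_var ev A x : eval ev A (EV x) = ev x. Proof. by []. Qed.
Lemma eval_const ev A k : eval ev A (EC k) = k. Proof. by []. Qed.
Lemma eval_add ev A a b : eval ev A (EAdd a b) = eval ev A a + eval ev A b.
Proof. by []. Qed.
Lemma eval_sub ev A a b : eval ev A (ESub a b) = eval ev A a - eval ev A b.
Proof. by []. Qed.
Lemma eval_read ev A a e : eval ev A (ERd a e) = A a (eval ev A e).
Proof. by []. Qed.

Definition evalE := (eval_var, eval_const, eval_add, eval_sub, eval_read).

Section Eval.

Variables (n p : nat) (A : nat -> nat -> nat).
Hypothesis tabA : tables n p A.
Let pr := pref_of n p (A 0).
Let ST := num_states n p.

Lemma tr_pr ev i x y : lims n p ev ->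
  tr ev A (Epr i x y) = pr (eval ev A i) (eval ev A x) (eval ev A y).
Proof.
move=> H; have [e0 _ _ _ [e4 _ _ _ _]] := H.
by rewrite /tr /Epr !evalE !eval_mul // !evalE !eval_mul // e0 e4.
Qed.

Lemma eval_alt ev a k : lims n p ev ->
  eval ev A (Ealt a k) = alt_index n (eval ev A a) (eval ev A k).
Proof.
move=> H; have [e0 _ _ _ _] := H.
by rewrite /Ealt !evalE eval_mul // !evalE e0 subn1.
Qed.

Lemma tr_strict ev i x y : lims n p ev -> tr ev A (Estrict i x y) =
  strictn pr (eval ev A i) (eval ev A x) (eval ev A y).
Proof. by move=> H; rewrite /Estrict tr_and tr_not !tr_pr. Qed.

Lemma tr_acc ev x a k e : lims n p ev -> tr ev A (Eacc x a k) =
  accepts n pr (A 1) (eval ev A x) (eval ev A a, eval ev A k, e).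
Proof.
move=> H; have [e0 _ _ _ _] := H.
by rewrite /Eacc tr_or tr_eq tr_pr // !eval_alt // !evalE e0 addn1.
Qed.

Lemma tr_dev ev x a k e a' k' e' : lims n p ev -> tr ev A (Edev x a k a' k' e') =
  deviates n pr (A 1) (eval ev A x) (eval ev A a, eval ev A k, e)
    (eval ev A a', eval ev A k', eval ev A e' != 0).
Proof.
move=> H; by rewrite /Edev 2!tr_and tr_strict // !eval_alt // !evalE addn1.
Qed.

Lemma eval_bit ev S b : lims n p ev -> 0 < eval ev A b <= p ->
  eval ev A S < 2 ^ p -> eval ev A (Ebit S b) = bit (eval ev A S) (eval ev A b).
Proof.
move=> H Hb HS; have [_ _ _ _ [_ e5 _ _ _]] := H; have [pw _] := tabA.
have pE : eval ev A (ERd 5 (ESub b (EC 1))) = 2 ^ (eval ev A b).-1.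
  by rewrite !evalE pw ?subn1 //; lia.
rewrite /Ebit; have dE := @eval_div ev A 5 S (ERd 5 (ESub b (EC 1))) isT.
rewrite pE expn_gt0 e5 in dE; have {}dE := dE isT (ltnW HS).
rewrite eval_mod // dE // e5.
by apply: leq_trans (leq_div _ _) (ltnW HS).
Qed.

Lemma tr_bit ev S b : lims n p ev -> 0 < eval ev A b <= p ->
  eval ev A S < 2 ^ p -> tr ev A (Ebit S b) = set_of (eval ev A S) (eval ev A b).
Proof. by move=> H Hb HS; rewrite /tr eval_bit. Qed.

Lemma tr_allb ev e : lims n p ev -> tr ev A (EAll 40 1 e) =
  all (fun b => tr (upd ev 40 b.-1) A e) (iota 1 p).
Proof.
move=> H; have [_ e1 _ _ _] := H; rewrite tr_all e1 -all_succ.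
exact: eq_all.
Qed.

Ltac tr_simpl := repeat match goal with
  | |- context [tr ?ev ?A (EAnd ?a ?b)] => rewrite (tr_and ev A a b)
  | |- context [tr ?ev ?A (EOr ?a ?b)] => rewrite (tr_or ev A a b)
  | |- context [tr ?ev ?A (EImp ?a ?b)] => rewrite (tr_imp ev A a b)
  | |- context [tr ?ev ?A (EIff ?a ?b)] => rewrite (tr_iff ev A a b)
  | |- context [tr ?ev ?A (ENot ?a)] => rewrite (tr_not ev A a)
  | |- context [tr ?ev ?A (ELe ?a ?b)] => rewrite (tr_le ev A a b)
  | |- context [tr ?ev ?A (EEq ?a ?b)] => rewrite (tr_eq ev A a b)
  | |- context [tr ?ev ?A (EIf ?c ?a ?b)] => rewrite (tr_if ev A c a b)
  | |- context [tr ?ev ?A (Epr ?i ?x ?y)] => rewrite (@tr_pr ev i x y); [|by []]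
  | |- context [tr ?ev ?A (Estrict ?i ?x ?y)] => rewrite (@tr_strict ev i x y); [|by []]
  | |- context [tr ?ev ?A (EAll 40 1 ?e)] => rewrite (@tr_allb ev e); [|by []]
  | |- context [tr ?ev ?A (ERd ?a ?e)] =>
      rewrite -[tr ev A (ERd a e)]/(A a (eval ev A e) != 0)
  | |- context [eval ?ev ?A (Ealt ?a ?b)] => rewrite (@eval_alt ev a b); [|by []]
  | |- context [eval ?ev ?A (EV ?x)] => rewrite (eval_var ev A x)
  | |- context [eval ?ev ?A (EC ?x)] => rewrite (eval_const ev A x)
  | |- context [eval ?ev ?A (EAdd ?x ?y)] => rewrite (eval_add ev A x y)
  | |- context [eval ?ev ?A (ERd ?x ?y)] => rewrite (eval_read ev A x y)
  end.

Lemma dec_act_le s : dec_act p s <= p.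
Proof. by rewrite -ltnS ltn_pmod. Qed.

Lemma eq_lab (a k e a' k' e' : nat) :
  ((a, k, e != 0) == (a', k', e' != 0) :> lab) =
  [&& a == a', k == k' & (e != 0) == (e' != 0)].
Proof. by rewrite !xpair_eqE andbA. Qed.

Lemma tr_node ev : lims n p ev -> ev 21 < ST -> ev 22 < 2 ^ p ->
  tr ev A Enode =
  lnode n p pr (A 1) (set_of (ev 22)) (A 3) (ev 20) (dec_lab n p (ev 21)).
Proof.
move=> H sS BT; have [e0 e1 _ _ _] := H; have [_ /(_ _ sS)] := tabA.
case=> ta tk te _ _.
have accE := tr_acc (EV 20) (ERd 6 (EV 21)) (ERd 7 (EV 21)) (ev 21 != 0) H.
rewrite !evalE ta tk in accE.
rewrite /Enode /lnode; tr_simpl; rewrite accE e0; case: eqP => _.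
  by rewrite ta tk te -[void]/((0, 0, 0 != 0) : lab) eq_lab eqbF_neg negbK.
rewrite ta tk te e1 addn1.
(* [Ebit] is specified for positive activities only, so the premise of the implication has to be
   used. *)
have -> : (dec_act p (ev 21) != 0) ==>
      (dec_size n p (ev 21) != 0) && tr ev A (Ebit (EV 22) (ERd 6 (EV 21))) =
    (dec_act p (ev 21) != 0) ==>
      (0 < dec_size n p (ev 21)) && set_of (ev 22) (dec_act p (ev 21)).
  case: eqVneq => //= a0; rewrite lt0n tr_bit // !evalE ta //.
  by rewrite lt0n a0 dec_act_le.
congr [&& _, _, _, _, _ , _ & _]; apply: eq_in_all => b; rewrite mem_iota => Hb.
have H' := lims_upd b.-1 (isT : 16 <= 40) H.
rewrite /Esucc; tr_simpl; rewrite tr_bit // !evalE /upd /=; last by lia.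
by rewrite ta tk addn1 prednK //; lia.
Qed.

Lemma tr_base ev : lims n p ev -> ev 21 < ST -> ev 22 < 2 ^ p ->
  tr ev A Ebase =
  base (lnode n p pr (A 1) (set_of (ev 22)) (A 3)) (lobj n pr (A 1)) p
    (dec_lab n p) (dec_cnt n p) (fun s => dec_wit n p s != 0)
    (fun s => bit (dec_set n p s)) (ev 20) (ev 21).
Proof.
move=> H sS BT; have [e0 e1 _ _ _] := H; have [_ /(_ _ sS)] := tabA.
case=> ta tk te tt [tw ts].
have accE := tr_acc (EV 20) (ERd 6 (EV 21)) (ERd 7 (EV 21)) (ev 21 != 0) H.
rewrite !evalE ta tk in accE.
rewrite /Ebase /base; tr_simpl; rewrite accE tr_node // tt tw.
congr [&& _, _, _ & _]; apply: eq_in_all => b; rewrite mem_iota => Hb.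
have H' := lims_upd b.-1 (isT : 16 <= 40) H.
have bE : upd ev 40 b.-1 40 + 1 = b by rewrite upd_same addn1 prednK //; lia.
by rewrite /Esucc; tr_simpl; rewrite eval_bit // !evalE ?bE /upd /= ?ts ?dec_set_lt.
Qed.

Lemma tr_merge ev : lims n p ev -> ev 21 < ST -> ev 24 < ST -> ev 25 < ST ->
  tr ev A Emerge =
  merge n lact (lcompat n pr (A 1)) lsz lac p
    (dec_lab n p) (dec_cnt n p) (fun s => dec_wit n p s != 0)
    (fun s => bit (dec_set n p s)) (ev 20) (ev 31) (ev 24) (ev 25) (ev 21).
Proof.
move=> H sS s1S s2S; have [e0 e1 _ _ _] := H; have [_ tb] := tabA.
have [ta tk te tt [tw ts]] := tb _ sS.
have [ta1 tk1 te1 tt1 [tw1 ts1]] := tb _ s1S.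
have [ta2 tk2 te2 tt2 [tw2 ts2]] := tb _ s2S.
have d1 := tr_dev (EV 20) (ERd 6 (EV 24)) (ERd 7 (EV 24)) (dec_acc n p (ev 24) != 0)
   (ERd 6 (EV 25)) (ERd 7 (EV 25)) (ERd 8 (EV 25)) H.
have d2 := tr_dev (EV 31) (ERd 6 (EV 25)) (ERd 7 (EV 25)) (dec_acc n p (ev 25) != 0)
   (ERd 6 (EV 24)) (ERd 7 (EV 24)) (ERd 8 (EV 24)) H.
rewrite !evalE ta1 tk1 te1 ta2 tk2 te2 in d1 d2.
rewrite /Emerge /merge; tr_simpl.
rewrite d1 d2 ta ta1 ta2 tk tk1 tk2 te te1 te2 tt tt1 tt2 tw tw1 tw2 e0 addn1.
have lE s s' : (dec_lab n p s == dec_lab n p s') = [&& dec_act p s == dec_act p s',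
    dec_size n p s == dec_size n p s' & (dec_acc n p s != 0) == (dec_acc n p s' != 0)].
  exact: eq_lab.
rewrite !lE.
have bits b : 0 < b <= p -> let ev' := upd ev 40 b.-1 in
   [/\ eval ev' A (Ebit (ERd 11 (EV 21)) (Esucc 40)) = bit (dec_set n p (ev 21)) b,
       eval ev' A (Ebit (ERd 11 (EV 24)) (Esucc 40)) = bit (dec_set n p (ev 24)) b,
       eval ev' A (Ebit (ERd 11 (EV 25)) (Esucc 40)) = bit (dec_set n p (ev 25)) b
     & eval ev' A (EEq (ERd 6 (EV 25)) (Esucc 40)) = (dec_act p (ev 25) == b)].
  move=> Hb ev'; have H' := lims_upd b.-1 (isT : 16 <= 40) H.
  have bE : eval ev' A (Esucc 40) = b by rewrite !evalE /ev' upd_same addn1 prednK //;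
    lia.
  rewrite !eval_bit // ?bE // !evalE /ev' /upd /= ?ts ?ts1 ?ts2 ?dec_set_lt //.
  by split=> //; rewrite ta2; move: bE; rewrite /= /ev' /upd /= => ->; lia.
congr (_ && _); case: ifP => aE.
  congr [&& _, _, _ & _]; first by move: aE => /= ->.
  apply: eq_in_all => b; rewrite mem_iota => Hb.
  have [|h1 h2 h3 _] := bits b; first by lia.
  by rewrite tr_eq eval_add h1 h2 h3.
congr [&& _, _, _, _ & _]; apply: eq_in_all => b; rewrite mem_iota => Hb.
have [|h1 h2 h3 h4] := bits b; first by lia.
by rewrite tr_eq !eval_add h1 h2 h3 h4.
Qed.

End Eval.

(** * The decision procedure *)

(** While the block at [off] is being filled, the body may rely on the original contents of [a]
    outside the part already written; a layer of the table can thus be computed from the previous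
    one in the same array. *)
Lemma exec_fill (Q : nat -> nat -> Prop) x y a e0 e off s :
  (forall i s', i < va s y -> (forall z, z != x -> va s' z = va s z) ->
     (forall b, b != a -> ar s' b = ar s b) ->
     (forall j, (j < off) || (off + i <= j) -> ar s' a j = ar s a j) ->
     eval (upd (va s') x i) (ar s') e0 = off + i /\
     Q i (eval (upd (va s') x i) (ar s') e)) ->
  let s' := exec (CFor x y (CStore a e0 e)) s in
  (forall j, (j < off) || (off + va s y <= j) -> ar s' a j = ar s a j) /\
  (forall j, j < va s y -> Q j (ar s' a (off + j))).
Proof.
move=> H.
pose I i s' := [/\ forall z, z != x -> va s' z = va s z,
   forall b, b != a -> ar s' b = ar s b,
   forall j, (j < off) || (off + i <= j) -> ar s' a j = ar s a j
  & forall j, j < i -> Q j (ar s' a (off + j))].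
suff [] : I (va s y) (exec (CFor x y (CStore a e0 e)) s) by [].
apply: exec_for => [|i s' iy [h1 h2 h3 h4]]; first by split.
have [E0 Qi] := H i s' iy h1 h2 h3; split=> /=.
- by move=> z zx; rewrite upd_other // h1.
- by move=> b ba; rewrite (negbTE ba) h2.
- by move=> j Hj; rewrite eqxx E0 upd_other ?h3 //; lia.
- move=> j Hj; rewrite eqxx E0; case: (ltngtP j i) => [ji|ij|->];
  last by rewrite upd_same.
    by rewrite upd_other; [apply: h4|lia].
  by lia.
Qed.

(** Splits the index within a layer, variable 30, into the vertex and the state. *)
Definition Estate e := ELet 20 (EDiv 9 (EV 30) (EV 8)) 21 (EMod 9 (EV 30) (EV 8)) e.

Definition Cbase := CFor 30 9 (CStore 4 (EV 30) (Estate Ebase)).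
Definition Cstep := CFor 30 9
  (CStore 4 (EAdd (EMul 9 (Esucc 31)) (EV 30)) (Estate Estep)).
(** Variable 16 receives the verdict. The language has no empty command; [CSet 16 (EV 16)] takes its
    place. *)
Definition Cdecide :=
  CSeq (CSet 16 (EC 0))
  (CFor 22 5 (CSeq Cbase (CSeq (CFor 31 0 Cstep)
    (CIf Efinal (CSet 16 (EC 1)) (CSet 16 (EV 16)))))).

Lemma num_states_gt0 n p : 0 < num_states n p.
Proof. by rewrite /num_states !muln_gt0 expn_gt0. Qed.

Lemma lims_eq n p ev ev' : (forall y, y < 16 -> ev' y = ev y) ->
  lims n p ev -> lims n p ev'.
Proof. by move=> E; rewrite /lims !E. Qed.

Lemma tables_eq n p A A' : (forall a, 3 < a -> a != 4 -> A' a = A a) ->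
  tables n p A -> tables n p A'.
Proof. by move=> E; rewrite /tables !E. Qed.

Lemma exec_seq c1 c2 s : exec (CSeq c1 c2) s = exec c2 (exec c1 s).
Proof. by []. Qed.

Lemma exec_set x e s : exec (CSet x e) s = set_var s x (eval (va s) (ar s) e).
Proof. by []. Qed.

Lemma exec_if e c1 c2 s : exec (CIf e c1 c2) s =
  if tr (va s) (ar s) e then exec c1 s else exec c2 s.
Proof. by rewrite /tr /=; case: (_ == 0). Qed.

Section Decide.

Variables (n p : nat).
Let ST := num_states n p.
Let NS := ST * n.+1.

Definition table_in (s : store) B k v s0 :=
  table n p (pref_of n p (ar s 0)) (ar s 1) (ar s 2) (ar s 3) B k v s0.

Definition layer (s : store) B k := forall v s0, v <= n -> s0 < ST ->
  (ar s 4 (k * NS + (v * ST + s0)) != 0) = table_in s B k v s0.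

Lemma cell_lt v s0 : v <= n -> s0 < ST -> v * ST + s0 < NS.
Proof.
move=> vn sS; rewrite /NS [ST * n.+1]mulnC; apply: leq_trans (_ : v.+1 * ST <= _).
  by rewrite mulSn [ST + _]addnC -addnS leq_add2l.
by rewrite leq_mul2r ltnS vn orbT.
Qed.

Lemma cell_div v s0 : s0 < ST ->
  ((v * ST + s0) %/ ST = v) * ((v * ST + s0) %% ST = s0).
Proof.
move=> sS; have S0 := num_states_gt0 n p.
by rewrite divnMDl // divn_small // addn0 modnMDl modn_small.
Qed.

Lemma tr_state ev A e i : lims n p ev -> i < NS -> ev 30 = i ->
  tr ev A (Estate e) = tr (upd (upd ev 20 (i %/ ST)) 21 (i %% ST)) A e.
Proof.
move=> H iN e30; have [_ _ _ _ [_ _ _ _ [e8 e9]]] := H.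
rewrite /Estate tr_let eval_div ?eval_mod /= ?e8 ?e9 ?e30 ?num_states_gt0 //; lia.
Qed.

Lemma tr_cell ev A k v s0 : lims n p ev -> tr ev A (Ecell k v s0) =
  (A 4 (eval ev A k * NS + (eval ev A v * ST + eval ev A s0)) != 0).
Proof.
move=> H; have [_ _ _ _ [_ _ _ _ [e8 e9]]] := H.
by rewrite /Ecell /tr !evalE !eval_mul // e8 e9.
Qed.

Lemma state_bounds i : i < NS -> i %/ ST <= n /\ i %% ST < ST.
Proof.
have S0 := num_states_gt0 n p.
by move=> iN; rewrite ltn_pmod // -ltnS ltn_divLR // mulnC.
Qed.

Lemma Cbase_layer s B : lims n p (va s) -> tables n p (ar s) -> va s 22 = B ->
  B < 2 ^ p -> layer (exec Cbase s) B 0.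
Proof.
move=> H T E22 BT; have [_ _ _ _ [_ _ _ _ [e8 e9]]] := H.
have F a : a != 4 -> ar (exec Cbase s) a = ar s a by move=> a4; apply: exec_ar;
  rewrite inE.
have [] := @exec_fill (fun i v => (v != 0) = table_in s B 0 (i %/ ST) (i %% ST))
  30 9 4 (EV 30) (Estate Ebase) 0 s.
  move=> i s' iy h1 h2 _; split; first by rewrite /= upd_same.
  rewrite e9 in iy; have [b1 b2] := state_bounds iy.
  set ev := upd (va s') 30 i.
  have H' : lims n p ev.
    apply: lims_upd => //; apply: lims_eq H => y y16; apply: h1; lia.
  have T' : tables n p (ar s') by apply: tables_eq T => a _ a4; apply: h2.
  rewrite -[LHS]/(tr ev (ar s') (Estate Ebase)) (tr_state _ _ H' iy); last first.
    by rewrite /ev upd_same.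
  set ev2 := upd (upd _ _ _) _ _.
  have H2 : lims n p ev2 by do 2!apply: lims_upd => //.
  have e22 : ev2 22 = B by rewrite -E22 -h1.
  have e21 : ev2 21 = i %% ST by [].
  rewrite (tr_base T' H2) ?e21 ?e22 // !h2 //.
rewrite -/Cbase e9 => _ Q v s0 vn sS.
have := Q (v * ST + s0) (cell_lt vn sS); rewrite !(cell_div v sS) mul0n => ->.
by rewrite /table_in !F.
Qed.

Lemma Cstep_layer s B k : lims n p (va s) -> tables n p (ar s) -> va s 31 = k ->
  k < n -> layer s B k -> layer (exec Cstep s) B k.+1.
Proof.
move=> H T E31 kn lay; have [_ _ _ _ [_ _ _ _ [e8 e9]]] := H.
have F a : a != 4 -> ar (exec Cstep s) a = ar s a by move=> a4; apply: exec_ar;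
  rewrite inE.
have [] := @exec_fill (fun i v => (v != 0) = table_in s B k.+1 (i %/ ST) (i %% ST))
  30 9 4 (EAdd (EMul 9 (Esucc 31)) (EV 30)) (Estate Estep) (k.+1 * NS) s.
  move=> i s' iy h1 h2 h3.
  set ev := upd (va s') 30 i.
  have H' : lims n p ev.
    apply: lims_upd => //; apply: lims_eq H => y y16; apply: h1; lia.
  have [_ _ _ _ [_ _ _ _ [_ e9']]] := H'.
  have ev31 : ev 31 = k by rewrite -E31 -h1.
  split; first by rewrite !evalE eval_mul // !evalE ev31 e9' addn1 /ev upd_same.
  rewrite e9 in iy; have [b1 b2] := state_bounds iy.
  have T' : tables n p (ar s') by apply: tables_eq T => a _ a4; apply: h2.
  rewrite -[LHS]/(tr ev (ar s') (Estate Estep)) (tr_state _ _ H' iy); last first.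
    by rewrite /ev upd_same.
  set ev2 := upd (upd _ _ _) _ _.
  have H2 : lims n p ev2 by do 2!apply: lims_upd => //.
  have e21 : ev2 21 = i %% ST by [].
  have e20 : ev2 20 = i %/ ST by [].
  have e31 : ev2 31 = k by rewrite -ev31.
  (* Layer [k] ends where the block being written begins, so it is still intact. *)
  have cells v s0 : v <= n -> s0 < ST ->
      (ar s' 4 (k * NS + (v * ST + s0)) != 0) = table_in s B k v s0.
    move=> vn sS; rewrite h3 ?lay //; have := cell_lt vn sS.
    by rewrite mulSn; lia.
  rewrite /Estep tr_if tr_eq !evalE e20 e31 h2 // /table_in /table [dp _ _ _ _ _ _ _
    _ _ _ _ _ _ _ k.+1 _ _]/=.
  case: eqP => pk; last by rewrite tr_cell // !evalE e20 e21 e31 cells.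
  have [_ _ _ _ [_ _ _ _ [e8' _]]] := H2.
  rewrite tr_sum e8'; apply: eq_in_has => s1; rewrite mem_iota add0n => /andP[_ s1S].
  have H3 : lims n p (upd ev2 24 s1) by apply: lims_upd.
  rewrite tr_sum upd_other // e8'; apply: eq_in_has => s2.
  rewrite mem_iota add0n => /andP[_ s2S].
  have H4 : lims n p (upd (upd ev2 24 s1) 25 s2) by apply: lims_upd.
  rewrite 2!tr_and !tr_cell // !evalE (tr_merge T' H4) //.
  set ev4 := upd (upd ev2 24 s1) 25 s2.
  have [-> -> -> -> ->] : [/\ ev4 20 = i %/ ST, ev4 31 = k, ev4 24 = s1, ev4 25 = s2
    & ev4 21 = i %% ST] by [].
  by rewrite (h2 0 isT) (h2 1 isT) !cells //; lia.
rewrite -/Cstep e9 => _ Q v s0 vn sS.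
have := Q (v * ST + s0) (cell_lt vn sS); rewrite !(cell_div v sS) => ->.
by rewrite /table_in !F.
Qed.

Lemma CdecideP s : lims n p (va s) -> tables n p (ar s) ->
  (va (exec Cdecide s) 16 != 0) =
  decide n p (pref_of n p (ar s 0)) (ar s 1) (ar s 2) (ar s 3).
Proof.
move=> H T; have [_ _ _ _ [_ e5 _ _ _]] := H.
rewrite /Cdecide exec_seq exec_set; set s0 := set_var s 16 _.
have s05 : va s0 5 = 2 ^ p by rewrite /= upd_other.
pose I i s' := [/\ forall y, y < 16 -> va s' y = va s y,
   forall a, a != 4 -> ar s' a = ar s a &
   (va s' 16 != 0) = has (fun B => has (final n p (pref_of n p (ar s 0)) (ar s 1)
      (ar s 2) (ar s 3) B) (iota 0 ST)) (iota 0 i)].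
suff [_ _] : I (2 ^ p) (exec (CFor 22 5 (CSeq Cbase (CSeq (CFor 31 0 Cstep)
    (CIf Efinal (CSet 16 (EC 1)) (CSet 16 (EV 16)))))) s0) by [].
rewrite -s05; apply: exec_for => [|B s1 Bp [h1 h2 h3]].
  by split=> // y y16; rewrite /= upd_other //; lia.
rewrite s05 in Bp.
set s2 := set_var s1 22 B; rewrite 2!exec_seq exec_if !exec_set.
set s3 := exec Cbase s2.
have H2 : lims n p (va s2).
  by apply: lims_eq H => y y16; rewrite /= upd_other ?h1 //; lia.
have T2 : tables n p (ar s2) by apply: tables_eq T => a _ a4; apply: h2.
have L3 : layer s3 B 0 by apply: Cbase_layer.
have F3 a : a != 4 -> ar s3 a = ar s2 a by move=> a4; apply: exec_ar; rewrite inE.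
have V3 y : y != 30 -> va s3 y = va s2 y by move=> h; apply: exec_va; rewrite inE.
pose J k s' := [/\ forall y, y != 30 -> y != 31 -> va s' y = va s2 y,
  forall a, a != 4 -> ar s' a = ar s2 a & layer s' B k].
have [e0 _ _ _ _] := H2.
have [] : J n (exec (CFor 31 0 Cstep) s3).
  have s30 : va s3 0 = n by rewrite V3.
  rewrite -s30; apply: exec_for => [|k s' kn [j1 j2 j3]]; first by split=> // y h _;
    apply: V3.
  rewrite s30 in kn; set s'' := set_var s' 31 k.
  split.
  - move=> y y30 y31; rewrite exec_va ?inE //= upd_other // j1 //.
  - by move=> a a4; rewrite exec_ar ?inE //= j2.
  - apply: Cstep_layer => //.
    + apply: lims_eq H2 => y y16; rewrite /= upd_other ?j1 //; lia.
    + by apply: tables_eq T2 => a _ a4; apply: j2.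
move: (exec (CFor 31 0 Cstep) s3) => s4 j1 j2 L4.
have H4 : lims n p (va s4) by apply: lims_eq H2 => y y16; rewrite j1 //; lia.
have T4 : tables n p (ar s4) by apply: tables_eq T2 => a _ a4; apply: j2.
have B4 : va s4 22 = B by rewrite j1 //= upd_same.
have fE : tr (va s4) (ar s4) Efinal =
    has (final n p (pref_of n p (ar s 0)) (ar s 1) (ar s 2) (ar s 3) B) (iota 0 ST).
  have [e0' _ _ _ [_ _ _ _ [e8 _]]] := H4.
  rewrite /Efinal tr_sum e8; apply: eq_in_has => t; rewrite mem_iota add0n => /andP[_ tS].
  have H5 : lims n p (upd (va s4) 24 t) by apply: lims_upd.
  rewrite tr_and tr_cell // !evalE /final.
  have [-> ->] : upd (va s4) 24 t 0 = n /\ upd (va s4) 24 t 24 = t by [].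
  rewrite L4 // /table_in !j2 // -!h2 //; congr (_ && _).
  rewrite (tr_allb _ _ H5); apply: eq_in_all => b; rewrite mem_iota => Hb.
  have H6 := lims_upd b.-1 (isT : 16 <= 40) H5.
  set ev6 := upd _ 40 _ in H6 *.
  have bE : eval ev6 (ar s4) (Esucc 40) = b.
    by rewrite !evalE /ev6 upd_same addn1 prednK //; lia.
  have e24 : ev6 24 = t by []. have e22 : ev6 22 = B by rewrite -B4.
  have [_ /(_ _ tS) [_ _ _ _ [_ ts]]] := T4.
  rewrite tr_eq !(eval_bit T4 H6) ?bE //; try lia.
  - by rewrite !evalE e24 e22 ts.
  - by rewrite !evalE e22.
  - by rewrite !evalE e24 ts dec_set_lt.
split.
- move=> y y16; rewrite -h1 //.
  have y4 : va s4 y = va s1 y.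
    by rewrite j1; [rewrite /s2 [va _]/= upd_other|..]; lia.
  by case: (tr _ _ _); rewrite [va _]/= upd_other ?y4 //; lia.
- by move=> a a4; case: (tr _ _ _) => /=; rewrite j2 //= h2.
- rewrite -[B.+1]addn1 iotaD has_cat add0n [has _ [:: _]]/= orbF -fE -h3.
  case: (tr _ _ _) => /=; rewrite ?upd_same ?orbT ?orbF //.
  by rewrite j1.
Qed.

End Decide.

(** * Precomputed arrays *)

(** Loop bounds have to be among the first 16 variables, so the range below variable 31 is obtained
    by a guard inside a range up to [n]. *)
Definition Ealive x := EAll 34 0 (EImp (ELe (Esucc 34) (EV 31))
  (ENot (EEq (ERd 1 (EV 34)) (EV x)))).
Definition Egood := EAnd (Ealive 33)
  (ELe (ESum 35 0 (EIf (EAnd (Ealive 35) (Eadj (EV 33) (EV 35))) (EC 1) (EC 0)))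
       (EC 1)).
(* The least [u] satisfying [Egood], as the number of [v] below which no vertex does. *)
Definition Eleast := ESum 36 0 (ENot (ESum 33 0 (EAnd (ELe (EV 33) (EV 36)) Egood))).
Definition Corder := CFor 31 0 (CStore 1 (EV 31) Eleast).

Definition Elater := EAnd (ELe (Esucc 31) (EV 34)) (Eadj (ERd 1 (EV 31)) (ERd 1 (EV 34))).
Definition Eparent := EIf (ESum 34 0 Elater) (ESum 34 0 (EIf Elater (EV 34) (EC 0)))
  (EV 0).
Definition Cparent := CFor 31 0 (CStore 2 (EV 31) Eparent).

Lemma eval_sum ev A x y e : eval ev A (ESum x y e) =
  sumn [seq eval (upd ev x i) A e | i <- iota 0 (ev y)].
Proof. by []. Qed.

Lemma eval_if ev A c a b : eval ev A (EIf c a b) =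
  if tr ev A c then eval ev A a else eval ev A b.
Proof. by rewrite /tr /=; case: (_ == 0). Qed.

Lemma tr_adj ev A i j : tr ev A (Eadj i j) =
  adj_of (ev 0) (A 0) (eval ev A i) (eval ev A j).
Proof. by rewrite /tr /Eadj !evalE eval_mul. Qed.

Lemma tr_alive ev A x k n : ev 0 = n -> ev 31 = k -> k <= n -> x != 34 ->
  tr ev A (Ealive x) = all (fun j => A 1 j != ev x) (iota 0 k).
Proof.
move=> e0 e31 kn x34; rewrite /Ealive tr_all e0.
have E i : tr (upd ev 34 i) A (EImp (ELe (Esucc 34) (EV 31)) (ENot (EEq (ERd 1 (EV
  34)) (EV x))))
   = (i < k) ==> (A 1 i != ev x).
  by rewrite tr_imp tr_le tr_not tr_eq !evalE upd_same !upd_other // e31 addn1.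
rewrite (eq_all E); apply/allP/allP => H j; rewrite mem_iota add0n => /andP[_ Hj].
  by have := H j; rewrite mem_iota (leq_trans Hj kn) Hj /= => /(_ isT).
by apply/implyP => jk; apply: H; rewrite mem_iota.
Qed.

Lemma sumn_count (P : pred nat) s : sumn [seq (if P i then 1 else 0) | i <- s] =
  count P s.
Proof. by elim: s => //= i s ->; case: (P i). Qed.

Lemma tr_good ev A k n : ev 0 = n -> ev 31 = k -> k <= n ->
  tr ev A Egood = eliminable n (adj_of n (A 0)) (A 1) k (ev 33).
Proof.
move=> e0 e31 kn; rewrite /Egood tr_and (@tr_alive ev A 33 k n) // tr_le /eliminable.
congr (_ && (_ <= 1)); rewrite -sumn_count eval_sum e0.
congr sumn; apply: eq_map => w; rewrite eval_if tr_and tr_adj !evalE.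
by rewrite (@tr_alive _ A 35 k n) // upd_same upd_other // e0 upd_other.
Qed.

Lemma sumn_least (P : pred nat) n : has P (iota 0 n) ->
  let v := sumn [seq 1 - sumn [seq (if (i <= j) && P i then 1 else 0) | i <- iota 0 n]
                | j <- iota 0 n] in
  v < n /\ P v.
Proof.
move=> hP v.
have exP : exists i, P i && (i < n).
  by case/hasP: hP => i; rewrite mem_iota => /andP[_ iN] Pi; exists i; rewrite Pi.
case: (ex_minnP exP) => m /andP[Pm mn] minm.
suff -> : v = m by [].
rewrite /v -[RHS]mul1n -(@sumn_prefix n 1 m (ltnW mn)); congr sumn.
apply/eq_in_map => j; rewrite mem_iota add0n => /andP[_ jn].
rewrite sumn_count; case: ltnP => h.
  rewrite (_ : count _ _ = 0) //; apply/eqP; rewrite -leqn0 leqNgt -has_count.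
  apply/hasP => -[i]; rewrite mem_iota add0n => /andP[_ iN] /andP[ij Pi].
  by have := minm i; rewrite Pi iN => /(_ isT); lia.
have : 0 < count (fun i => (i <= j) && P i) (iota 0 n).
  by rewrite -has_count; apply/hasP; exists m; rewrite ?mem_iota ?h ?Pm.
by lia.
Qed.

(** Only whether the sum vanishes matters, so truth values other than 0 and 1 do no harm. *)
Lemma sumn_cap (f : nat -> nat) (P : pred nat) s : (forall i, (f i != 0) = P i) ->
  1 - sumn [seq f i | i <- s] = 1 - sumn [seq (if P i then 1 else 0) | i <- s].
Proof.
move=> E; have := sumn_neq0 f s; rewrite (eq_has E) sumn_count has_count; lia.
Qed.

Lemma eval_least ev A k n : ev 0 = n -> ev 31 = k -> k <= n ->
  has (eliminable n (adj_of n (A 0)) (A 1) k) (iota 0 n) ->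
  eval ev A Eleast < n /\ eliminable n (adj_of n (A 0)) (A 1) k (eval ev A Eleast).
Proof.
move=> e0 e31 kn /sumn_least; set v := sumn _; suff -> : eval ev A Eleast = v by [].
rewrite /Eleast eval_sum e0; congr sumn; apply: eq_map => j.
rewrite eval_sub eval_const eval_sum upd_other // e0; apply: sumn_cap => i.
rewrite -/(tr _ A (EAnd (ELe (EV 33) (EV 36)) Egood)) tr_and tr_le !evalE.
by rewrite (@tr_good _ A k n) // !upd_same upd_other // upd_same.
Qed.

(** Only the entries before [k] matter, so later writes into the order keep the earlier choices
    valid. *)
Lemma eq_eliminable n g ord ord' k u : (forall j, j < k -> ord j = ord' j) ->
  eliminable n g ord k u = eliminable n g ord' k u.
Proof.
move=> E; rewrite /eliminable; have al w : all (fun j => ord j != w) (iota 0 k) =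
    all (fun j => ord' j != w) (iota 0 k).
  by apply: eq_in_all => j; rewrite mem_iota add0n => /andP[_ jk]; rewrite E.
by rewrite al; congr (_ && (_ <= 1)); apply: eq_count => w; rewrite al.
Qed.

Lemma CorderP n s : va s 0 = n ->
  (forall ord k, k < n -> exists2 u, u < n & eliminable n (adj_of n (ar s 0)) ord k u) ->
  let ord := ar (exec Corder s) 1 in
  (forall k, k < n -> ord k < n) /\
  (forall k, k < n -> eliminable n (adj_of n (ar s 0)) ord k (ord k)).
Proof.
move=> e0 ex.
pose I i s' := [/\ va s' 0 = n, ar s' 0 = ar s 0,
  forall k, k < i -> ar s' 1 k < n &
  forall k, k < i -> eliminable n (adj_of n (ar s 0)) (ar s' 1) k (ar s' 1 k)].
suff [_ _] : I (va s 0) (exec Corder s) by rewrite e0.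
apply: exec_for => [|k s' kn [h0 h1 h2 h3]]; first by split.
rewrite e0 in kn; rewrite -[exec _ _]/(set_cell (set_var s' 31 k) 1 k
   (eval (upd (va s') 31 k) (ar s') Eleast)).
set v := eval _ _ _.
have [v1 v2] : v < n /\ eliminable n (adj_of n (ar s' 0)) (ar s' 1) k v.
  apply: eval_least => //; first exact: ltnW.
  by rewrite h1; have [u un hu] := ex (ar s' 1) k kn; apply/hasP; exists u;
    rewrite ?mem_iota.
rewrite h1 in v2; split=> //=.
- move=> j; rewrite ltnS leq_eqVlt => /orP[/eqP ->|jk]; first by rewrite upd_same.
  by rewrite upd_other ?h2 //; lia.
- move=> j; rewrite ltnS leq_eqVlt => /orP[/eqP ->|jk].
    rewrite upd_same (@eq_eliminable _ _ _ (ar s' 1)) // => i ik.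
    by rewrite upd_other //; lia.
  rewrite upd_other; last by lia.
  rewrite (@eq_eliminable _ _ _ (ar s' 1)) ?h3 // => i ij.
  by rewrite upd_other //; lia.
Qed.

Lemma tr_later ev A n j : ev 0 = n -> tr (upd ev 34 j) A Elater =
  (ev 31 < j) && adj_of n (A 0) (A 1 (ev 31)) (A 1 j).
Proof.
move=> e0; rewrite /Elater tr_and tr_le tr_adj !evalE upd_same !upd_other //.
by rewrite e0 addn1.
Qed.

Lemma eval_parent ev A n : ev 0 = n ->
  eval ev A Eparent = par_of n (adj_of n (A 0)) (A 1) (ev 31).
Proof.
move=> e0; rewrite /Eparent /par_of eval_if tr_sum e0 eval_sum e0.
rewrite (eq_has (fun j => tr_later A j e0)).
case: ifP => _; last by rewrite eval_var.
by congr sumn; apply: eq_map => j; rewrite eval_if (tr_later A j e0) !evalE upd_same.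
Qed.

Lemma CparentP n s : va s 0 = n -> forall k, k < n ->
  ar (exec Cparent s) 2 k = par_of n (adj_of n (ar s 0)) (ar s 1) k.
Proof.
move=> e0 k kn.
have [] := @exec_fill (fun i v => v = par_of n (adj_of n (ar s 0)) (ar s 1) i)
  31 0 2 (EV 31) Eparent 0 s.
  move=> i s' iN h1 h2 _; split; first by rewrite /= upd_same.
  have e0' : upd (va s') 31 i 0 = n by rewrite upd_other ?h1.
  by rewrite (eval_parent _ e0') upd_same !h2.
by rewrite -/Cparent e0 => _ /(_ k kn).
Qed.

Definition Cmod a src y := CFor 30 8 (CStore a (EV 30) (EMod 8 (ERd src (EV 30)) (EV y))).
Definition Cdiv a src y := CFor 30 8 (CStore a (EV 30) (EDiv 8 (ERd src (EV 30)) (EV y))).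

(** Every intermediate quotient is at most the state it comes from, so the number of states,
    variable 8, is a large enough range for division by counting. *)
Lemma Cdivmod_spec (op : nat -> expr -> expr -> expr) (f : nat -> nat -> nat)
    (h : nat -> nat) a src y s :
  (forall ev A u v, 0 < eval ev A v -> eval ev A u <= ev 8 ->
     eval ev A (op 8 u v) = f (eval ev A u) (eval ev A v)) ->
  src != a -> y < 16 -> 0 < va s y ->
  (forall i, i < va s 8 -> ar s src i = h i) -> (forall i, h i <= i) ->
  forall i, i < va s 8 ->
  ar (exec (CFor 30 8 (CStore a (EV 30) (op 8 (ERd src (EV 30)) (EV y)))) s) a i =
  f (h i) (va s y).
Proof.
move=> opE sa y16 y0 hs hle i iS.
have [] := @exec_fill (fun i v => v = f (h i) (va s y))
  30 8 a (EV 30) (op 8 (ERd src (EV 30)) (EV y)) 0 s.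
  move=> j s' jS h1 h2 _; split; first by rewrite /= upd_same.
  have yE : upd (va s') 30 j y = va s y by rewrite upd_other ?h1 //; lia.
  have e8 : upd (va s') 30 j 8 = va s 8 by rewrite upd_other ?h1.
  rewrite opE !evalE ?yE ?e8 // upd_same h2 // hs //.
  by apply: leq_trans (ltnW jS).
by move=> _ /(_ i iS).
Qed.

Definition Cmod_spec (h : nat -> nat) a src y s :=
  @Cdivmod_spec EMod modn h a src y s (fun ev A u v => @eval_mod ev A 8 u v isT).
Definition Cdiv_spec (h : nat -> nat) a src y s :=
  @Cdivmod_spec EDiv divn h a src y s (fun ev A u v => @eval_div ev A 8 u v isT).

Definition Cid := CFor 30 8 (CStore 11 (EV 30) (EV 30)).

(** Array 11 starts as the identity, from which the digits are split off one by one, and ends with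
    the last quotient, the set of completed activities. *)
Definition Ctables :=
  CSeq Cid (CSeq (Cmod 6 11 3) (CSeq (Cdiv 12 11 3)
  (CSeq (Cmod 7 12 2) (CSeq (Cdiv 13 12 2)
  (CSeq (Cmod 8 13 6) (CSeq (Cdiv 14 13 6)
  (CSeq (Cmod 9 14 7) (CSeq (Cdiv 15 14 7)
  (CSeq (Cmod 10 15 6) (Cdiv 11 15 6)))))))))).

Lemma CtablesP n p s : lims n p (va s) -> (forall b, b < p -> ar s 5 b = 2 ^ b) ->
  tables n p (ar (exec Ctables s)).
Proof.
move=> H pw; split; first by move=> b bp; rewrite exec_ar // pw.
have [_ _ e2 e3 [_ _ e6 e7 [e8 _]]] := H.
have q1 i : dec_q1 p i <= i by apply: leq_div.
have q2 i : dec_q2 n p i <= i by apply: leq_trans (leq_div _ _) (q1 i).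
have q3 i : dec_q3 n p i <= i by apply: leq_trans (leq_div _ _) (q2 i).
have q4 i : dec_q4 n p i <= i by apply: leq_trans (leq_div _ _) (q3 i).
rewrite /Ctables !exec_seq.
set s0 := exec Cid s; set s1 := exec (Cmod 6 _ _) s0; set s2 := exec (Cdiv 12 _ _) s1.
set s3 := exec (Cmod 7 _ _) s2; set s4 := exec (Cdiv 13 _ _) s3.
set s5 := exec (Cmod 8 _ _) s4; set s6 := exec (Cdiv 14 _ _) s5.
set s7 := exec (Cmod 9 _ _) s6; set s8 := exec (Cdiv 15 _ _) s7.
set s9 := exec (Cmod 10 _ _) s8; set sf := exec (Cdiv 11 _ _) s9.
have V c x : x != 30 -> forall t, assigned c = [:: 30] -> va (exec c t) x = va t x.
  by move=> x30 t ac; apply: exec_va; rewrite ac inE.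
have V0 x : x != 30 -> va s0 x = va s x by move=> h; apply: V.
have V1 x : x != 30 -> va s1 x = va s x by move=> h; rewrite V ?V0.
have V2 x : x != 30 -> va s2 x = va s x by move=> h; rewrite V ?V1.
have V3 x : x != 30 -> va s3 x = va s x by move=> h; rewrite V ?V2.
have V4 x : x != 30 -> va s4 x = va s x by move=> h; rewrite V ?V3.
have V5 x : x != 30 -> va s5 x = va s x by move=> h; rewrite V ?V4.
have V6 x : x != 30 -> va s6 x = va s x by move=> h; rewrite V ?V5.
have V7 x : x != 30 -> va s7 x = va s x by move=> h; rewrite V ?V6.
have V8 x : x != 30 -> va s8 x = va s x by move=> h; rewrite V ?V7.
have V9 x : x != 30 -> va s9 x = va s x by move=> h; rewrite V ?V8.
have id0 i : i < num_states n p -> ar s0 11 i = i.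
  move=> iS; have [] := @exec_fill (fun i v => v = i) 30 8 11 (EV 30) (EV 30) 0 s.
    by move=> j s' _ _ _ _; rewrite /= upd_same.
  by rewrite -/Cid e8 => _ /(_ i iS).
have M h a src y t : (forall x, x != 30 -> va t x = va s x) -> src != a -> y < 16 ->
    0 < va s y -> (forall i, i < num_states n p -> ar t src i = h i) ->
    (forall i, h i <= i) -> forall i, i < num_states n p ->
    (ar (exec (Cmod a src y) t) a i = h i %% va s y) *
    (ar (exec (Cdiv a src y) t) a i = h i %/ va s y).
  move=> Vt sa y16 y0 ht hle i iS.
  have t8 : va t 8 = num_states n p by rewrite Vt.
  have ty : va t y = va s y by rewrite Vt //; lia.
  by rewrite (@Cmod_spec h) ?(@Cdiv_spec h) ?t8 ?ty.
have R c t a : a \notin stored c -> ar (exec c t) a = ar t a by apply: exec_ar.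
have T6 i : i < num_states n p -> ar s1 6 i = dec_act p i.
  by move=> iS; rewrite (M id) ?e3.
have T12 i : i < num_states n p -> ar s2 12 i = dec_q1 p i.
  by move=> iS; rewrite (M id) ?e3 // => j jS; rewrite R ?id0.
have T7 i : i < num_states n p -> ar s3 7 i = dec_size n p i.
  by move=> iS; rewrite (M (dec_q1 p)) ?e2.
have T13 i : i < num_states n p -> ar s4 13 i = dec_q2 n p i.
  by move=> iS; rewrite (M (dec_q1 p)) ?e2 // => j jS; rewrite R ?T12.
have T8 i : i < num_states n p -> ar s5 8 i = dec_acc n p i.
  by move=> iS; rewrite (M (dec_q2 n p)) ?e6.
have T14 i : i < num_states n p -> ar s6 14 i = dec_q3 n p i.
  by move=> iS; rewrite (M (dec_q2 n p)) ?e6 // => j jS; rewrite R ?T13.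
have T9 i : i < num_states n p -> ar s7 9 i = dec_cnt n p i.
  by move=> iS; rewrite (M (dec_q3 n p)) ?e7.
have T15 i : i < num_states n p -> ar s8 15 i = dec_q4 n p i.
  by move=> iS; rewrite (M (dec_q3 n p)) ?e7 // => j jS; rewrite R ?T14.
have T10 i : i < num_states n p -> ar s9 10 i = dec_wit n p i.
  by move=> iS; rewrite (M (dec_q4 n p)) ?e6.
have T11 i : i < num_states n p -> ar sf 11 i = dec_set n p i.
  by move=> iS; rewrite (M (dec_q4 n p)) ?e6 // => j jS; rewrite R ?T15.
move=> i iS; rewrite T11 //; split; last split=> //.
- by rewrite /sf R // /s9 R // /s8 R // /s7 R // /s6 R // /s5 R // /s4 R // /s3 R //
  /s2 R // T6.
- by rewrite /sf R // /s9 R // /s8 R // /s7 R // /s6 R // /s5 R // /s4 R // T7.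
- by rewrite /sf R // /s9 R // /s8 R // /s7 R // /s6 R // T8.
- by rewrite /sf R // /s9 R // /s8 R // T9.
- by rewrite /sf R // T10.
Qed.

(** * Search and output *)

(** Variable 19 keeps the last activity for which the decision procedure still answers yes, with
    default 0. Successors are stored because 0 in array 3 means free. *)
Definition Cround :=
  CSeq (CSet 19 (EC 0))
  (CSeq (CFor 33 3 (CSeq (CStore 3 (EV 32) (Esucc 33))
    (CSeq Cdecide (CIf (EV 16) (CSet 19 (EV 33)) (CSet 19 (EV 19))))))
  (CStore 3 (EV 32) (Esucc 19))).
Definition Csearch := CFor 32 0 Cround.

Section Search.

Variables (n p : nat) (stable : ('I_n -> option 'I_p) -> Prop) (s0 : store).
Hypothesis Hlims : lims n p (va s0).
Hypothesis Htab : tables n p (ar s0).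
Hypothesis Hdec : forall fixed,
  decide n p (pref_of n p (ar s0 0)) (ar s0 1) (ar s0 2) fixed <->
  exists pi, stable pi /\ consistent fixed pi.

Definition similar s := (forall y, y < 16 -> va s y = va s0 y) /\
  (forall a, a != 3 -> a != 4 -> ar s a = ar s0 a).

Lemma similar_lims s : similar s -> lims n p (va s).
Proof. by move=> [h _]; apply: lims_eq Hlims. Qed.

Lemma similar_tables s : similar s -> tables n p (ar s).
Proof. by move=> [_ h]; apply: tables_eq Htab => a a3 a4; apply: h => //; lia. Qed.

Definition solvable fixed := exists pi, stable pi /\ consistent fixed pi.

Lemma Cdecide_solvable s : similar s ->
  (va (exec Cdecide s) 16 != 0) <-> solvable (ar s 3).
Proof.
move=> sim; rewrite (CdecideP (similar_lims sim) (similar_tables sim)).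
by have [_ h] := sim; rewrite (h 0 isT isT) (h 1 isT isT) (h 2 isT isT); apply: Hdec.
Qed.

Lemma Cdecide_frame s :
  (forall y, y \notin [:: 16; 22; 30; 31] -> va (exec Cdecide s) y = va s y) /\
  (forall a, a != 4 -> ar (exec Cdecide s) a = ar s a).
Proof.
split=> [y Hy|a Ha]; [apply: exec_va|apply: exec_ar]; last by rewrite !inE !(negbTE Ha).
by move: Hy; rewrite /= !inE !negb_or => /and4P[-> -> -> ->].
Qed.

Lemma similar_eq s s' : (forall y, y < 16 -> va s' y = va s y) ->
  (forall a, a != 3 -> a != 4 -> ar s' a = ar s a) -> similar s -> similar s'.
Proof.
by move=> e1 e2 [h1 h2]; split=> [y Hy|a a3 a4]; rewrite ?e1 ?e2 ?h1 ?h2.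
Qed.

Lemma CroundP s i : similar s -> i < n -> va s 32 = i -> ar s 3 i = 0 ->
  let s' := exec Cround s in
  [/\ similar s', forall j, j != i -> ar s' 3 j = ar s 3 j, 0 < ar s' 3 i
    & solvable (ar s 3) -> solvable (ar s' 3)].
Proof.
move=> sim iN s32 s3i; rewrite /Cround 2!exec_seq exec_set.
set s1 := set_var s 19 _.
have sim1 : similar s1 by apply: similar_eq sim => // y Hy; rewrite /= upd_other //; lia.
have [_ _ _ e3 _] := similar_lims sim1.
(* [P a] says that player [i] can be given activity [a]; the invariant is that variable 19 is a good
   choice as soon as some activity tried so far is. *)
pose P a := solvable (upd (ar s 3) i a.+1).
pose I a t := [/\ similar t, va t 32 = i, forall j, j != i -> ar t 3 j = ar s 3 j
   & forall b, b < a -> P b -> P (va t 19)].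
set c := CSeq (CStore 3 _ _) _.
have : I (va s1 3) (exec (CFor 33 3 c) s1).
  apply: exec_for => [|a t ap [t1 t2 t3 t4]]; first by split.
  rewrite /c 2!exec_seq; set t5 := exec (CStore 3 _ _) _.
  have t5E : ar t5 3 = upd (ar t 3) i a.+1.
    by rewrite /t5 /= upd_same upd_other // t2 addn1.
  have sim5 : similar t5.
    apply: similar_eq t1 => [y Hy|b b3 b4]; first by rewrite /= upd_other //; lia.
    by rewrite /= (negbTE b3).
  have t519 : va t5 19 = va t 19 by [].
  have t532 : va t5 32 = i by rewrite -t2.
  have t533 : va t5 33 = a by rewrite /= upd_same.
  clearbody t5.
  have [F1 F2] := Cdecide_frame t5; have D := Cdecide_solvable sim5.
  move: (exec Cdecide t5) F1 F2 D => t6 F1 F2 D.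
  have sim6 : similar t6.
    apply: similar_eq sim5 => [y Hy|b b3 b4]; last exact: F2.
    by apply: F1; rewrite !inE; lia.
  have fE : solvable (ar t5 3) <-> P a.
    rewrite t5E /P; split=> -[pi [h1 h2]]; exists pi; split=> // j; have := h2 j;
      rewrite /upd; case: eqP => // /eqP ji; by rewrite t3.
  rewrite exec_if !exec_set /tr !eval_var.
  have [f|nf] := boolP (va t6 16 != 0).
    have Pa : P a by apply/fE/D.
    split.
    - by apply: similar_eq sim6 => // y Hy; rewrite /= upd_other //; lia.
    - by rewrite /= upd_other // F1.
    - by move=> j ji; rewrite /= F2 // t5E upd_other // t3.
    - by move=> b _ _; rewrite /= upd_same F1 // t533.
  split.
  - by apply: similar_eq sim6 => // y Hy; rewrite /= upd_other //; lia.
  - by rewrite /= upd_other // F1.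
  - by move=> j ji; rewrite /= F2 // t5E upd_other // t3.
  - move=> b; rewrite /= upd_same F1 // t519 ltnS leq_eqVlt => /orP[/eqP ->|];
    last exact: t4.
    by move=> /fE /D; rewrite (negbTE nf).
move: (exec (CFor 33 3 c) s1) => s2 [sim2 s232 s23 best].
have E3 : ar (exec (CStore 3 (EV 32) (Esucc 19)) s2) 3 = upd (ar s2 3) i (va s2 19).+1.
  by rewrite /= s232 addn1.
split.
- by apply: similar_eq sim2 => // b b3 b4; rewrite /= (negbTE b3).
- by move=> j ji; rewrite E3 upd_other // s23.
- by rewrite E3 upd_same.
(* A stable assignment consistent with the earlier choices makes its own activity at [i] a good
   choice. *)
case=> pi [st co].
have Pb : P (code_activity (pi (Ordinal iN))).
  exists pi; split=> // j; rewrite /upd; case: eqP => [ji|//].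
  by right; congr (_.+1); congr code_activity; congr pi; apply: val_inj.
have bl : code_activity (pi (Ordinal iN)) < va s1 3.
  by rewrite e3; case: (pi _) => [a|] //=; rewrite !ltnS.
have [pi' [st' co']] := best _ bl Pb; exists pi'; split=> // j.
rewrite E3; have := co' j; rewrite /upd; case: eqP => // /eqP ji.
by rewrite s23.
Qed.

Lemma CsearchP : (forall j, j < n -> ar s0 3 j = 0) ->
  let s := exec Csearch s0 in
  [/\ similar s, forall j, j < n -> 0 < ar s 3 j &
      (exists pi, stable pi) -> solvable (ar s 3)].
Proof.
move=> z; have [e0 _ _ _ _] := Hlims.
pose I i s := [/\ similar s, forall j, j < i -> 0 < ar s 3 j,
  forall j, i <= j < n -> ar s 3 j = 0 & (exists pi, stable pi) -> solvable (ar s 3)].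
suff [h1 h2 _ h3] : I (va s0 0) (exec Csearch s0) by rewrite e0 in h2; split.
apply: exec_for => [|i s iN [h1 h2 h3 h4]].
  split=> //.
  by case=> pi st; exists pi; split=> // j; left; apply: z.
rewrite e0 in iN; set s' := set_var s 32 i.
have sim : similar s' by apply: similar_eq h1 => // y Hy; rewrite /= upd_other //; lia.
have [||a1 a2 a3 a4] := CroundP sim iN.
- by rewrite /= upd_same.
- by apply: h3; rewrite leqnn.
split=> //.
- move=> j; rewrite ltnS leq_eqVlt => /orP[/eqP ->//|ji].
  by rewrite a2; [apply: h2|lia].
- by move=> j Hj; rewrite a2; [apply: h3|]; lia.
- by move=> h; exact: a4 (h4 h).
Qed.

End Search.

Definition Coutput :=
  CIf (EV 16)
    (CSeq (CFor 30 0 (CStore 0 (EAdd (EC 2) (EV 30)) (ESub (ERd 3 (EV 30)) (EC 1))))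
    (CSeq (CStore 0 (EC 1) (EC 1)) (CStore 0 (EC 0) (Esucc 0))))
    (CSeq (CStore 0 (EC 1) (EC 0)) (CStore 0 (EC 0) (EC 1))).

Lemma CoutputP n s : va s 0 = n ->
  let A := ar (exec Coutput s) in
  [seq A 0 i.+1 | i <- iota 0 (A 0 0)] =
  (if va s 16 != 0 then 1 :: [seq (ar s 3 i).-1 | i <- iota 0 n] else [:: 0])
  /\ A 0 0 <= n.+1.
Proof.
move=> e0; rewrite /Coutput exec_if /tr eval_var.
have [f|nf] := boolP (va s 16 != 0); last by rewrite !exec_seq /=.
rewrite !exec_seq; set s1 := exec (CFor _ _ _) s.
have [] := @exec_fill (fun i v => v = (ar s 3 i).-1) 30 0 0 (EAdd (EC 2) (EV 30))
  (ESub (ERd 3 (EV 30)) (EC 1)) 2 s.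
  by move=> i s' iN h1 h2 h3; rewrite !evalE upd_same h2 // subn1.
rewrite -/s1 e0 => _ Q.
have s10 : va s1 0 = n by rewrite exec_va.
rewrite /= s10 addn1; split; last by rewrite upd_same.
rewrite upd_same /= upd_other // upd_same; congr (_ :: _).
rewrite -[1]addn0 iotaDl -map_comp; apply/eq_in_map => i;
  rewrite mem_iota add0n => /andP[_ iN].
by rewrite /= !upd_other //; exact: Q.
Qed.

(** * Loop bounds *)

Definition execs (cs : seq cmd) s := foldl (fun s c => exec c s) s cs.

Lemma exec_foldr w cs s : exec (foldr CSeq w cs) s = exec w (execs cs s).
Proof. by elim: cs s => //= c cs IH s; rewrite IH. Qed.

(** The initial assignments set the loop bounds themselves, which [bounded] forbids. They are
    allowed on the spine of the program only, where [small_along] requires the limit [M] at every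
    point. *)
Definition bounded_top c := if c is CSet _ e then bounded_expr e else bounded c.

Fixpoint small_along M (cs : seq cmd) s : Prop :=
  small M (va s) /\ if cs is c :: cs' then small_along M cs' (exec c s) else True.

Lemma cost_spine w cs : bounded w -> all bounded_top cs ->
  exists C d, forall s M, 0 < M -> small_along M cs s ->
    cost (foldr CSeq w cs) s <= C * M ^ d.
Proof.
move=> bw; elim: cs => [_|c cs IH /= /andP[bc /IH[C2 [d2 H2]]]].
  have [C [d H]] := cost_bound w; exists C, d => s M M0 /= [sm _]; exact: H.
have [C1 [d1 H1]] : exists C d, forall s M, 0 < M -> small M (va s) ->
    cost c s <= C * M ^ d.
  have := cost_bound c.
  case: c bc => [x e be _|a e1 e2 b|c1 c2 b|e c1 c2 b|x y c b].
    have [C [d H]] := cost_expr_bound e; exists (C + 0 + 2), (d + 0) => s M M0 sm /=.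
    rewrite -[cost_expr _ _ e]addn0.
    by apply: (@poly_bound_add _ _ 0 0) => //; apply: H.
  1-4: by move=> [C [d H]]; exists C, d => s M M0 sm; apply: H.
exists (C1 + C2 + 0), (d1 + d2) => s M M0 /= [sm smr].
rewrite -[X in X <= _]addn0; apply: poly_bound_add => //; first exact: H1.
exact: H2.
Qed.

Definition Cpow := CFor 18 1 (CSeq (CStore 5 (EV 18) (EV 17))
  (CSet 17 (EAdd (EV 17) (EV 17)))).

Lemma CpowP s : va s 17 = 1 ->
  va (exec Cpow s) 17 = 2 ^ va s 1 /\
  forall b, b < va s 1 -> ar (exec Cpow s) 5 b = 2 ^ b.
Proof.
move=> e17; pose I i s' := va s' 17 = 2 ^ i /\ forall b, b < i -> ar s' 5 b = 2 ^ b.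
suff [] : I (va s 1) (exec Cpow s) by [].
apply: exec_for => [|i s' iN [h1 h2]] //=; split.
  by rewrite upd_same /= /upd /= h1 expnS mul2n addnn.
move=> b; rewrite ltnS leq_eqVlt /= /upd /= => /orP[/eqP ->|bi]; first by rewrite eqxx.
by rewrite (ltn_eqF bi) h2.
Qed.

Definition params1 :=
  [:: CSet 0 (ERd 0 (EC 1)); CSet 1 (ERd 0 (EC 2)); CSet 2 (Esucc 0);
      CSet 3 (Esucc 1); CSet 4 (EAdd (EMul 0 (EV 1)) (EC 1)); CSet 17 (EC 1)].
Definition params2 :=
  [:: CSet 5 (EV 17); CSet 6 (EC 2); CSet 7 (EAdd (EV 0) (EC 2));
      CSet 8 (EMul 3 (EMul 2 (EMul 6 (EMul 7 (EMul 6 (EV 5))))));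
      CSet 9 (EMul 2 (EV 8))].
Definition params := params1 ++ Cpow :: params2.

Lemma small_set_var M s x v : small M (va s) -> v <= M -> small M (va (set_var s x v)).
Proof. by move=> sm vM y y16; rewrite /= /upd; case: eqP => // _; apply: sm. Qed.

Lemma paramsP n p s M : (forall y, va s y = 0) -> ar s 0 1 = n -> ar s 0 2 = p ->
  n.+2 <= M -> p.+1 <= M -> (p * n).+1 <= M -> 2 ^ p <= M -> num_states n p * n.+1 <= M ->
  let s' := execs params s in
  [/\ lims n p (va s'), forall b, b < p -> ar s' 5 b = 2 ^ b,
      forall a, a != 5 -> ar s' a = ar s a & small_along M params s].
Proof.
move=> s0 In Ip nM pM qM TM NM.
have sm0 : small M (va s) by move=> y _; rewrite s0.
pose t1 := set_var s 0 n; pose t2 := set_var t1 1 p; pose t3 := set_var t2 2 n.+1.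
pose t4 := set_var t3 3 p.+1; pose t5 := set_var t4 4 (p * n).+1.
pose t6 := set_var t5 17 1; pose t7 := exec Cpow t6.
pose t8 := set_var t7 5 (2 ^ p); pose t9 := set_var t8 6 2; pose t10 := set_var t9 7 n.+2.
pose t11 := set_var t10 8 (num_states n p).
pose t12 := set_var t11 9 (num_states n p * n.+1).
have E1 : exec (CSet 0 (ERd 0 (EC 1))) s = t1 by rewrite exec_set !evalE In.
have E2 : exec (CSet 1 (ERd 0 (EC 2))) t1 = t2 by rewrite exec_set !evalE Ip.
have E3 : exec (CSet 2 (Esucc 0)) t2 = t3 by rewrite exec_set !evalE addn1.
have E4 : exec (CSet 3 (Esucc 1)) t3 = t4 by rewrite exec_set !evalE addn1.
have E5 : exec (CSet 4 (EAdd (EMul 0 (EV 1)) (EC 1))) t4 = t5.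
  by rewrite exec_set eval_add eval_mul // addn1.
have E6 : exec (CSet 17 (EC 1)) t5 = t6 by [].
have [p17 pw] := @CpowP t6 erefl; rewrite -/t7 in p17 pw.
have v7 y : y < 16 -> va t7 y = va t6 y.
  by move=> y16; apply: exec_va; rewrite !inE; lia.
have E8 : exec (CSet 5 (EV 17)) t7 = t8 by rewrite exec_set eval_var p17.
have E9 : exec (CSet 6 (EC 2)) t8 = t9 by [].
have E10 : exec (CSet 7 (EAdd (EV 0) (EC 2))) t9 = t10.
  by rewrite exec_set !evalE /= !upd_other // v7 //= addn2.
have v10 : [/\ va t10 2 = n.+1, va t10 3 = p.+1, va t10 5 = 2 ^ p, va t10 6 = 2
    & va t10 7 = n.+2].
  by split; rewrite //= !upd_other // v7.
have E11 : exec (CSet 8 (EMul 3 (EMul 2 (EMul 6 (EMul 7 (EMul 6 (EV 5))))))) t10 = t11.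
  by case: v10 => a b c d e; rewrite exec_set !eval_mul // eval_var a b c d e.
have E12 : exec (CSet 9 (EMul 2 (EV 8))) t11 = t12.
  case: v10 => a _ _ _ _; rewrite exec_set eval_mul // eval_var.
  by have [-> ->] : va t11 8 = num_states n p /\ va t11 2 = n.+1.
have Es : execs params s = t12.
  rewrite /execs /params foldl_cat /params1 /params2.
  rewrite -[foldl _ s _]/(exec (CSet 17 (EC 1)) (exec (CSet 4 (EAdd (EMul 0 (EV 1))
    (EC 1)))
    (exec (CSet 3 (Esucc 1)) (exec (CSet 2 (Esucc 0)) (exec (CSet 1 (ERd 0 (EC 2)))
    (exec (CSet 0 (ERd 0 (EC 1))) s)))))) E1 E2 E3 E4 E5 E6.
  rewrite -[LHS]/(exec (CSet 9 (EMul 2 (EV 8)))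
    (exec (CSet 8 (EMul 3 (EMul 2 (EMul 6 (EMul 7 (EMul 6 (EV 5)))))))
    (exec (CSet 7 (EAdd (EV 0) (EC 2))) (exec (CSet 6 (EC 2)) (exec (CSet 5 (EV 17))
      t7))))).
  by rewrite E8 E9 E10 E11 E12.
have sm1 : small M (va t1) by apply: small_set_var => //; lia.
have sm2 : small M (va t2) by apply: small_set_var => //; lia.
have sm3 : small M (va t3) by apply: small_set_var => //; lia.
have sm4 : small M (va t4) by apply: small_set_var => //; lia.
have sm5 : small M (va t5) by apply: small_set_var => //; lia.
have sm6 : small M (va t6) by apply: small_set_var => //; lia.
have sm7 : small M (va t7) by move=> y y16; rewrite v7 // sm6.
have sm8 : small M (va t8) by apply: small_set_var.
have sm9 : small M (va t9) by apply: small_set_var => //; lia.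
have sm10 : small M (va t10) by apply: small_set_var.
have sm11 : small M (va t11).
  by apply: small_set_var => //; apply: leq_trans NM; apply: leq_pmulr.
have sm12 : small M (va t12) by apply: small_set_var.
rewrite Es; split.
- rewrite /lims.
  have [-> -> -> -> ->] : [/\ va t12 0 = va t7 0, va t12 1 = va t7 1,
    va t12 2 = va t7 2, va t12 3 = va t7 3 & va t12 4 = va t7 4] by [].
  by rewrite !v7.
- by move=> b bp; apply: pw.
- by move=> a a5; rewrite -[LHS]/(ar t7 a) /t7 exec_ar // inE.
rewrite /params /params1 /params2 [cat _ _]/= /small_along.
by rewrite E1 E2 E3 E4 E5 E6 -/t7 E8 E9 E10 E11 E12.
Qed.

(** * Instances as RAM inputs *)

Lemma nth_flatten_block (I T : Type) (x0 : T) (i0 : I) (f : I -> seq T) (s : seq I) w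
  i j :
  (forall x, size (f x) = w) -> i < size s -> j < w ->
  nth x0 (flatten [seq f x | x <- s]) (i * w + j) = nth x0 (f (nth i0 s i)) j.
Proof.
move=> sf; elim: s i => // x s IH [|i] /= Hi Hj; rewrite nth_cat sf; first by rewrite Hj.
rewrite mulSn -addnA ltnNge leq_addr /= addKn; exact: IH.
Qed.

Lemma size_flatten_block (I T : Type) (f : I -> seq T) (s : seq I) w :
  (forall x, size (f x) = w) -> size (flatten [seq f x | x <- s]) = size s * w.
Proof. by move=> sf; elim: s => //= x s IH; rewrite size_cat sf IH mulSn. Qed.

Lemma size_alts n p : size (alts n p) = (p * n).+1.
Proof.
rewrite /= (size_flatten_block _ (w := n)) ?size_enum_ord // => a.
by rewrite size_map size_iota.
Qed.

Lemma nth_alts n p (x : alt p) : x \in alts n p ->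
  altn n x < size (alts n p) /\ nth None (alts n p) (altn n x) = x.
Proof.
rewrite size_alts; case: x => [[a k]|//]; rewrite inE /= => /allpairsP[[b m] /= [_]].
rewrite mem_iota => Hm [-> ->] {a k}; have bp := ltn_ord b.
have E : alt_index n b.+1 m = (b * n + m.-1).+1 by rewrite /alt_index /=; lia.
rewrite E ltnS /=; split.
  apply: leq_trans (_ : b.+1 * n <= _); first by rewrite mulSn; lia.
  by rewrite leq_mul2r bp orbT.
rewrite (nth_flatten_block None b); first last.
- by lia.
- by rewrite size_enum_ord.
- by move=> a; rewrite size_map size_iota.
rewrite nth_ord_enum (nth_map 0) ?size_iota; last by lia.
by rewrite nth_iota; [congr (Some (_, _))|]; lia.
Qed.

Section Encoding.

Variables (n p : nat) (L : {set {set 'I_n}}) (pref : 'I_n -> rel (alt p)).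
Let x := encode_instance L pref.
Let In := Defs.mem (init x).

Let adjs := [seq nat_of_bool (adj L i j) | i <- enum 'I_n, j <- enum 'I_n].
Let prefs := flatten [seq [seq nat_of_bool (pref i u v) | u <- alts n p, v <- alts n p]
          | i <- enum 'I_n].

Lemma size_adjs : size adjs = n * n.
Proof.
by rewrite (size_flatten_block _ (w := n)) ?size_enum_ord // => i;
  rewrite size_map size_enum_ord.
Qed.

Lemma size_prefs : size prefs = n * ((p * n).+1 * (p * n).+1).
Proof.
rewrite (size_flatten_block _ (w := (p * n).+1 * (p * n).+1)) ?size_enum_ord // => i.
rewrite (size_flatten_block _ (w := (p * n).+1)) ?size_alts // => u.
by rewrite size_map size_alts.
Qed.

Lemma size_encode : size x = 2 + (n * n + n * ((p * n).+1 * (p * n).+1)).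
Proof. by rewrite /x /encode_instance size_cat size_cat -/adjs -/prefs size_adjs
  size_prefs. Qed.

Lemma encode_adj (i j : 'I_n) : adj_of n In i j = adj L i j.
Proof.
rewrite /adj_of /In /x /encode_instance -[3 + _]/((i * n + j).+3) /= -/adjs -/prefs.
rewrite nth_cat size_adjs; have -> : i * n + j < n * n.
  apply: leq_trans (_ : i.+1 * n <= _); first by rewrite mulSn; have := ltn_ord j; lia.
  by rewrite leq_mul2r ltn_ord orbT.
rewrite (nth_flatten_block 0 i) ?size_enum_ord //; last first.
  by move=> k; rewrite size_map size_enum_ord.
by rewrite nth_ord_enum (nth_map i) ?size_enum_ord // nth_ord_enum; case: (adj _ _ _).
Qed.

Lemma encode_pref (i : 'I_n) u v : u \in alts n p -> v \in alts n p ->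
  pref_of n p In i (altn n u) (altn n v) = pref i u v.
Proof.
move=> /nth_alts[ul uE] /nth_alts[vl vE]; rewrite size_alts in ul vl.
rewrite /pref_of; set q := (p * n).+1 in ul vl *.
have -> : 3 + n * n + ((i * q + altn n u) * q + altn n v) =
  (n * n + (i * (q * q) + (altn n u * q + altn n v))).+3 by lia.
rewrite /In /x /encode_instance /= -/adjs -/prefs nth_cat size_adjs.
rewrite ltnNge leq_addr /= addKn.
have B : altn n u * q + altn n v < q * q.
  apply: leq_trans (_ : (altn n u).+1 * q <= _); first by rewrite mulSn; lia.
  by rewrite leq_mul2r ul orbT.
rewrite (nth_flatten_block 0 i) ?size_enum_ord //; last first.
  move=> k; rewrite (size_flatten_block _ (w := q)) ?size_alts // => u'.
  by rewrite size_map size_alts.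
rewrite nth_ord_enum (nth_flatten_block 0 None) ?size_alts //; last first.
  by move=> u'; rewrite size_map size_alts.
by rewrite uE (nth_map None) ?size_alts // vE; case: (pref _ _ _).
Qed.

(** The third input word is the diagonal entry (0, 0) of the adjacency matrix, or lies past the end
    when [n = 0]. This is the zero in register 3 from which the prologue starts. *)
Lemma encode_free : nth 0 x 2 = 0.
Proof.
have [n0|n0] := posnP n.
  by rewrite nth_default // size_encode n0.
have := encode_adj (Ordinal n0) (Ordinal n0); rewrite /adj_of /= /adj eqxx /=.
by rewrite /In /= => /negbFE/eqP.
Qed.

End Encoding.

(** * The complete program and its running time *)

Definition Cwork := CSeq Ctables (CSeq Corder (CSeq Cparent (CSeq Csearch
  (CSeq Cdecide Coutput)))).
Definition Cmain := foldr CSeq Cwork params.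

Lemma CmainP n p (L : {set {set 'I_n}}) (pref : 'I_n -> rel (alt p)) :
  acyclic L ->
  let s := start (encode_instance L pref) in
  let A := ar (exec Cmain s) in
  A 0 0 <= n.+1 /\ correct_answer L pref [seq A 0 i.+1 | i <- iota 0 (A 0 0)].
Proof.
move=> ac s A; set x := encode_instance L pref in s A *.
pose M := n.+2 + p.+1 + (p * n).+1 + 2 ^ p + num_states n p * n.+1.
have [||||||||] := @paramsP n p s M; try by rewrite /M; lia.
- by [].
- by [].
- by [].
rewrite -/params; rewrite /A /Cmain exec_foldr; move: (execs params s) => s1 H1 pw F1 _.
rewrite /Cwork 5!exec_seq.
have In1 : ar s1 0 = Defs.mem (init x) by rewrite F1.
have T2 := CtablesP H1 pw; set s2 := exec Ctables s1 in T2 *.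
have V2 y : y < 16 -> va s2 y = va s1 y by move=> y16; apply: exec_va; rewrite !inE; lia.
have F2 a : a < 5 -> ar s2 a = ar s1 a by move=> a5; apply: exec_ar; rewrite !inE; lia.
have H2 : lims n p (va s2) by apply: lims_eq H1.
clearbody s2.
pose g := adj_of n (Defs.mem (init x)).
have gE i j : g (nat_of_ord i) (nat_of_ord j) = adj L i j by apply: encode_adj.
have [e0 _ _ _ _] := H2.
have [|o1 o2] := @CorderP n s2 e0.
  by move=> ord k kn; rewrite F2 // In1; apply: (eliminable_exists ac gE).
rewrite F2 // In1 -/g in o2.
set s3 := exec Corder s2 in o1 o2 *.
have V3 y : y < 16 -> va s3 y = va s2 y by move=> y16; apply: exec_va; rewrite !inE; lia.
have F3 a : a != 1 -> ar s3 a = ar s2 a by move=> a1; apply: exec_ar; rewrite !inE.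
clearbody s3.
have e30 : va s3 0 = n by rewrite V3.
have P4 := CparentP e30; rewrite F3 // F2 // In1 -/g in P4.
set s4 := exec Cparent s3 in P4 *.
have V4 y : y < 16 -> va s4 y = va s3 y by move=> y16; apply: exec_va; rewrite !inE; lia.
have F4 a : a != 2 -> ar s4 a = ar s3 a by move=> a1; apply: exec_ar; rewrite !inE.
clearbody s4.
have I4 : ar s4 0 = Defs.mem (init x) by rewrite F4 // F3 // F2 // In1.
have H4 : lims n p (va s4) by apply: lims_eq H2 => y y16; rewrite V4 // V3.
have T4 : tables n p (ar s4).
  by apply: tables_eq T2 => a a3 a4; rewrite F4 ?F3 //; lia.
rewrite -(F4 1 isT) in o1 o2 P4; set ord := ar s4 1 in o1 o2 P4.
pose ps := pos_of (n := n) ord.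
have ps_lt i : ps i < n by apply: (pos_of_lt o1 o2).
have par_gt y : y < n -> y < ar s4 2 y <= n.
  by move=> yn; rewrite P4 //; apply: (par_of_gt o1 o2).
have adj_ps i j : adj L i j = (ar s4 2 (ps i) == ps j) || (ar s4 2 (ps j) == ps i).
  by rewrite !P4 //; apply: (adj_pos_of gE o1 o2).
have dec fixed := decideP fixed par_gt ps_lt (pos_of_inj o1 o2)
  (ord_pos_of o1 o2) adj_ps (@encode_pref n p L pref).
rewrite -/x -I4 in dec.
have fix0 j : j < n -> ar s4 3 j = 0 by rewrite F4 // F3 // F2 // F1.
have [sim5 pos5 solv5] := CsearchP H4 T4 dec fix0.
move: (exec Csearch s4) sim5 pos5 solv5 => s5 sim5 pos5 solv5.
(* All entries of array 3 are now positive, so they determine the only assignment consistent with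
   them; a last decision tells whether it is stable. *)
have D6 := Cdecide_solvable H4 T4 dec sim5; have [V6 F6] := Cdecide_frame s5.
move: (exec Cdecide s5) D6 V6 F6 => s6 D6 V6 F6.
have e60 : va s6 0 = n.
  by rewrite V6 //; case: sim5 => -> // _; case: H4.
have [-> le] := CoutputP e60; split=> //.
case: ifP => [/D6[pi [st co]]|/negbT nf]; [left|right].
  exists pi; split=> //; congr (_ :: _).
  rewrite -val_enum_ord -map_comp; apply: eq_map => i /=.
  by case: (co i) => h; [have := pos5 _ (ltn_ord i); rewrite h|rewrite F6 // h].
split=> // -[pi st]; case/negP: nf; apply/D6; apply: solv5; by exists pi.
Qed.

Lemma compiled nv low c : 7 < low -> nv.+1 < low -> wf nv low nv.+1 c ->
  exists (P : program) K, forall x, nth 0 x 2 = 0 ->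
  ar (exec c (start x)) 0 0 <= size x ->
  forall t, K + 14 * size x + cost c (start x) <= t ->
  runs_within P x t
    [seq ar (exec c (start x)) 0 i.+1 | i <- iota 0 (ar (exec c (start x)) 0 0)].
Proof.
move=> h1 h2 w; exists (full_program nv low c).
exists (size (prologue nv low) + size (epilogue low 0)) => x x2 le t.
exact: full_programP.
Qed.

Lemma Cmain_wf : wf 80 200 81 Cmain.
Proof. by vm_compute. Qed.

Lemma params_bounded : all bounded_top params /\ bounded Cwork.
Proof. by vm_compute. Qed.

(** The parameter part of the time bound must itself be computable; the same compiler provides a
    program, which performs [E * k.+1] doublings. *)
Definition Cexp E :=
  CSeq (CSet 0 (EAdd (ERd 0 (EC 1)) (EC 1))) (CSeq (CSet 1 (EC E)) (CSeq (CSet 17 (EC 1))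
  (CSeq (CFor 18 0 (CFor 19 1 (CSet 17 (EAdd (EV 17) (EV 17)))))
  (CSeq (CStore 0 (EC 1) (EV 17)) (CStore 0 (EC 0) (EC 1)))))).

Lemma computable_exp E : computable_fun (fun k => 2 ^ (E * k.+1)).
Proof.
have [P [K FP]] := @compiled 80 200 (Cexp E) isT isT isT.
exists P => k; set c := Cexp E; set x := [:: k].
exists (K + 14 * size x + cost c (start x)).
pose A := ar (exec c (start x)).
have {}FP : A 0 0 <= size x -> _ := FP x erefl.
pose s3 := set_var (set_var (set_var (start x) 0 (k + 1)) 1 E) 17 1.
pose s4 := exec (CFor 18 0 (CFor 19 1 (CSet 17 (EAdd (EV 17) (EV 17))))) s3.
have A00 : A 0 0 = 1 by [].
have A01 : A 0 1 = va s4 17 by [].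
have E17 : va s4 17 = 2 ^ (E * k.+1).
  pose I i s := va s 1 = E /\ va s 17 = 2 ^ (E * i).
  have [] : I (va s3 0) s4; last by rewrite [va s3 0]/= addn1.
  apply: exec_for => [|i s _ [h1 h2]]; first by rewrite /I muln0.
  pose J j s' := va s' 1 = E /\ va s' 17 = 2 ^ (E * i + j).
  set s' := set_var s 18 i; have s'1 : va s' 1 = E by [].
  have : J (va s' 1) (exec (CFor 19 1 (CSet 17 (EAdd (EV 17) (EV 17)))) s').
    apply: exec_for => [|j t _ [g1 g2]]; first by rewrite /J addn0.
    by split=> //=; rewrite upd_same /upd /= g2 addnS expnS mul2n addnn.
  by rewrite /J /I s'1 mulnS [E + _]addnC.
have := FP isT _ (leqnn _); rewrite -/A A00 /= A01 E17.
exact.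
Qed.

(** The product [num_states n p * n.+1] has seven factors, each at most [Z]; this is the exponent 7.
    As [Z] is a function of [p] times the input size, its powers split in the same way. *)
Lemma params_le n p S : S = 2 + (n * n + n * ((p * n).+1 * (p * n).+1)) ->
  let Z := 2 ^ p.+1 * S in
  [/\ n.+2 <= Z ^ 7, p.+1 <= Z ^ 7, (p * n).+1 <= Z ^ 7, 2 ^ p <= Z ^ 7
    & num_states n p * n.+1 <= Z ^ 7].
Proof.
move=> SE Z.
have nS : n.+2 <= S by rewrite SE; case: (n) => // m; lia.
have T1 : 0 < 2 ^ p by rewrite expn_gt0.
have pT : p.+1 <= 2 ^ p by apply: ltn_expl.
have ZE : Z = 2 ^ p * (2 * S) by rewrite /Z expnS; lia.
have a1 : n.+2 <= Z by rewrite ZE; apply: leq_trans (_ : 1 * (2 * S) <= _);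
  [lia|rewrite leq_mul2r T1 orbT].
have a2 : 2 ^ p <= Z by rewrite ZE -[X in X <= _]muln1; apply: leq_mul; lia.
have a3 : p.+1 <= Z by apply: leq_trans a2.
have Z0 : 0 < Z by lia.
have up k : 0 < k <= 7 -> Z ^ k <= Z ^ 7 by move=> /andP[_ h]; rewrite leq_pexp2l.
have Z1 : Z <= Z ^ 7 by rewrite -{1}[Z]expn1; apply: up.
split; try by apply: leq_trans Z1.
- apply: leq_trans (up 2 isT); rewrite expnS expn1.
  by apply: leq_trans (_ : p.+1 * n.+2 <= _); [lia|apply: leq_mul].
- apply: leq_trans (_ : Z * Z * Z * Z * Z * Z * Z <= _); last by rewrite !expnS expn0;
  lia.
  by rewrite /num_states; do 6!(apply: leq_mul; last by lia).
Qed.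

Theorem theorem7 :
  exists (P : program) (f : nat -> nat) (c : nat),
    computable_fun f /\
    forall (n p : nat) (L : {set {set 'I_n}}) (pref : 'I_n -> rel (alt p)),
      links_ok L ->
      (forall i, weak_order_on n (pref i)) ->
      acyclic L ->
      exists y : seq nat,
        runs_within P (encode_instance L pref)
          (f p * size (encode_instance L pref) ^ c) y /\
        correct_answer L pref y.
Proof.
have [bp bw] := params_bounded; have [C [d Hcost]] := cost_spine bw bp.
have [P [K0 FP]] := @compiled 80 200 Cmain isT isT Cmain_wf.
pose K := K0 + 14 + C.
(* The cost is at most [C * Z ^ (7 * d)], whose power splits into [2 ^ (7 * d * p.+1)] and
   [size x ^ (7 * d)]. The summand [K] of the exponent absorbs the constants, and one more factor
   [size x] pays for copying the input and output. *)
exists P, (fun p => 2 ^ ((7 * d + K) * p.+1)), (7 * d).+1.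
split; first exact: computable_exp.
move=> n p L pref _ _ ac; set x := encode_instance L pref.
pose A := ar (exec Cmain (start x)).
have [le ca] : A 0 0 <= n.+1 /\
  correct_answer L pref [seq A 0 i.+1 | i <- iota 0 (A 0 0)] := CmainP pref ac.
have SE := size_encode L pref; rewrite -/x in SE.
exists [seq A 0 i.+1 | i <- iota 0 (A 0 0)]; split=> //.
apply: FP; first exact: encode_free.
  by apply: leq_trans le _; rewrite SE; case: (n) => // m; lia.
have [h1 h2 h3 h4 h5] := params_le SE.
set Z := 2 ^ p.+1 * size x in h1 h2 h3 h4 h5.
have Z0 : 0 < Z by rewrite muln_gt0 expn_gt0 SE.
have cst : cost Cmain (start x) <= C * Z ^ (7 * d).
  rewrite expnM; apply: Hcost; first by rewrite expn_gt0 Z0.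
  by have [] := @paramsP n p (start x) (Z ^ 7).
apply: leq_trans (_ : K * (2 ^ (7 * d * p.+1) * size x ^ (7 * d).+1) <= _); last first.
  rewrite mulnDl expnD mulnA [_ * 2 ^ (K * _)]mulnC leq_mul2r leq_mul2r.
  apply/orP; right; apply/orP; right.
  apply: leq_trans (ltnW (ltn_expl K (isT : 1 < 2))) _.
  by rewrite leq_exp2l // leq_pmulr.
set W := _ * size x ^ _.
have W1 : size x <= W.
  rewrite -[X in X <= _]mul1n; apply: leq_mul; first by rewrite expn_gt0.
  by rewrite expnS leq_pmulr // expn_gt0 SE.
have S0 : 0 < size x by rewrite SE.
have W2 : Z ^ (7 * d) <= W.
  rewrite /Z expnMn -expnM mulnC [p.+1 * _]mulnC mulnC; apply: leq_mul => //.
  by rewrite leq_pexp2l.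
have W3 : C * Z ^ (7 * d) <= C * W by rewrite leq_mul2l W2 orbT.
rewrite /K !mulnDl; apply: leq_add; [apply: leq_add|exact: leq_trans cst W3].
  by apply: leq_pmulr; apply: leq_trans W1.
by rewrite leq_mul2l W1 orbT.
Qed.
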